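(* For every connected plane Euclidean network $\mathcal{N}$, it can be determined in polynomial time whether there exists a shortcut for $\mathcal{N}_{\ell}$ and, if one exists, such a shortcut can be computed in polynomial time.
   Context: A plane Euclidean network $\mathcal{N}$ is a finite graph whose vertices are points of $\mathbb{R}^2$ and whose edges are straight-line segments between their endpoints, with no two edges crossing; edge lengths are Euclidean lengths. Its locus $\mathcal{N}_{\ell}$ is the closed set of all points lying on $\mathcal{N}$. For a closed union $X$ of finitely many segments (all intersection points being network points), $d_X(p,q)$ is the length of a shortest path from $p$ to $q$ within $X$, and $\mathrm{diam}(X)=\max_{p,q\in X}d_X(p,q)$. A shortcut for $\mathcal{N}_{\ell}$ is a straight segment $s$ with both endpoints on $\mathcal{N}_{\ell}$ (it may intersect $\mathcal{N}_{\ell}$ at further points, which become points of the network) such that $\mathrm{diam}(\mathcal{N}_{\ell}\cup s)<\mathrm{diam}(\mathcal{N}_{\ell})$. *)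

(* Defs.v *)
(* MathComp-Analysis; the plane is R * R for an arbitrary R : realType. *)
From HB Require Import structures.
From mathcomp Require Import all_boot all_order all_algebra.
From mathcomp Require Import boolp classical_sets reals constructive_ereal ereal.
From mathcomp Require polyrcf.

Set Implicit Arguments.
Unset Strict Implicit.
Unset Printing Implicit Defensive.

Import Order.TTheory GRing.Theory Num.Theory.

Local Open Scope classical_set_scope.
Local Open Scope ring_scope.

(** * Plane Euclidean networks and shortcuts *)

Section Geometry.
Context {R : realType}.
Implicit Types (p q x : R * R) (X : set (R * R)).

(* Not the norm of R * R, which is the maximum norm. *)
Definition edist p q : R :=
  Num.sqrt ((p.1 - q.1) ^+ 2 + (p.2 - q.2) ^+ 2).

Definition segment p q : set (R * R) :=
  [set x | exists2 t : R, 0 <= t <= 1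
     & x = ((1 - t) * p.1 + t * q.1, (1 - t) * p.2 + t * q.2)].

(* A path is a polygonal line p, w_1, ..., w_k; nothing is lost compared with
   arbitrary rectifiable paths when X is a finite union of segments.  The line
   may turn at any point of X, so all intersection points of the segments
   forming X act as network points. *)
Fixpoint path_within X p (w : seq (R * R)) : Prop :=
  if w is x :: w' then segment p x `<=` X /\ path_within X x w' else True.

Fixpoint path_length p (w : seq (R * R)) : R :=
  if w is x :: w' then edist p x + path_length x w' else 0.

(* Extended reals make the distance between points that are not joined by a
   path +oo.  For a connected finite union of segments the infimum and the
   supremum below are attained and finite. *)
Definition dist_within X p q : \bar R :=
  ereal_inf [set (path_length p w)%:E | w in
               [set w | path_within X p w /\ last p w = q]].

Definition diam X : \bar R :=
  ereal_sup [set d | exists p q, [/\ X p, X q & d = dist_within X p q]].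

End Geometry.

Record network (R : realType) := Network {
  nvert : nat;
  pos : 'I_nvert -> R * R;
  edges : seq ('I_nvert * 'I_nvert)
}.

Section Networks.
Context {R : realType}.
Implicit Types N : network R.

Definition edge_segment N (e : 'I_(nvert N) * 'I_(nvert N)) : set (R * R) :=
  segment (pos e.1) (pos e.2).

Definition edge_ends N (e : 'I_(nvert N) * 'I_(nvert N)) : set (R * R) :=
  [set pos e.1; pos e.2].

(* Each undirected edge is listed once, in either orientation: the last
   condition excludes both (i, j) and (j, i) being listed. *)
Definition plane_network N : Prop :=
  [/\ injective (@pos R N),
      uniq (edges N),
      forall e, e \in edges N -> e.1 != e.2
    & forall e f, e \in edges N -> f \in edges N -> e != f ->
        edge_segment e `&` edge_segment f `<=` edge_ends e `&` edge_ends f].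

Definition adjacent N : rel 'I_(nvert N) :=
  fun i j => ((i, j) \in edges N) || ((j, i) \in edges N).

Definition connected_network N : Prop :=
  (0 < nvert N)%N /\ forall i j : 'I_(nvert N), connect (@adjacent N) i j.

(* The vertices are listed separately for the network with a single vertex. *)
Definition locus N : set (R * R) :=
  range (@pos R N) `|` \bigcup_(e in [set` edges N]) edge_segment e.

(* The shortcut is the segment with endpoints p and q. *)
Definition is_shortcut N (p q : R * R) : Prop :=
  [/\ locus N p, locus N q
    & (diam (locus N `|` segment p q) < diam (locus N))%E].

Definition network_size N : nat := (nvert N + size (edges N))%N.

End Networks.

(** * The real RAM *)

(* A real RAM has two memories, indexed by the natural numbers: one for
   natural numbers, used for addresses, counters and combinatorial data, and
   one for exact real numbers.  Programs are in structured form and do not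
   depend on R: their only constants are natural numbers.  Integers can only
   be added and subtracted, and there is no rounding of a real to an integer,
   so that unit cost does not give extra power.  *)

Inductive nexpr : Type :=
| NConst of nat
| NLoad of nexpr                (* contents of the integer cell *)
| NAdd of nexpr & nexpr
| NSub of nexpr & nexpr.        (* truncated *)

(* [RRoot d k a] is the k-th real root (counted from 0, in increasing order,
   without multiplicity) of the polynomial of formal degree d whose
   coefficients are in the real cells a, ..., a + d.  Since d and k are
   literals, a given program only takes roots of polynomials of bounded
   degree: this is the usual constant-time primitive of computational geometry
   for algebraic curves of bounded degree. *)
Inductive rexpr : Type :=
| RConst of nat
| RLoad of nexpr
| RAdd of rexpr & rexpr
| RSub of rexpr & rexpr
| RMul of rexpr & rexpr
| RDiv of rexpr & rexpr
| RSqrt of rexpr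
| RRoot of nat & nat & nexpr.

Inductive bexpr : Type :=
| BNLe of nexpr & nexpr
| BRLe of rexpr & rexpr
| BNot of bexpr
| BAnd of bexpr & bexpr.

Inductive cmd : Type :=
| Skip
| NStore of nexpr & nexpr       (* address, value *)
| RStore of nexpr & rexpr
| Seq of cmd & cmd
| If of bexpr & cmd & cmd
| While of bexpr & cmd.

Record state (R : realType) := State {
  nmem : nat -> nat;
  rmem : nat -> R
}.

Section Semantics.
Context {R : realType}.
Implicit Types s : state R.

Fixpoint neval s (e : nexpr) : nat :=
  match e with
  | NConst n => n
  | NLoad a => nmem s (neval s a)
  | NAdd e1 e2 => neval s e1 + neval s e2
  | NSub e1 e2 => neval s e1 - neval s e2
  end%N.

(* 0 if there is no such root, or if the polynomial is zero. *)
Definition kth_root (p : {poly R}) (k : nat) : R :=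
  nth 0 (polyrcf.rootsR p) k.

(* Division by 0 and the square root of a negative number give 0. *)
Fixpoint reval s (e : rexpr) : R :=
  match e with
  | RConst n => n%:R
  | RLoad a => rmem s (neval s a)
  | RAdd e1 e2 => reval s e1 + reval s e2
  | RSub e1 e2 => reval s e1 - reval s e2
  | RMul e1 e2 => reval s e1 * reval s e2
  | RDiv e1 e2 => reval s e1 / reval s e2
  | RSqrt e1 => Num.sqrt (reval s e1)
  | RRoot d k a =>
      kth_root (\poly_(i < d.+1) rmem s (neval s a + i)%N) k
  end.

Fixpoint beval s (b : bexpr) : bool :=
  match b with
  | BNLe e1 e2 => (neval s e1 <= neval s e2)%N
  | BRLe e1 e2 => reval s e1 <= reval s e2
  | BNot b1 => ~~ beval s b1
  | BAnd b1 b2 => beval s b1 && beval s b2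
  end.

Definition nstore s (a v : nat) : state R :=
  State [eta nmem s with a |-> v] (rmem s).

Definition rstore s (a : nat) (v : R) : state R :=
  State (nmem s) [eta rmem s with a |-> v].

(* [exec c s t s']: started in s, the program c halts in s' after t steps.
   Every assignment and every test takes one step; the size of an expression
   is bounded by a constant that depends only on the program. *)
Inductive exec : cmd -> state R -> nat -> state R -> Prop :=
| ExecSkip s : exec Skip s 1%N s
| ExecNStore a e s :
    exec (NStore a e) s 1%N (nstore s (neval s a) (neval s e))
| ExecRStore a e s :
    exec (RStore a e) s 1%N (rstore s (neval s a) (reval s e))
| ExecSeq c1 c2 s1 s2 s3 t1 t2 :
    exec c1 s1 t1 s2 -> exec c2 s2 t2 s3 ->
    exec (Seq c1 c2) s1 (t1 + t2)%N s3
| ExecIf b c1 c2 s s' t :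
    exec (if beval s b then c1 else c2) s t s' ->
    exec (If b c1 c2) s t.+1 s'
| ExecWhileFalse b c s :
    ~~ beval s b -> exec (While b c) s 1%N s
| ExecWhileTrue b c s1 s2 s3 t1 t2 :
    beval s1 b -> exec c s1 t1 s2 -> exec (While b c) s2 t2 s3 ->
    exec (While b c) s1 (t1 + t2).+1%N s3.

Lemma exec_det c s t1 s1 t2 s2 :
  exec c s t1 s1 -> exec c s t2 s2 -> t1 = t2 /\ s1 = s2.
Proof.
move=> e1; elim: e1 t2 s2 => {c s t1 s1}.
- by move=> s t2 s2 e2; inversion e2.
- by move=> a e s t2 s2 e2; inversion e2.
- by move=> a e s t2 s2 e2; inversion e2.
- move=> c1 c2 s1 s2 s3 t1 t2 _ IH1 _ IH2 t s e2.
  inversion e2 as [| | |? ? ? ? ? ? ? E1 E2| | |]; subst.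
  by have [? ?] := IH1 _ _ E1; subst; have [-> ->] := IH2 _ _ E2.
- move=> b c1 c2 s s' t _ IH t2 s2 e2.
  inversion e2 as [| | | |? ? ? ? ? ? E1| |]; subst.
  by have [-> ->] := IH _ _ E1.
- move=> b c s nb t2 s2 e2.
  inversion e2 as [| | | | | |? ? ? ? ? ? ? hb]; subst => //.
  by rewrite hb in nb.
- move=> b c s1 s2 s3 t1 t2 hb _ IH1 _ IH2 t s e2.
  inversion e2 as [| | | | |? ? ? nb|? ? ? ? ? ? ? ? E1 E2]; subst.
    by rewrite hb in nb.
  by have [? ?] := IH1 _ _ E1; subst; have [-> ->] := IH2 _ _ E2.
Qed.

(* Integer cells: the numbers of vertices and of edges, then the two endpoints
   of each edge.  Real cells: the two coordinates of each vertex.  All other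
   cells contain 0. *)
Definition network_input (N : network R) : state R :=
  State
    (nth 0%N ([:: nvert N; size (edges N)] ++
              flatten [seq [:: val e.1; val e.2] | e <- edges N]))
    (nth 0 (flatten [seq [:: (pos i).1; (pos i).2] | i : 'I_(nvert N)])).

End Semantics.

(* Main.v *)
Require Import Defs.
From HB Require Import structures.
From mathcomp Require Import all_boot all_order all_algebra.
From mathcomp Require Import boolp classical_sets reals constructive_ereal ereal.
From mathcomp Require Import zify ring lra.
From mathcomp Require polyrcf polyorder qe_rcf_th qe_rcf.

Set Implicit Arguments.
Unset Strict Implicit.
Unset Printing Implicit Defensive.

Import Order.TTheory GRing.Theory Num.Theory.

Local Open Scope classical_set_scope.
Local Open Scope ring_scope.

(* A shortest path in the augmented network uses the segment pq only between its
   first and its last point on pq, so "pq is a shortcut" is a first-order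
   condition on the coordinates of p and q: its quantifiers range over edges and
   over a fixed number of reals, and its atoms are polynomial inequalities in the
   input and the table of vertex distances (Floyd-Warshall).

   A real quantifier is replaced by a choice among sample points: if the atoms are
   polynomials p_i(X), then every sign condition met by the p_i is met at a root of
   X, of some p_i(X), p_i(X + 1), p_i(X - 1) or of some (p_i p_j)'.  The sign of a
   polynomial at the k-th root of another one is, for fixed degrees, a
   semialgebraic predicate of the coefficients (Tarski-Seidenberg), so it is again
   a boolean combination of polynomial inequalities.  The number of atoms over all
   choices of edges is polynomial, hence quantification over sample points amounts
   to more quantifiers over edges, and a formula with only such quantifiers is
   evaluated by nested loops in polynomial time.  The coordinates of a shortcut are
   found one after another by trying the sample points. *)

(** * Semialgebraic predicates with rational coefficients *)

(** Tarski-Seidenberg cannot be applied to the shortcut condition as a whole: once the quantifiers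
    over edges are expanded, the number of atoms grows with the network and elimination is no longer
    polynomial. The formula is therefore kept at a fixed size, with quantified indices into arrays,
    and elimination is used only on one pair of polynomials of fixed degree at a time, namely an
    atom and the sample polynomial whose root is put into it. The sample points make this possible,
    because each of them involves at most two atoms. Rationality has to be followed through the
    whole elimination procedure: its formulas may contain arbitrary constants of the field, whereas
    the constants of a program are natural numbers. No diameter is ever computed. Being a shortcut
    means that some number r separates the two diameters, and r is just one more quantified real. *)

Inductive pterm : Type :=
| PVar of nat
| PConst of rat
| PAdd of pterm & pterm
| PMul of pterm & pterm.

Section Semialgebraic.
Context {R : rcfType}.
Implicit Types (e : seq R) (S : seq R -> Prop).

Fixpoint peval e (t : pterm) : R :=
  match t with
  | PVar i => e`_i
  | PConst c => ratr c
  | PAdd t1 t2 => peval e t1 + peval e t2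
  | PMul t1 t2 => peval e t1 * peval e t2
  end.

Definition clause_holds e (c : seq pterm * seq pterm) : bool :=
  all (fun t => peval e t == 0) c.1 && all (fun t => 0 < peval e t) c.2.

(** A disjunctive normal form whose clauses, made of equations and strict inequalities, have the
    shape that the root counting of [qe_rcf] takes as input. Coefficients are rational although
    points have coordinates in R; coordinates beyond the end of the list read as 0. *)
Definition semialg S : Prop :=
  exists cl, forall e, S e <-> has (clause_holds e) cl.

Lemma semialg_ext S S' : (forall e, S e <-> S' e) -> semialg S -> semialg S'.
Proof. by move=> eqS [cl h]; exists cl => e; rewrite -eqS. Qed.

Lemma semialg_or S S' :
  semialg S -> semialg S' -> semialg (fun e => S e \/ S' e).
Proof.
move=> [cl h] [cl' h']; exists (cl ++ cl') => e; rewrite has_cat h h'.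
by split=> /orP.
Qed.

Lemma semialg_and S S' :
  semialg S -> semialg S' -> semialg (fun e => S e /\ S' e).
Proof.
move=> [cl h] [cl' h'].
exists [seq (c.1 ++ c'.1, c.2 ++ c'.2) | c <- cl, c' <- cl'] => e.
rewrite h h'.
suff -> : has (clause_holds e)
    [seq (c.1 ++ c'.1, c.2 ++ c'.2) | c <- cl, c' <- cl'] =
    has (clause_holds e) cl && has (clause_holds e) cl' by split=> /andP.
elim: cl {h} => //= c cl IH; rewrite has_cat IH has_map andb_orl; congr orb.
elim: cl' {h' IH} => [|c' cl' IH] /=; first by rewrite andbF.
rewrite IH andb_orr; congr orb.
by rewrite /clause_holds /= !all_cat; do 4?case: all.
Qed.

Lemma semialg_pos t : semialg (fun e => 0 < peval e t).
Proof.
by exists [:: ([::], [:: t])] => e; rewrite /clause_holds /= !andbT orbF.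
Qed.

Lemma semialg_eq0 t : semialg (fun e => peval e t = 0).
Proof.
exists [:: ([:: t], [::])] => e; rewrite /clause_holds /= !andbT orbF.
by split=> /eqP.
Qed.

Lemma semialg_bool (b : bool) : semialg (fun=> b).
Proof. by case: b; [exists [:: ([::], [::])] | exists [::]] => e. Qed.

Definition popp t := PMul (PConst (-1)) t.

Lemma peval_opp e t : peval e (popp t) = - peval e t.
Proof. by rewrite /= rmorphN1 mulN1r. Qed.

Lemma semialg_npos t : semialg (fun e => ~ 0 < peval e t).
Proof.
apply: (@semialg_ext (fun e => peval e t = 0 \/ 0 < peval e (popp t))).
  move=> e; rewrite peval_opp oppr_gt0; split.
    by move=> [->|h]; [rewrite ltxx|move/lt_trans/(_ h); rewrite ltxx].
  by move=> /negP; rewrite -leNgt le_eqVlt => /orP[/eqP|]; [left|right].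
by apply: semialg_or; [apply: semialg_eq0|apply: semialg_pos].
Qed.

Lemma semialg_neq0 t : semialg (fun e => ~ peval e t = 0).
Proof.
apply: (@semialg_ext (fun e => 0 < peval e t \/ 0 < peval e (popp t))).
  move=> e; rewrite peval_opp oppr_gt0; split.
    by move=> + h0; rewrite h0 ltxx; case.
  by move=> /eqP; rewrite neq_lt => /orP[]; [right|left].
by apply: semialg_or; apply: semialg_pos.
Qed.

Lemma semialg_not S : semialg S -> semialg (fun e => ~ S e).
Proof.
move=> [cl h]; apply: (@semialg_ext (fun e => ~ has (clause_holds e) cl)).
  by move=> e; rewrite h.
have hF : semialg (fun e => ~ true).
  by apply: semialg_ext (semialg_bool false) => e; split=> // /(_ isT).
elim: cl {S h} => [|[sp sq] cl IH].
  by apply: semialg_ext (semialg_bool true) => e; split.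
have hnp : semialg (fun e => ~ all (fun t => peval e t == 0) sp).
  elim: sp {IH} => [|t sp IH] //.
  apply: semialg_ext (semialg_or (semialg_neq0 t) IH) => e /=.
  case: eqP => /= h; last by split=> // _; left.
  by split=> [[]|] //; right.
have hnq : semialg (fun e => ~ all (fun t => 0 < peval e t) sq).
  elim: sq {IH hnp} => [|t sq IH] //.
  apply: semialg_ext (semialg_or (semialg_npos t) IH) => e /=.
  case: (0 < _) => //=; last by split=> // _; left.
  by split=> [[/(_ isT)|]|] //; right.
apply: semialg_ext (semialg_and (semialg_or hnp hnq) IH) => e /=.
rewrite /clause_holds /=; split=> [[h1 h2] /orP[/andP[p q]|//]|h].
  by case: h1.
split; last by move=> hc; apply: h; rewrite hc orbT.
case p: (all _ sp); last by left.
by right=> q; apply: h; rewrite p q.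
Qed.

(** * Rationality of the formulas produced by real quantifier elimination *)

Notation qterm := (qe_rcf.term R).
Notation qform := (qe_rcf.formula R).

Fixpoint qterm_of (t : pterm) : qterm :=
  match t with
  | PVar i => qe_rcf.Var R i
  | PConst c => qe_rcf.Const (ratr c)
  | PAdd t1 t2 => qe_rcf.Add (qterm_of t1) (qterm_of t2)
  | PMul t1 t2 => qe_rcf.Mul (qterm_of t1) (qterm_of t2)
  end.

Lemma eval_qterm_of e t : qe_rcf.eval e (qterm_of t) = peval e t.
Proof. by elim: t => //= t1 -> t2 ->. Qed.

(** Terms of [qe_rcf] may contain any constant of R. The condition is semantic, so it does not
    matter how a term has been built. *)
Definition rational_term (t : qterm) : Prop :=
  exists p, forall e, qe_rcf.eval e t = peval e p.

Definition rational_poly (p : seq qterm) : Prop :=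
  foldr (fun t P => rational_term t /\ P) True p.

Definition rational_polys (ps : seq (seq qterm)) : Prop :=
  foldr (fun p P => rational_poly p /\ P) True ps.

Definition semialg_form (f : qform) : Prop :=
  semialg (fun e => qe_rcf.qf_eval e f).

Lemma rt_const (c : rat) : rational_term (qe_rcf.Const (ratr c)).
Proof. by exists (PConst c). Qed.

Lemma rt_const0 : rational_term (qe_rcf.Const 0).
Proof. by exists (PConst 0) => e /=; rewrite rmorph0. Qed.

Lemma rt_nat n : rational_term (qe_rcf.NatConst R n).
Proof. by exists (PConst n%:R) => e /=; rewrite ratr_nat. Qed.

Lemma rt_add t u :
  rational_term t -> rational_term u -> rational_term (qe_rcf.Add t u).
Proof. by move=> [p hp] [q hq]; exists (PAdd p q) => e /=; rewrite hp hq. Qed.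

Lemma rt_mul t u :
  rational_term t -> rational_term u -> rational_term (qe_rcf.Mul t u).
Proof. by move=> [p hp] [q hq]; exists (PMul p q) => e /=; rewrite hp hq. Qed.

Lemma rt_opp t : rational_term t -> rational_term (qe_rcf.Opp t).
Proof. by move=> [p hp]; exists (popp p) => e; rewrite peval_opp /= hp. Qed.

Lemma rt_exp t n : rational_term t -> rational_term (qe_rcf.Exp t n).
Proof.
move=> [p hp]; elim: n => [|n [q hq]].
  by exists (PConst 1) => e /=; rewrite expr0 rmorph1.
by exists (PMul p q) => e /=; rewrite exprS -hp -hq.
Qed.

Lemma sf_bool b : semialg_form (qe_rcf.Bool b).
Proof. exact: semialg_bool. Qed.

Lemma sf_eq0 t : rational_term t ->
  semialg_form (qe_rcf.Equal t (qe_rcf.NatConst R 0)).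
Proof.
move=> [p hp]; apply: semialg_ext (semialg_eq0 p) => e /=.
by rewrite hp; split=> /eqP.
Qed.

Lemma sf_lt t u : rational_term t -> rational_term u ->
  semialg_form (qe_rcf.Lt t u).
Proof.
move=> [p hp] [q hq].
apply: semialg_ext (semialg_pos (PAdd q (popp p))) => e.
by rewrite /= rmorphN1 mulN1r hp hq subr_gt0.
Qed.

Lemma sf_and f g : semialg_form f -> semialg_form g ->
  semialg_form (qe_rcf.And f g).
Proof. by move=> hf hg; apply: semialg_ext (semialg_and hf hg) => e; split=> /andP. Qed.

Lemma sf_or f g : semialg_form f -> semialg_form g ->
  semialg_form (qe_rcf.Or f g).
Proof. by move=> hf hg; apply: semialg_ext (semialg_or hf hg) => e; split=> /orP. Qed.

Lemma sf_not f : semialg_form f -> semialg_form (qe_rcf.Not f).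
Proof. by move=> hf; apply: semialg_ext (semialg_not hf) => e; split=> /negP. Qed.

Lemma sf_if p f g : semialg_form p -> semialg_form f -> semialg_form g ->
  semialg_form (qe_rcf.If p f g).
Proof.
by move=> hp hf hg; apply: sf_or; apply: sf_and => //; apply: sf_not.
Qed.

(** The functions of [qe_rcf] are in continuation-passing style: they branch on signs of
    coefficients and hand their result to [k]. This lemma and those below carry one fact through
    each of them: rational data and a semialgebraic continuation give a semialgebraic formula. *)
Lemma sf_Size k p : (forall n, semialg_form (k n)) -> rational_poly p ->
  semialg_form (qe_rcf.Size p k).
Proof.
elim: p k => [|c p IH] k hk /=; first by [].
move=> [hc hp]; apply: IH => // -[|m] //.
by apply: sf_if => //; apply: sf_eq0.
Qed.

Lemma sf_Isnull k p : (forall n, semialg_form (k n)) -> rational_poly p ->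
  semialg_form (qe_rcf.Isnull p k).
Proof. by move=> hk; apply: sf_Size. Qed.

Lemma sf_LeadCoef k p : (forall t, rational_term t -> semialg_form (k t)) ->
  rational_poly p -> semialg_form (qe_rcf.LeadCoef p k).
Proof.
elim: p k => [|c p IH] k hk /=; first by move=> _; apply/hk/rt_const0.
move=> [hc hp]; apply: IH => // t ht.
by apply: sf_if; [apply: sf_eq0|apply: hk|apply: hk].
Qed.

Lemma rp_AmulXn t n : rational_term t -> rational_poly (qe_rcf.AmulXn t n).
Proof. by move=> ht; elim: n => [|n IH] /=; split=> //; apply: rt_const0. Qed.

Lemma rp_add p q : rational_poly p -> rational_poly q ->
  rational_poly (qe_rcf.AddPoly p q).
Proof.
elim: p q => [|a p IH] [|b q] //= [ha hp] [hb hq].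
by split; [apply: rt_add|apply: IH].
Qed.

Lemma rp_scale t p : rational_term t -> rational_poly p ->
  rational_poly (qe_rcf.ScalPoly t p).
Proof.
move=> ht; elim: p => //= a p IH [ha hp].
by split; [apply: rt_mul|apply: IH].
Qed.

Lemma rp_mul p q : rational_poly p -> rational_poly q ->
  rational_poly (qe_rcf.MulPoly p q).
Proof.
move=> hp hq; elim: p hp => //= a p IH [ha hp].
by apply: rp_add; [apply: rp_scale|split; [apply: rt_nat|apply: IH]].
Qed.

Lemma rp_one : rational_poly [:: qe_rcf.NatConst R 1].
Proof. by split=> //; apply: rt_nat. Qed.

Lemma rp_exp p n : rational_poly p -> rational_poly (qe_rcf.ExpPoly p n).
Proof.
move=> hp; rewrite /qe_rcf.ExpPoly; case: n => [|n]; first exact: rp_one.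
rewrite iteropS; elim: n => //= n IH; exact: rp_mul.
Qed.

Lemma rp_opp p : rational_poly p -> rational_poly (qe_rcf.OppPoly p).
Proof.
apply: rp_scale; exists (PConst (-1)) => e /=; by rewrite rmorphN1.
Qed.

Lemma rp_deriv p : rational_poly p -> rational_poly (qe_rcf.Deriv p).
Proof.
elim: p => //= a p IH [ha hp]; apply: rp_add => //; split; last exact: IH.
exact: rt_nat.
Qed.

Lemma rp_const0 : rational_poly [:: qe_rcf.Const 0].
Proof. by split=> //; apply: rt_const0. Qed.

Lemma sf_Rediv_rec_loop q sq cq c qq r n k :
  (forall d, rational_poly d.1.2 -> rational_poly d.2 -> semialg_form (k d)) ->
  rational_poly q -> rational_term cq -> rational_poly qq -> rational_poly r ->
  semialg_form (qe_rcf.Rediv_rec_loop q sq cq c qq r n k).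
Proof.
move=> hk hq hcq; elim: n c qq r => [|n IH] c qq r hqq hr /=;
  apply: sf_Size => // sr; case: ifP => _; try exact: hk;
  apply: sf_LeadCoef => // lr hlr.
all: have hm := rp_AmulXn (sr - sq) hlr.
all: have hcq' : rational_poly [:: cq] by [].
all: have h1 : rational_poly (qe_rcf.AddPoly (qe_rcf.MulPoly qq [:: cq])
   (qe_rcf.AmulXn lr (sr - sq))) by apply: rp_add => //; apply: rp_mul.
all: have h2 : rational_poly (qe_rcf.AddPoly (qe_rcf.MulPoly r [:: cq])
  (qe_rcf.OppPoly (qe_rcf.MulPoly (qe_rcf.AmulXn lr (sr - sq)) q)))
  by apply: rp_add; [apply: rp_mul|apply/rp_opp/rp_mul].
  exact: hk.
exact: IH.
Qed.

Lemma sf_Rediv p q k :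
  (forall d, rational_poly d.1.2 -> rational_poly d.2 -> semialg_form (k d)) ->
  rational_poly p -> rational_poly q -> semialg_form (qe_rcf.Rediv p q k).
Proof.
move=> hk hp hq; apply: sf_Isnull => // -[].
  by apply: hk => //; apply: rp_const0.
apply: sf_Size => // sq; apply: sf_Size => // sp.
apply: sf_LeadCoef => // lq hlq; apply: sf_Rediv_rec_loop => //.
exact: rp_const0.
Qed.

Lemma sf_Rgcd_loop n p q k :
  (forall r, rational_poly r -> semialg_form (k r)) ->
  rational_poly p -> rational_poly q ->
  semialg_form (qe_rcf.Rgcd_loop n p q k).
Proof.
move=> hk; elim: n p q => [|n IH] p q hp hq /=;
  apply: sf_Rediv => // d _ hd; apply: sf_Isnull => // -[]; auto.
Qed.

Lemma sf_Rgcd p q k :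
  (forall r, rational_poly r -> semialg_form (k r)) ->
  rational_poly p -> rational_poly q -> semialg_form (qe_rcf.Rgcd p q k).
Proof.
have aux p1 q1 : (forall r, rational_poly r -> semialg_form (k r)) ->
    rational_poly p1 -> rational_poly q1 ->
    semialg_form (qe_rcf.Isnull p1 (fun b => if b then k q1 else
      qe_rcf.Size p1 (fun n => qe_rcf.Rgcd_loop n p1 q1 k))).
  move=> hk hp hq; apply: sf_Isnull => // -[]; first exact: hk.
  by apply: sf_Size => // n; apply: sf_Rgcd_loop.
move=> hk hp hq; apply: sf_Size => // n; apply: sf_Size => // m.
by case: ifP => _; apply: aux.
Qed.

Lemma sf_BigRgcd ps k :
  (forall r, rational_poly r -> semialg_form (k r)) ->
  rational_polys ps -> semialg_form (qe_rcf.BigRgcd ps k).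
Proof.
elim: ps k => [|p ps IH] k hk /=; first by move=> _; apply/hk/rp_const0.
by move=> [hp hps]; apply: IH => // r hr; apply: sf_Rgcd.
Qed.

Lemma sf_Changes s k : (forall n, semialg_form (k n)) -> rational_poly s ->
  semialg_form (qe_rcf.Changes s k).
Proof.
elim: s k => [|a s IH] k hk //= [ha hs]; apply: IH => // v.
apply: sf_if => //; apply: sf_lt; last exact: rt_nat.
apply: rt_mul => //; case: s hs => [|b s] //=; last by case.
by move=> _; apply: rt_nat.
Qed.

Lemma sf_SeqPInfty ps k :
  (forall s, rational_poly s -> semialg_form (k s)) ->
  rational_polys ps -> semialg_form (qe_rcf.SeqPInfty ps k).
Proof.
elim: ps k => [|p ps IH] k hk /=; first by move=> _; apply: hk.
move=> [hp hps]; apply: sf_LeadCoef => // lp hlp; apply: IH => // s hs.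
exact: hk.
Qed.

Lemma sf_SeqMInfty ps k :
  (forall s, rational_poly s -> semialg_form (k s)) ->
  rational_polys ps -> semialg_form (qe_rcf.SeqMInfty ps k).
Proof.
elim: ps k => [|p ps IH] k hk /=; first by move=> _; apply: hk.
move=> [hp hps]; apply: sf_LeadCoef => // lp hlp; apply: sf_Size => // n.
apply: IH => // s hs; apply: hk; split=> //; apply: rt_mul => //.
by apply: rt_exp; exists (PConst (-1)) => e /=; rewrite rmorphN1.
Qed.

Lemma sf_ChangesPoly ps k : (forall i, semialg_form (k i)) ->
  rational_polys ps -> semialg_form (qe_rcf.ChangesPoly ps k).
Proof.
move=> hk hps; apply: sf_SeqMInfty => // m hm; apply: sf_SeqPInfty => // p hp.
by apply: sf_Changes => // vm; apply: sf_Changes.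
Qed.

Lemma sf_NextMod p q k : (forall r, rational_poly r -> semialg_form (k r)) ->
  rational_poly p -> rational_poly q -> semialg_form (qe_rcf.NextMod p q k).
Proof.
move=> hk hp hq; apply: sf_LeadCoef => // lq hlq.
apply: sf_Rediv => // d _ _; apply: sf_Rediv => // d' _ hd'.
by apply/hk/rp_scale => //; apply/rt_opp/rt_exp.
Qed.

Lemma sf_ModsAux p q n k :
  (forall ps, rational_polys ps -> semialg_form (k ps)) ->
  rational_poly p -> rational_poly q -> semialg_form (qe_rcf.ModsAux p q n k).
Proof.
elim: n p q k => [|n IH] p q k hk hp hq /=; first exact: hk.
apply: sf_Isnull => // -[]; first exact: hk.
apply: sf_NextMod => // r hr; apply: IH => // ps hps.
exact: hk.
Qed.

Lemma sf_TaqR p q k : (forall i, semialg_form (k i)) ->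
  rational_poly p -> rational_poly q -> semialg_form (qe_rcf.TaqR p q k).
Proof.
move=> hk hp hq.
have h : rational_poly (qe_rcf.MulPoly (qe_rcf.Deriv p) q).
  by apply: rp_mul => //; apply: rp_deriv.
apply: sf_Size => // n; apply: sf_Size => // m.
by apply: sf_ModsAux => // ps hps; apply: sf_ChangesPoly.
Qed.

Lemma rp_nth ps i : rational_polys ps -> rational_poly (nth [::] ps i).
Proof. by elim: ps i => [|p ps IH] [|i] //= [hp hps] //; apply: IH. Qed.

Lemma rp_PolyComb sq sc : rational_polys sq ->
  rational_poly (qe_rcf.PolyComb sq sc).
Proof.
move=> hsq; rewrite /qe_rcf.PolyComb.
elim: (iota _ _) => [|i s IH] /=; first exact: rp_one.
by apply: rp_mul => //; apply/rp_exp/rp_nth.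
Qed.

Lemma rp_Pcq sq i : rational_polys sq -> rational_poly (qe_rcf.Pcq sq i).
Proof.
move=> hsq; apply: rp_nth; elim: (qe_rcf_th.sg_tab _) => //= s l IH.
by split=> //; apply: rp_PolyComb.
Qed.

Lemma sf_TaqsR p sq i k : (forall t, rational_term t -> semialg_form (k t)) ->
  rational_poly p -> rational_polys sq -> semialg_form (qe_rcf.TaqsR p sq i k).
Proof.
move=> hk hp hsq; apply: sf_TaqR => // [n|]; last exact: rp_Pcq.
by apply: hk; exists (PConst n%:~R) => e /=; rewrite ratr_int.
Qed.

(** These weights turn Tarski queries into numbers of roots. They are entries of the inverse of an
    integer matrix, and inversion commutes with the embedding of the rationals. *)
Lemma coefs_rat n i : exists c : rat, qe_rcf_th.coefs R n i = ratr c.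
Proof.
exists (qe_rcf_th.coefs rat n i).
rewrite /qe_rcf_th.coefs.
have [lt_i|le_i] := ltnP i (3 ^ n); last first.
  by rewrite !nth_default ?rmorph0 // size_map size_enum_ord.
rewrite !(nth_map (Ordinal lt_i)) -?enumT ?size_enum_ord //.
rewrite !castmxE.
have -> : map_mx (intr : int -> R) (qe_rcf_th.ctmat n) =
   map_mx ratr (map_mx (intr : int -> rat) (qe_rcf_th.ctmat n)).
  by apply/matrixP => a b; rewrite !mxE ratr_int.
by rewrite -map_invmx !mxE.
Qed.

Lemma rt_Coefs n i : rational_term (qe_rcf.Coefs R n i).
Proof.
have [c hc] := coefs_rat n i.
by exists (PConst c) => e; rewrite qe_rcf.eval_Coefs.
Qed.

Lemma sf_CcountWeak p sq k : (forall t, rational_term t -> semialg_form (k t)) ->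
  rational_poly p -> rational_polys sq -> semialg_form (qe_rcf.CcountWeak p sq k).
Proof.
move=> hk hp hsq; rewrite /qe_rcf.CcountWeak.
set aux := (fix aux s i k := match i with 0 => _ | _ => _ end).
have : rational_term (qe_rcf.NatConst R 0) by apply: rt_nat.
elim: (3 ^ size sq)%N (qe_rcf.NatConst R 0) => [|n IH] s hs /=; first exact: hk.
apply: sf_TaqsR => // x hx; apply: IH; apply: rt_add => //.
by apply: rt_mul => //; apply: rt_Coefs.
Qed.

Lemma rp_BoundingPoly sq : rational_polys sq ->
  rational_poly (qe_rcf.BoundingPoly sq).
Proof.
move=> h; apply: rp_deriv; elim: sq h => [|p sq IH] /=.
  by move=> _; apply: rp_one.
by move=> [hp hsq]; apply: rp_mul => //; apply: IH.
Qed.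

Lemma sf_CcountGt0 sp sq : rational_polys sp -> rational_polys sq ->
  semialg_form (qe_rcf.CcountGt0 sp sq).
Proof.
move=> hsp hsq; apply: sf_BigRgcd => // p hp; apply: sf_Isnull => // -[] /=.
  apply: sf_CcountWeak => //; last exact: rp_BoundingPoly.
  move=> c hc; apply: sf_or; last apply: sf_or.
  - elim: sq {sp hsp} hsq => [|q sq IH] /=; first by move=> _; apply: sf_bool.
    move=> [hq hsq]; apply: sf_and; last exact: IH.
    by apply: sf_LeadCoef => // t ht; apply: sf_lt => //; apply: rt_nat.
  - elim: sq {sp hsp} hsq => [|q sq IH] /=; first by move=> _; apply: sf_bool.
    move=> [hq hsq]; apply: sf_and; last exact: IH.
    apply: sf_Size => // n; apply: sf_LeadCoef => // t ht.
    apply: sf_lt; first exact: rt_nat.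
    by apply: rt_mul => //; apply/rt_exp/rt_opp/rt_nat.
  - by apply: sf_lt => //; apply: rt_nat.
by apply: sf_CcountWeak => // c hc; apply: sf_lt => //; apply: rt_nat.
Qed.

Lemma rp_abstrX i t : rational_poly (qe_rcf.abstrX i (qterm_of t)).
Proof.
elim: t => [n|c|t1 h1 t2 h2|t1 h1 t2 h2] /=.
- case: ifP => _; split=> //; try split=> //; try exact: rt_nat.
  by exists (PVar n).
- by split=> //; apply: rt_const.
- exact: rp_add.
- exact: rp_mul.
Qed.

(** Tarski-Seidenberg projection. The quantifier commutes with the disjunction of clauses; for a
    single clause [qe_rcf.CcountGt0] is a quantifier-free equivalent, rational by the lemmas
    above. *)
Lemma semialg_ex S i :
  semialg S -> semialg (fun e => exists x, S (set_nth 0 e i x)).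
Proof.
move=> [cl hcl].
apply: (@semialg_ext
    (fun e => exists x, has (clause_holds (set_nth 0 e i x)) cl)).
  by move=> e; split=> -[x hx]; exists x; apply/hcl.
elim: cl {S hcl} => [|c cl IH].
  by apply: semialg_ext (semialg_bool false) => e; split=> // -[].
pose ab := qe_rcf.abstrX i \o qterm_of.
have hab ts : rational_polys (map ab ts).
  by elim: ts => //= t ts IHt; split=> //; apply: rp_abstrX.
have hc : semialg (fun e => exists x, clause_holds (set_nth 0 e i x) c).
  apply: semialg_ext (sf_CcountGt0 (hab c.1) (hab c.2)) => e.
  rewrite qe_rcf.eval_CcountGt0.
  have hq (a : pred R) ts x :
      \big[andb/true]_(p <- map (qe_rcf.eval_poly e) (map ab ts)) a p.[x] =
      all (fun t => a (peval (set_nth 0 e i x) t)) ts.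
    by rewrite big_all !all_map; apply: eq_all => t /=;
      rewrite qe_rcf.abstrXP eval_qterm_of.
  split=> [/qe_rcf_th.ccount_gt0P[x]|[x hx]].
    by rewrite (hq (fun y => y == 0)) (hq (fun y => 0 < y)); exists x.
  apply/qe_rcf_th.ccount_gt0P; exists x.
  by rewrite (hq (fun y => y == 0)) (hq (fun y => 0 < y)).
apply: semialg_ext (semialg_or hc IH) => e; split.
  by case=> -[x hx]; exists x => /=; rewrite hx ?orbT.
by move=> [x /= /orP[hx|hx]]; [left|right]; exists x.
Qed.

End Semialgebraic.

(** * The k-th root as a semialgebraic function of the coefficients *)

Section KthRoot.
Context {R : realType}.
Implicit Types (e : seq R) (p : {poly R}) (x : R).

(** A first-order description of the increasing list of roots: each root is tied to the previous one
    by the absence of roots in between. The base case rules out the zero polynomial for every k. *)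
Fixpoint is_kth_root p (k : nat) x : Prop :=
  if k is k'.+1 then
    root p x /\ exists y, [/\ is_kth_root p k' y, y < x
      & ~ exists z, [/\ y < z, z < x & root p z]]
  else [/\ p <> 0, root p x & ~ exists z, z < x /\ root p z].

Lemma mem_rootsR p x : p != 0 -> (x \in polyrcf.rootsR p) = root p x.
Proof. by move=> p0; rewrite -(polyrcf.roots_on_rootsR p0). Qed.

Lemma is_kth_rootP p k x :
  is_kth_root p k x <->
  [/\ p != 0, (k < size (polyrcf.rootsR p))%N & x = kth_root p k].
Proof.
rewrite /kth_root; set s := polyrcf.rootsR p.
have s_sorted : sorted <%R s by apply: polyrcf.sorted_roots.
have lt_s : {in gtn (size s) &, {mono nth 0 s : i j / (i < j)%N >-> i < j}}.
  by move=> i j hi hj; rewrite (lt_sorted_ltn_nth 0 s_sorted).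
have mem_s z : p != 0 -> root p z ->
    exists2 i, (i < size s)%N & z = nth 0 s i.
  move=> p0; rewrite -mem_rootsR // -/s => zs.
  by exists (index z s); rewrite ?index_mem ?nth_index.
have root_s i : p != 0 -> (i < size s)%N -> root p (nth 0 s i).
  by move=> p0 hi; rewrite -mem_rootsR // mem_nth.
elim: k x => [|k IH] x /=.
  split.
    move=> [/eqP p0 rx nz]; have [[|i] hi xE] := mem_s _ p0 rx; first by split.
    have hs : (0 < size s)%N by apply: leq_ltn_trans hi.
    case: nz; exists (nth 0 s 0); rewrite xE lt_s ?inE //.
    by split=> //; apply: root_s.
  move=> [p0 hs ->]; split; [exact/eqP|exact: root_s|].
  move=> [z [zx rz]]; have [i hi zE] := mem_s _ p0 rz.
  by move: zx; rewrite zE lt_s ?inE.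
split.
  move=> [rx [y [/IH[p0 hk ->] yx nz]]].
  have [i hi xE] := mem_s _ p0 rx.
  move: yx; rewrite xE lt_s ?inE // => ki.
  have [ik|ik] := leqP i k.+1.
    by have -> : k.+1 = i by apply/eqP; rewrite eqn_leq ki ik.
  have hk1 : (k.+1 < size s)%N by apply: ltn_trans hi.
  case: nz; exists (nth 0 s k.+1); rewrite xE !lt_s ?inE //.
  by split=> //; apply: root_s.
move=> [p0 hk xE]; have hk' : (k < size s)%N by apply: ltnW.
split; first by rewrite xE; apply: root_s.
exists (nth 0 s k); split; first by apply/IH.
  by rewrite xE lt_s ?inE.
move=> [z [+ + rz]]; have [i hi ->] := mem_s _ p0 rz.
rewrite xE !lt_s ?inE // => h1 h2.
by move: (leq_trans h1 h2); rewrite ltnn.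
Qed.

Definition env_poly (a d : nat) e : {poly R} := \poly_(i < d) e`_(a + i).

Fixpoint env_horner (a d j : nat) : pterm :=
  if d is d'.+1 then PAdd (PVar a) (PMul (PVar j) (env_horner a.+1 d' j))
  else PConst 0.

Lemma peval_env_horner e a d j :
  peval e (env_horner a d j) = (env_poly a d e).[e`_j].
Proof.
elim: d a => [|d IH] a /=; first by rewrite /env_poly poly_def big_ord0 horner0 rmorph0.
rewrite IH /env_poly !horner_poly big_ord_recl addn0 expr0 mulr1; congr (_ + _).
rewrite mulr_sumr; apply: eq_bigr => i _.
by rewrite lift0 addSnnS exprS mulrCA.
Qed.

Lemma env_poly_set_nth e a d j x : (a + d <= j)%N ->
  env_poly a d (set_nth 0 e j x) = env_poly a d e.
Proof.
move=> hj; rewrite /env_poly; apply/polyP => i; rewrite !coef_poly.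
case: ifP => // hi; rewrite nth_set_nth /= ifF //.
by apply/negbTE; rewrite neq_ltn (leq_trans _ hj) // ltn_add2l.
Qed.

Lemma semialg_env_poly_neq0 a d : semialg (fun e => env_poly a d e <> 0).
Proof.
apply: semialg_not; elim: d a => [|d IH] a.
  apply: semialg_ext (semialg_bool true) => e.
  by rewrite /env_poly poly_def big_ord0.
apply: semialg_ext (semialg_and (semialg_eq0 (PVar a)) (IH a.+1)) => e /=.
split.
  move=> [h0 h]; apply/polyP => -[|i]; rewrite coef_poly coef0 ?addn0 //=.
  by move/polyP/(_ i): h; rewrite coef_poly coef0 addSnnS ltnS.
move=> /polyP h; split; first by have := h 0%N; rewrite coef_poly coef0 addn0.
by apply/polyP => i; have := h i.+1; rewrite !coef_poly !coef0 addSnnS ltnS.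
Qed.

Lemma semialg_root a d j : semialg (fun e => root (env_poly a d e) e`_j).
Proof.
apply: semialg_ext (semialg_eq0 (env_horner a d j)) => e.
by rewrite peval_env_horner; split=> /rootP.
Qed.

Lemma semialg_lt i j : semialg (fun e => e`_i < e`_j).
Proof.
apply: semialg_ext (semialg_pos (PAdd (PVar j) (popp (PVar i)))) => e.
by rewrite /= rmorphN1 mulN1r subr_gt0.
Qed.

(** The coefficients lie below coordinate j, so j.+1 and j.+2 are free for the previous root and for
    a root in between; writing there does not disturb the polynomial. *)
Lemma semialg_is_kth_root a d k j : (a + d <= j)%N ->
  semialg (fun e => is_kth_root (env_poly a d e) k e`_j).
Proof.
elim: k j => [|k IH] j hj /=.
  have h1 := semialg_not (semialg_ex j.+1
    (semialg_and (semialg_lt j.+1 j) (semialg_root a d j.+1))).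
  apply: semialg_ext (semialg_and (semialg_env_poly_neq0 a d)
    (semialg_and (semialg_root a d j) h1)) => e.
  have hx x : ((set_nth 0 e j.+1 x)`_j = e`_j) * ((set_nth 0 e j.+1 x)`_j.+1 = x).
    by split; rewrite nth_set_nth /= ?eqxx // ltn_eqF.
  split.
    move=> [p0 [rx nz]]; split=> // -[z [zx rz]]; apply: nz; exists z.
    by rewrite !hx env_poly_set_nth // ltnW.
  move=> [p0 rx nz]; split=> //; split=> // -[z].
  by rewrite !hx env_poly_set_nth ?(leqW hj) // => hz; apply: nz; exists z.
have hB : semialg (fun e => e`_j.+1 < e`_j.+2 /\
    (e`_j.+2 < e`_j /\ root (env_poly a d e) e`_j.+2)).
  apply: semialg_and; first exact: semialg_lt.
  by apply: semialg_and; [exact: semialg_lt|exact: semialg_root].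
have h2 := semialg_not (semialg_ex j.+2 hB).
have h3 := semialg_ex j.+1 (semialg_and (IH _ (leqW hj))
  (semialg_and (semialg_lt j.+1 j) h2)).
apply: semialg_ext (semialg_and (semialg_root a d j) h3) => e.
have hx x : ((set_nth 0 e j.+1 x)`_j = e`_j) * ((set_nth 0 e j.+1 x)`_j.+1 = x).
  by split; rewrite nth_set_nth /= ?eqxx // ltn_eqF.
have hy x y (e' := set_nth 0 (set_nth 0 e j.+1 x) j.+2 y) :
    [/\ e'`_j = e`_j, e'`_j.+1 = x, e'`_j.+2 = y
      & env_poly a d e' = env_poly a d e].
  rewrite /e'; split; rewrite ?(env_poly_set_nth _ _ (leqW (leqW hj)))
    ?(env_poly_set_nth _ _ (leqW hj)) //; rewrite !nth_set_nth /= ?eqxx //.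
  - rewrite !nth_set_nth /= !ltn_eqF //; exact: leqW.
  - by rewrite ltn_eqF // nth_set_nth /= eqxx.
split.
  move=> [rx [y]]; rewrite !hx env_poly_set_nth ?(leqW hj) // => -[h1 [yx nz]].
  split=> //; exists y; split=> // -[z hz]; apply: nz; exists z.
  by have [-> -> -> ->] := hy y z; case: hz.
move=> [rx [y [h1 yx nz]]]; split=> //; exists y.
rewrite !hx env_poly_set_nth ?(leqW hj) //; split=> //; split=> // -[z].
by have [-> -> -> ->] := hy y z => -[u [v w]]; apply: nz; exists z.
Qed.

(** This stands in for the substitution of a root into an atom. The root gets a new coordinate j
    after the coefficients of both polynomials, and j is then projected away. *)
Lemma semialg_pos_at_kth_root d d' k :
  semialg (fun e => 0 < (env_poly d d' e).[kth_root (env_poly 0 d e) k]).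
Proof.
set j := (d + d')%N.
have hj : (0 + d <= j)%N by rewrite leq_addr.
have hK := @semialg_is_kth_root 0 d k j hj.
have hpos : semialg (fun e => 0 < (env_poly d d' e).[e`_j]).
  by apply: semialg_ext (semialg_pos (env_horner d d' j)) => e; rewrite peval_env_horner.
(* When there is no k-th root, [kth_root] is 0 by default; this disjunct evaluates the second
   polynomial there. *)
have h0 := semialg_ex j (semialg_and (semialg_eq0 (PVar j)) hpos).
have h1 := semialg_ex j hK.
apply: semialg_ext (semialg_or (semialg_ex j (semialg_and hK hpos))
  (semialg_and (semialg_not h1) h0)) => e.
have hx x : ((set_nth 0 e j x)`_j = x) * (env_poly d d' (set_nth 0 e j x) = env_poly d d' e)
   * (env_poly 0 d (set_nth 0 e j x) = env_poly 0 d e).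
  by rewrite !env_poly_set_nth // nth_set_nth /= eqxx.
set p := env_poly 0 d e.
have kth0 : (~ exists x, is_kth_root p k x) -> kth_root p k = 0.
  move=> nex; rewrite /kth_root nth_default // leqNgt; apply/negP => hk.
  apply: nex; exists (kth_root p k); apply/is_kth_rootP; split=> //.
  by apply/eqP => p0; move: hk; rewrite p0 polyrcf.rootsR0.
split.
  move=> [[x]|[nex [x]]]; rewrite /= !hx => -[].
    by move=> /is_kth_rootP[_ _ ->].
  move=> ->; rewrite kth0 // => -[x' hx']; apply: nex; exists x'.
  by rewrite !hx.
move=> hb; have [[x hk]|nex] := pselect (exists x, is_kth_root p k x).
  left; exists x; rewrite !hx; split=> //.
  by case/is_kth_rootP: hk => _ _ ->.
right; split.
  by move=> [x]; rewrite !hx => hk; apply: nex; exists x.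
by exists 0; rewrite /= !hx; split=> //; move: hb; rewrite kth0.
Qed.

End KthRoot.

(** * Sample points *)

Section SamplePoints.
Context {R : realType}.
Implicit Types (p q : {poly R}) (x y z : R).

Lemma pos_horner_noroot p x y :
  (forall z, (x <= z <= y) || (y <= z <= x) -> ~~ root p z) ->
  (0 < p.[y]) = (0 < p.[x]).
Proof.
wlog lexy : x y / x <= y => [hw nr|nr].
  have [/hw|/ltW/hw] := leP x y; first exact.
  by move=> -> // z; rewrite orbC; apply: nr.
have [xy0|xy0] := leP (p.[x] * p.[y]) 0.
  have [z] := polyrcf.poly_ivt lexy xy0.
  by rewrite in_itv /= => hz rz; have := nr z; rewrite hz rz => /(_ isT).
by apply/idP/idP => h; nra.
Qed.

Lemma seq_max (s : seq R) : s <> [::] -> exists2 m, m \in s & {in s, forall z, z <= m}.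
Proof.
elim: s => // a [|b s] IH _; first by exists a => [|z]; rewrite inE // => /eqP->.
have [//|m ms hm] := IH.
have [am|ma] := leP a m.
  by exists m => [|z]; rewrite inE ?ms ?orbT // => /orP[/eqP->|/hm].
exists a => [|z]; rewrite inE ?eqxx // => /orP[/eqP-> //|/hm zm].
exact: le_trans zm (ltW ma).
Qed.

Lemma seq_min (s : seq R) : s <> [::] -> exists2 m, m \in s & {in s, forall z, m <= z}.
Proof.
move=> s0; have [|m] := @seq_max (map -%R s); first by case: s s0.
move=> /mapP[n ns ->] hm; exists n => // z zs.
by rewrite -lerN2; apply/hm/map_f.
Qed.

Definition sample_poly (ps : seq {poly R}) q : Prop :=
  q = 'X \/
  (exists2 p, p \in ps & [\/ q = p, q = p \Po ('X + 1%:P) | q = p \Po ('X + (-1)%:P)]) \/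
  (exists p p', [/\ p \in ps, p' \in ps & q = (p * p')^`()]).

(** Unless x is itself a root, it lies in an interval cut out by the roots of all nonzero
    polynomials of [ps], and no sign changes inside it. Left of a smallest root b, take b - 1, a
    root of p(X + 1); right of a largest root a, take a + 1; between neighbours a and b, Rolle gives
    a root of the derivative of a product vanishing at both. If there are no roots at all, 0
    serves. *)
Lemma sample_points (ps : seq {poly R}) x :
  exists q y, [/\ sample_poly ps q, q != 0, root q y
    & {in ps, forall p, (0 < p.[y]) = (0 < p.[x])}].
Proof.
have [/hasP[p pps /andP[p0 rp]]|/hasPn nrx] :=
    boolP (has (fun p => (p != 0) && root p x) ps).
  exists p, x; split=> //; right; left; exists p => //.
  by constructor 1.
pose rs := flatten [seq polyrcf.rootsR p | p <- ps & p != 0].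
have rsP z : reflect (exists2 p, p \in ps & (p != 0) /\ root p z) (z \in rs).
  apply: (iffP flatten_mapP) => [[p]|[p pps [p0 rz]]].
    rewrite mem_filter => /andP[p0 pps]; rewrite mem_rootsR // => rz.
    by exists p.
  by exists p; rewrite ?mem_filter ?p0 ?mem_rootsR.
have xrs : x \notin rs.
  apply/negP => /rsP[p pps [p0 rx]].
  by have := nrx _ pps; rewrite p0 rx.
have lo : (forall z, z \in rs -> x < z) \/
    exists2 a, a \in rs & a < x /\ forall z, z \in rs -> z < x -> z <= a.
  have [e|/eqP/seq_max[a]] := eqVneq [seq z <- rs | z < x] [::].
    left=> z zrs; rewrite ltNge; apply/negP => zx.
    have : z \in [seq z <- rs | z < x].
      by rewrite mem_filter zrs lt_neqAle zx !andbT; apply: contraNneq xrs => <-.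
    by rewrite e.
  rewrite mem_filter => /andP[ax ars] ha; right; exists a => //; split=> // z zrs zx.
  by apply: ha; rewrite mem_filter zx.
have hi : (forall z, z \in rs -> z < x) \/
    exists2 b, b \in rs & x < b /\ forall z, z \in rs -> x < z -> b <= z.
  have [e|/eqP/seq_min[b]] := eqVneq [seq z <- rs | x < z] [::].
    left=> z zrs; rewrite ltNge; apply/negP => zx.
    have : z \in [seq z <- rs | x < z].
      by rewrite mem_filter zrs lt_neqAle zx !andbT; apply: contraNneq xrs => ->.
    by rewrite e.
  rewrite mem_filter => /andP[xb brs] hb; right; exists b => //; split=> // z zrs zx.
  by apply: hb; rewrite mem_filter zx.
have conc y : (forall z, (x <= z <= y) || (y <= z <= x) -> z \notin rs) ->
    {in ps, forall p, (0 < p.[y]) = (0 < p.[x])}.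
  move=> hz p pps; have [->|p0] := eqVneq p 0; first by rewrite !horner0.
  apply: pos_horner_noroot => z /hz; apply: contra => rz.
  by apply/rsP; exists p.
have sP q p : p \in ps -> q = p \Po ('X + 1%:P) \/ q = p \Po ('X + (-1)%:P) ->
    sample_poly ps q.
  by move=> pps hq; right; left; exists p => //; case: hq; [constructor 2|constructor 3].
have shift0 p c : p != 0 -> p \Po ('X + c%:P) != 0.
  by move=> p0; rewrite comp_poly2_eq0 ?size_XaddC.
case: lo => [lo|[a ars [ax ha]]]; case: hi => [hi|[b brs [xb hb]]].
- exists 'X, 0; rewrite polyX_eq0 rootX; split=> //; first by left.
  apply: conc => z _; apply/negP => zrs.
  by have := lt_trans (lo _ zrs) (hi _ zrs); rewrite ltxx.
- have /rsP[p pps [p0 rb]] := brs.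
  exists (p \Po ('X + 1%:P)), (b - 1); split.
  + by apply: (sP _ p) => //; left.
  + exact: shift0.
  + by rewrite /root horner_comp !hornerE subrK.
  + apply: conc => z hz; apply/negP => zrs.
    have xz := lo _ zrs; have bz := hb _ zrs xz.
    by move: hz => /orP[] /andP[]; lra.
- have /rsP[p pps [p0 ra]] := ars.
  exists (p \Po ('X + (-1)%:P)), (a + 1); split.
  + by apply: (sP _ p) => //; right.
  + exact: shift0.
  + by rewrite /root horner_comp !hornerE addrK.
  + apply: conc => z hz; apply/negP => zrs.
    have zx := hi _ zrs; have za := ha _ zrs zx.
    by move: hz => /orP[] /andP[]; lra.
- have /rsP[p pps [p0 ra]] := ars; have /rsP[p' pps' [p0' rb]] := brs.
  have ab : a < b := lt_trans ax xb.
  have [|y hy ry] := @polyrcf.poly_rolle _ a b (p * p') ab.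
    by rewrite !hornerM (rootP ra) (rootP rb) mul0r mulr0.
  have ppn0 : p * p' != 0 by rewrite mulf_neq0.
  exists ((p * p')^`()), y; split.
  + by right; right; exists p, p'.
  (* A nonzero polynomial with a root is not constant, so its derivative is nonzero. *)
  + rewrite -size_poly_eq0 polyorder.size_deriv -lt0n.
    have : (1 < size (p * p')%R)%N.
      by apply: (root_size_gt1 (a := a)) => //; rewrite rootM ra.
    by case: (size _) => [|[]].
  + by rewrite /root ry.
  + move: hy; rewrite in_itv /= => /andP[ay yb].
    apply: conc => z hz; apply/negP => zrs.
    have zx : z != x by apply: contraNneq xrs => <-.
    have [zx1|xz1] := ltP z x.
      have za := ha _ zrs zx1.
      by move: hz => /orP[] /andP[]; lra.
    have bz : b <= z by apply: hb => //; rewrite lt_neqAle eq_sym zx.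
    by move: hz => /orP[] /andP[]; lra.
Qed.

End SamplePoints.

(** * Elimination of real quantifiers *)

(** An array entry may serve as an index, which is how one passes from an edge to the coordinates of
    its ends. Products are left out, as in the integer arithmetic of the machine. *)
Inductive iterm : Type :=
| IVar of nat
| IConst of nat
| IAdd of iterm & iterm
| IArr of iterm.

Inductive rterm : Type :=
| TVar of nat
| TArr of iterm
| TConst of rat
| TAdd of rterm & rterm
| TMul of rterm & rterm.

Lemma iterm_comparable : comparable iterm.
Proof. by move=> x y; rewrite /decidable; decide equality; apply: PeanoNat.Nat.eq_dec. Qed.

HB.instance Definition _ := hasDecEq.Build iterm (compareP iterm_comparable).

Lemma rterm_comparable : comparable rterm.
Proof.
move=> x y; rewrite /decidable; decide equality.
- exact: PeanoNat.Nat.eq_dec.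
- exact: iterm_comparable.
- by case: (eqVneq r r0); [left|right; apply/eqP].
Qed.

HB.instance Definition _ := hasDecEq.Build rterm (compareP rterm_comparable).

(** Variables are numbered registers that quantifiers overwrite. Positivity is the only real atom;
    equality and weak inequalities arise from it by negation. *)
Inductive form : Type :=
| FLe of iterm & iterm
| FPos of rterm
| FNot of form
| FAnd of form & form
| FExI of nat & form
| FExR of nat & form.

Definition upd T (f : nat -> T) (i : nat) (v : T) : nat -> T :=
  fun j => if j == i then v else f j.

Lemma upd_eq T (f : nat -> T) i v : upd f i v i = v.
Proof. by rewrite /upd eqxx. Qed.

Lemma upd_neq T (f : nat -> T) i v j : j != i -> upd f i v j = f j.
Proof. by rewrite /upd => /negbTE->. Qed.

Lemma upd_id T (f : nat -> T) i : upd f i (f i) = f.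
Proof. by apply/funext => j; rewrite /upd; case: eqP => [->|]. Qed.

Lemma upd_upd T (f : nat -> T) i v w : upd (upd f i v) i w = upd f i w.
Proof. by apply/funext => j; rewrite /upd; case: eqP. Qed.

Record structure (R : Type) := Structure {
  ibound : nat;
  iarr : nat -> nat;
  rarr : nat -> R
}.

Section Logic.
Context {R : realType}.
Implicit Types (A : structure R) (si : nat -> nat) (ro : nat -> R).

Fixpoint ival A si (t : iterm) : nat :=
  match t with
  | IVar c => si c
  | IConst n => n
  | IAdd t1 t2 => ival A si t1 + ival A si t2
  | IArr t1 => iarr A (ival A si t1)
  end%N.

Fixpoint tval A si ro (t : rterm) : R :=
  match t with
  | TVar r => ro r
  | TArr a => rarr A (ival A si a)
  | TConst c => ratr c
  | TAdd t1 t2 => tval A si ro t1 + tval A si ro t2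
  | TMul t1 t2 => tval A si ro t1 * tval A si ro t2
  end.

(* Every integer quantifier ranges over the interval [0, ibound A). *)
Fixpoint holds A si ro (f : form) : Prop :=
  match f with
  | FLe t1 t2 => (ival A si t1 <= ival A si t2)%N
  | FPos t => 0 < tval A si ro t
  | FNot f1 => ~ holds A si ro f1
  | FAnd f1 f2 => holds A si ro f1 /\ holds A si ro f2
  | FExI c f1 => exists2 i, (i < ibound A)%N & holds A (upd si c i) ro f1
  | FExR r f1 => exists x, holds A si (upd ro r x) f1
  end.

Fixpoint rfree (f : form) : bool :=
  match f with
  | FLe _ _ | FPos _ => true
  | FNot f1 => rfree f1
  | FAnd f1 f2 => rfree f1 && rfree f2
  | FExI _ f1 => rfree f1
  | FExR _ _ => false
  end.

Fixpoint iname (t : iterm) : nat :=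
  match t with
  | IVar c => c.+1
  | IConst _ => 0
  | IAdd t1 t2 => maxn (iname t1) (iname t2)
  | IArr t1 => iname t1
  end%N.

Fixpoint tname (t : rterm) : nat :=
  match t with
  | TVar _ | TConst _ => 0
  | TArr a => iname a
  | TAdd t1 t2 | TMul t1 t2 => maxn (tname t1) (tname t2)
  end%N.

(** Bound index variables count as well, so every name from [fname f] on is fresh for [f]. *)
Fixpoint fname (f : form) : nat :=
  match f with
  | FLe t1 t2 => maxn (iname t1) (iname t2)
  | FPos t => tname t
  | FNot f1 => fname f1
  | FAnd f1 f2 => maxn (fname f1) (fname f2)
  | FExI c f1 => maxn c.+1 (fname f1)
  | FExR _ f1 => fname f1
  end%N.

Definition agree (M : nat) (si si' : nat -> nat) : Prop :=
  forall c, (c < M)%N -> si c = si' c.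

Lemma ival_agree A si si' M t : (iname t <= M)%N -> agree M si si' ->
  ival A si t = ival A si' t.
Proof.
move=> + h; elim: t => [c|n|t1 IH1 t2 IH2|t1 IH1] /=.
- by move=> /h.
- by [].
- by rewrite geq_max => /andP[/IH1-> /IH2->].
- by move=> hM; congr (iarr A _); apply: IH1.
Qed.

Lemma tval_agree A si si' ro M t : (tname t <= M)%N -> agree M si si' ->
  tval A si ro t = tval A si' ro t.
Proof.
move=> + h; elim: t => [r|a|c|t1 IH1 t2 IH2|t1 IH1 t2 IH2] //=.
- by move=> ha; rewrite (ival_agree A ha h).
- by rewrite geq_max => /andP[h1 h2]; rewrite IH1 ?IH2.
- by rewrite geq_max => /andP[h1 h2]; rewrite IH1 ?IH2.
Qed.

Lemma holds_agree A si si' ro M f : (fname f <= M)%N -> agree M si si' ->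
  holds A si ro f <-> holds A si' ro f.
Proof.
elim: f si si' ro => //= [t1 t2|t|f IH|f1 IH1 f2 IH2|c f IH|r f IH] si si' ro.
- by rewrite geq_max => /andP[h1 h2] h; rewrite (ival_agree A h1 h) (ival_agree A h2 h).
- by move=> ht h; rewrite (tval_agree A ro ht h).
- by move=> hf h; rewrite (IH _ _ _ hf h).
- by rewrite geq_max => /andP[h1 h2] h; rewrite (IH1 _ _ _ h1 h) (IH2 _ _ _ h2 h).
- rewrite geq_max => /andP[hc hf] h.
  have h' i : agree M (upd si c i) (upd si' c i).
    by move=> j hj; rewrite /upd; case: eqP => // _; apply: h.
  by split=> -[i ib hi]; exists i => //; apply/(IH _ _ _ hf (h' i)).
- by move=> hf h; split=> -[x hx]; exists x; apply/(IH _ _ _ hf h).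
Qed.

Fixpoint irename (g : nat -> nat) (t : iterm) : iterm :=
  match t with
  | IVar c => IVar (g c)
  | IConst n => IConst n
  | IAdd t1 t2 => IAdd (irename g t1) (irename g t2)
  | IArr t1 => IArr (irename g t1)
  end.

Fixpoint trename (g : nat -> nat) (t : rterm) : rterm :=
  match t with
  | TVar r => TVar r
  | TArr a => TArr (irename g a)
  | TConst c => TConst c
  | TAdd t1 t2 => TAdd (trename g t1) (trename g t2)
  | TMul t1 t2 => TMul (trename g t1) (trename g t2)
  end.

Lemma ival_rename A si g t : ival A si (irename g t) = ival A (si \o g) t.
Proof. by elim: t => //= [t1 -> t2 ->|t1 ->]. Qed.

Lemma tval_rename A si ro g t :
  tval A si ro (trename g t) = tval A (si \o g) ro t.
Proof. by elim: t => //= [a|t1 -> t2 ->|t1 -> t2 ->] //; rewrite ival_rename. Qed.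

(** * Univariate polynomials with terms as coefficients *)

Fixpoint uadd (u v : seq rterm) : seq rterm :=
  match u, v with
  | a :: u', b :: v' => TAdd a b :: uadd u' v'
  | [::], _ => v
  | _, [::] => u
  end.

Fixpoint umul (u v : seq rterm) : seq rterm :=
  if u is a :: u' then uadd (map (TMul a) v) (TConst 0 :: umul u' v) else [::].

Fixpoint uderiv (u : seq rterm) : seq rterm :=
  if u is a :: u' then uadd u' (TConst 0 :: uderiv u') else [::].

Fixpoint ushift (c : rat) (u : seq rterm) : seq rterm :=
  if u is a :: u' then uadd [:: a] (umul (ushift c u') [:: TConst c; TConst 1])
  else [::].

Fixpoint tcoefs (r : nat) (t : rterm) : seq rterm :=
  match t with
  | TVar r' => if r' == r then [:: TConst 0; TConst 1] else [:: TVar r']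
  | TArr _ | TConst _ => [:: t]
  | TAdd t1 t2 => uadd (tcoefs r t1) (tcoefs r t2)
  | TMul t1 t2 => umul (tcoefs r t1) (tcoefs r t2)
  end.

Definition uval A si ro (u : seq rterm) : {poly R} := Poly (map (tval A si ro) u).

Lemma uval_nil A si ro : uval A si ro [::] = 0.
Proof. by []. Qed.

Lemma uval_cons A si ro a u :
  uval A si ro (a :: u) = uval A si ro u * 'X + (tval A si ro a)%:P.
Proof. by rewrite /uval /= cons_poly_def. Qed.

Lemma uval_add A si ro u v :
  uval A si ro (uadd u v) = uval A si ro u + uval A si ro v.
Proof.
elim: u v => [|a u IH] [|b v] /=; rewrite ?uval_nil ?add0r ?addr0 //.
by rewrite !uval_cons IH /= polyCD mulrDl addrACA.
Qed.

Arguments uadd : simpl never.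

Lemma uval_scale A si ro a u :
  uval A si ro (map (TMul a) u) = (tval A si ro a)%:P * uval A si ro u.
Proof.
elim: u => [|b u IH]; rewrite /= ?uval_nil ?mulr0 //.
by rewrite !uval_cons IH /= polyCM mulrDr mulrA.
Qed.

Lemma uval_mul A si ro u v :
  uval A si ro (umul u v) = uval A si ro u * uval A si ro v.
Proof.
elim: u => [|a u IH]; rewrite /= ?uval_nil ?mul0r //.
by rewrite uval_add uval_scale !uval_cons IH /= rmorph0 addr0 mulrDl addrC mulrAC.
Qed.

Lemma uval_deriv A si ro u : uval A si ro (uderiv u) = (uval A si ro u)^`().
Proof.
elim: u => [|a u IH]; rewrite /= ?uval_nil ?deriv0 //.
by rewrite uval_add !uval_cons IH /= rmorph0 addr0 !derivE addrC.
Qed.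

Lemma uval_shift A si ro c u :
  uval A si ro (ushift c u) = uval A si ro u \Po ('X + (ratr c)%:P).
Proof.
elim: u => [|a u IH]; rewrite /= ?uval_nil ?comp_poly0 //.
rewrite uval_add uval_mul !uval_cons IH uval_nil /= rmorph1 mul0r !add0r mul1r.
by rewrite comp_polyD comp_polyM comp_polyX comp_polyC addrC.
Qed.

Lemma uval_coefs A si ro r x t :
  tval A si (upd ro r x) t = (uval A si ro (tcoefs r t)).[x].
Proof.
elim: t => /= [r'|a|c|t1 IH1 t2 IH2|t1 IH1 t2 IH2].
- rewrite /upd; case: eqP => _; rewrite !uval_cons uval_nil !hornerE //=.
  by rewrite rmorph0 rmorph1 addr0 mul1r.
- by rewrite uval_cons uval_nil !hornerE.
- by rewrite uval_cons uval_nil !hornerE.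
- by rewrite uval_add hornerD IH1 IH2.
- by rewrite uval_mul hornerM IH1 IH2.
Qed.

Lemma uval_agree A si si' ro M r t : (tname t <= M)%N -> agree M si si' ->
  uval A si ro (tcoefs r t) = uval A si' ro (tcoefs r t).
Proof.
move=> + h; elim: t => //= [r'|a|t1 IH1 t2 IH2|t1 IH1 t2 IH2].
- by case: eqP.
- by move=> ha; rewrite !uval_cons /= (ival_agree A ha h).
- by rewrite geq_max => /andP[h1 h2]; rewrite !uval_add IH1 // IH2.
- by rewrite geq_max => /andP[h1 h2]; rewrite !uval_mul IH1 // IH2.
Qed.

Lemma uval_rename A si ro g u :
  uval A si ro (map (trename g) u) = uval A (si \o g) ro u.
Proof.
rewrite /uval -map_comp; congr Poly; apply: eq_map => t /=.
by rewrite tval_rename.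
Qed.

(** * Sample polynomials of a formula *)

Fixpoint atoms (f : form) : seq rterm :=
  match f with
  | FLe _ _ => [::]
  | FPos t => [:: t]
  | FNot f1 | FExI _ f1 | FExR _ f1 => atoms f1
  | FAnd f1 f2 => atoms f1 ++ atoms f2
  end.

Lemma tname_atoms f t : t \in atoms f -> (tname t <= fname f)%N.
Proof.
elim: f => //= [t'|f1 IH1 f2 IH2|c f IH].
- by rewrite inE => /eqP->.
- rewrite mem_cat leq_max => /orP[/IH1->|/IH2->] //; exact: orbT.
- by rewrite leq_max => /IH->; rewrite orbT.
Qed.

(* The two instances of the atoms in a sample polynomial use the index
   variables M, ..., 2 M - 1 and 2 M, ..., 3 M - 1. *)
Definition candidates (r M : nat) (ts : seq rterm) : seq (seq rterm) :=
  let us := map (tcoefs r) ts in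
  let left_copy := map (trename (addn M)) in
  let right_copy := map (trename (addn (M + M))) in
  [:: TConst 0; TConst 1] :: map left_copy us
    ++ [seq ushift 1 (left_copy u) | u <- us]
    ++ [seq ushift (-1) (left_copy u) | u <- us]
    ++ [seq uderiv (umul (left_copy u) (right_copy u')) | u <- us, u' <- us].

Definition samples (r M : nat) (ts : seq rterm) : seq (seq rterm * nat) :=
  [seq (u, k) | u <- candidates r M ts, k <- iota 0 (size u)].

Lemma rootsR_size (q : {poly R}) : (size (polyrcf.rootsR q) <= size q)%N.
Proof.
have [->|q0] := eqVneq q 0; first by rewrite polyrcf.rootsR0.
apply/ltnW/max_poly_roots => //; last exact: polyrcf.uniq_roots.
by apply/allP => x; rewrite mem_rootsR.
Qed.

Lemma kth_rootP (q : {poly R}) y : q != 0 -> root q y ->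
  exists2 k, (k < size q)%N & y = kth_root q k.
Proof.
move=> q0; rewrite -mem_rootsR // => hy.
exists (index y (polyrcf.rootsR q)); last by rewrite /kth_root nth_index.
by apply: leq_trans (rootsR_size q); rewrite index_mem.
Qed.

(** An atom contains index variables, so it stands for the finitely many polynomials given by the
    valuations below [ibound A]; [si] has to be bounded for the polynomials met in evaluating [f] to
    be among these. A sample point for this finite set comes from at most two of them, whose
    valuations are recorded in two blocks of M fresh index variables. *)
Lemma sample_complete f r A si ro x M : rfree f -> (fname f <= M)%N ->
  (forall c, (si c < ibound A)%N) -> holds A si (upd ro r x) f ->
  exists q k si', [/\ (q, k) \in samples r M (atoms f),
    (forall c, c \notin iota M (M + M) -> si' c = si c),
    (forall c, (si' c < ibound A)%N)
    & holds A si' (upd ro r (kth_root (uval A si' ro q) k)) f].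
Proof.
move=> rf fM siA hx.
have [Z ZE] : exists Z, ibound A = Z.+1.
  by case: (ibound A) (siA 0%N) => // Z _; exists Z.
(* Valuations of the names below M form a finite type, which makes [ps] a list. *)
pose ext (v : {ffun 'I_M -> 'I_Z.+1}) c : nat :=
  if insub c is Some i then val (v i) else 0%N.
have ext_lt v c : (ext v c < ibound A)%N.
  by rewrite /ext ZE; case: insub => [i|] //; apply: ltn_ord.
pose ps := [seq uval A (ext v) ro (tcoefs r t) | t <- atoms f,
              v <- enum {ffun 'I_M -> 'I_Z.+1}].
have ps_mem si1 t : (forall c, (si1 c < ibound A)%N) -> t \in atoms f ->
    uval A si1 ro (tcoefs r t) \in ps.
  move=> h1 tf; pose v := [ffun i : 'I_M => inord (si1 i) : 'I_Z.+1].
  apply/allpairsP; exists (t, v); rewrite mem_enum; split=> //=.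
  apply: (uval_agree _ _ _ (leq_trans (tname_atoms tf) fM)) => c cM.
  by rewrite /ext insubT /= ffunE inordK //= -ZE.
have inv y : {in ps, forall p, (0 < p.[y]) = (0 < p.[x])} ->
    holds A si (upd ro r y) f.
  (* Induction over the subformulas of [f] at all bounded valuations, since index quantifiers change
     the valuation but keep it bounded. *)
  move=> hy; suff h g si1 : (forall c, (si1 c < ibound A)%N) -> rfree g ->
      {subset atoms g <= atoms f} ->
      holds A si1 (upd ro r x) g <-> holds A si1 (upd ro r y) g.
    by apply/(h f).
  elim: g si1 => //= [t|g IH|g1 IH1 g2 IH2|c g IH] si1 si1A rg sub.
  - by rewrite !uval_coefs hy // ps_mem // sub ?mem_head.
  - by rewrite IH.
  - case/andP: rg => rg1 rg2; rewrite IH1 ?IH2 // => t ht.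
      by apply: sub; rewrite mem_cat ht orbT.
    by apply: sub; rewrite mem_cat ht.
  - have siA' i : (i < ibound A)%N -> forall d, (upd si1 c i d < ibound A)%N.
      by move=> ib d; rewrite /upd; case: eqP.
    by split=> -[i ib hi]; exists i => //; apply/(IH _ (siA' i ib) rg sub).
have [q [y [hq q0 ry hy]]] := sample_points ps x.
have [k kq yE] := kth_rootP q0 ry.
have fy := inv y hy.
(* The names of [f] keep their values; the two blocks after them receive the valuations of the two
   factors. *)
pose mix v w c : nat :=
  if (c < M)%N then si c else if (c < M + M)%N then ext v (c - M)%N
  else if (c < M + M + M)%N then ext w (c - (M + M))%N else si c.
have mix_agree v w : agree M (mix v w) si by move=> c cM; rewrite /mix cM.
have mix_lt v w c : (mix v w c < ibound A)%N by rewrite /mix; do 3?case: ifP.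
have mixl v w : agree M (mix v w \o addn M) (ext v).
  move=> c cM; rewrite /= /mix ifF; last by rewrite ltnNge leq_addr.
  by rewrite ltn_add2l cM addnC addnK.
have mixr v w : agree M (mix v w \o addn (M + M)) (ext w).
  move=> c cM; rewrite /= /mix ifF; last by lia.
  by rewrite ifF ?ifT; [rewrite addnC addnK|lia|lia].
have nm t : t \in atoms f -> (tname t <= M)%N.
  by move=> tf; apply: leq_trans fM; apply: tname_atoms.
suff [u [v [w [uc uE]]]] : exists u v w, u \in candidates r M (atoms f) /\
    uval A (mix v w) ro u = q.
  exists u, k, (mix v w); split=> //; last first.
  - by apply/(holds_agree A _ fM (mix_agree v w)); rewrite uE -yE.
  - move=> c; rewrite mem_iota => hc; rewrite /mix; case: ltnP => // h1.
    by case: ltnP => h2; [lia|case: ltnP => // h3; lia].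
  - apply: allpairs_f_dep => //; rewrite mem_iota /= add0n.
    apply: leq_trans kq _; rewrite -uE /uval.
    by apply: leq_trans (size_Poly _) _; rewrite size_map.
(* Fills a block that does not occur in the sample polynomial. *)
pose v0 : {ffun 'I_M -> 'I_Z.+1} := [ffun=> ord0].
case: hq => [->|[[p pps hp]|[p [p' [pps pps' ->]]]]].
- exists [:: TConst 0; TConst 1], v0, v0; rewrite mem_head; split=> //.
  by rewrite !uval_cons uval_nil /= rmorph0 rmorph1 mul0r add0r mul1r addr0.
- have /allpairsP[[t v] /= [tf _ pE]] := pps.
  set u := tcoefs r t; pose u' := map (trename (addn M)) u.
  have u'E w : uval A (mix v w) ro u' = p.
    by rewrite uval_rename pE; apply: uval_agree (nm _ tf) (mixl v w).
  have us : u \in map (tcoefs r) (atoms f) by apply: map_f.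
  case: hp => ->.
  + exists u', v, v0; rewrite u'E; split=> //.
    by rewrite inE mem_cat map_f ?orbT.
  + exists (ushift 1 u'), v, v0; rewrite uval_shift u'E rmorph1; split=> //.
    rewrite inE !mem_cat; apply/orP; right; apply/orP; right; apply/orP; left.
    by apply/mapP; exists u.
  + exists (ushift (-1) u'), v, v0; rewrite uval_shift u'E rmorphN1; split=> //.
    rewrite inE !mem_cat; do 3!(apply/orP; right); apply/orP; left.
    by apply/mapP; exists u.
- have /allpairsP[[t v] /= [tf _ pE]] := pps.
  have /allpairsP[[t' w] /= [tf' _ pE']] := pps'.
  exists (uderiv (umul (map (trename (addn M)) (tcoefs r t))
    (map (trename (addn (M + M))) (tcoefs r t')))), v, w; split.
    rewrite inE !mem_cat; do 4!(apply/orP; right).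
    by apply/allpairsP; exists (tcoefs r t, tcoefs r t');
      split=> //=; apply: map_f.
  rewrite uval_deriv uval_mul !uval_rename pE pE'.
  by rewrite (uval_agree _ _ _ (nm _ tf) (mixl v w)) (uval_agree _ _ _ (nm _ tf') (mixr v w)).
Qed.

(** * Substitution of roots and elimination of one real quantifier *)

Definition FTrue : form := FLe (IConst 0) (IConst 0).
Definition FOr (f g : form) : form := FNot (FAnd (FNot f) (FNot g)).

Lemma holds_or A si ro f g :
  holds A si ro (FOr f g) <-> holds A si ro f \/ holds A si ro g.
Proof.
rewrite /=; split; last by case=> h [].
by move=> h; apply: contrapT => /not_orP.
Qed.

Definition fors (fs : seq form) : form := foldr FOr (FNot FTrue) fs.

Lemma holds_fors A si ro (T : eqType) (F : T -> form) (s : seq T) :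
  holds A si ro (fors (map F s)) <-> exists2 x, x \in s & holds A si ro (F x).
Proof.
elim: s => [|a s IH].
  by split=> [|[]] //= /(_ (leqnn 0)).
rewrite [fors _]/= -/(fors _) holds_or IH; split.
  move=> [h|[x xs h]]; first by exists a; rewrite ?mem_head.
  by exists x => //; rewrite inE xs orbT.
by move=> [x]; rewrite inE => /orP[/eqP->|xs h]; [left|right; exists x].
Qed.

Lemma rfree_fors (T : eqType) (F : T -> form) (s : seq T) :
  (forall x, x \in s -> rfree (F x)) -> rfree (fors (map F s)).
Proof.
elim: s => //= a s IH h; rewrite h ?mem_head // IH // => x xs.
by apply: h; rewrite inE xs orbT.
Qed.

Definition fexs (cs : seq nat) (f : form) : form := foldr FExI f cs.

Lemma holds_fexs A si ro cs f :
  holds A si ro (fexs cs f) <-> exists si', [/\ (forall c, c \notin cs -> si' c = si c),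
     (forall c, c \in cs -> (si' c < ibound A)%N) & holds A si' ro f].
Proof.
elim: cs si => [|c cs IH] si /=.
  split=> [h|[si' [h _]]]; first by exists si.
  by have -> : si' = si by apply/funext => c; apply: h.
split.
  move=> [i ib /IH[si' [h1 h2 h3]]]; exists si'; split=> // d.
    by rewrite inE negb_or => /andP[dc /h1->]; rewrite upd_neq.
  rewrite inE; have [/h2//|/h1 e] := boolP (d \in cs).
  by rewrite orbF => /eqP dc; rewrite e dc upd_eq.
move=> [si' [h1 h2 h3]]; exists (si' c); first by apply: h2; rewrite mem_head.
apply/IH; exists si'; split=> // d hd; last by apply: h2; rewrite inE hd orbT.
rewrite /upd; case: eqP => [->//|/eqP dc]; apply: h1.
by rewrite inE negb_or dc.
Qed.

Lemma rfree_fexs cs f : rfree (fexs cs f) = rfree f.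
Proof. by elim: cs => //= c cs ->. Qed.

Fixpoint psubst (es : seq rterm) (p : pterm) : rterm :=
  match p with
  | PVar i => nth (TConst 0) es i
  | PConst c => TConst c
  | PAdd p1 p2 => TAdd (psubst es p1) (psubst es p2)
  | PMul p1 p2 => TMul (psubst es p1) (psubst es p2)
  end.

Lemma tval_psubst A si ro es p :
  tval A si ro (psubst es p) = peval (map (tval A si ro) es) p.
Proof.
elim: p => //= [i|p1 -> p2 ->|p1 -> p2 ->] //.
have [hi|hi] := ltnP i (size es); first by rewrite (nth_map (TConst 0)).
by rewrite !nth_default ?size_map //= rmorph0.
Qed.

Lemma semialg_form_ex (S : seq R -> Prop) es : semialg S ->
  exists2 g, rfree g & forall A si ro,
    holds A si ro g <-> S (map (tval A si ro) es).
Proof.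
move=> [cl hcl]; suff [g rg hg] : exists2 g, rfree g & forall A si ro,
    holds A si ro g <-> has (clause_holds (map (tval A si ro) es)) cl.
  by exists g => // A si ro; rewrite hcl.
elim: cl {hcl} => [|[sp sq] cl [g rg hg]].
  by exists (FNot FTrue) => // A si ro; split=> //= /(_ (leqnn 0)).
have [gp rgp hgp] : exists2 g, rfree g & forall A si ro, holds A si ro g <->
    all (fun t => peval (map (tval A si ro) es) t == 0) sp.
  elim: sp => [|t sp [gp rgp hgp]]; first by exists FTrue.
  exists (FAnd (FAnd (FNot (FPos (psubst es t)))
    (FNot (FPos (psubst es (popp t))))) gp) => //= A si ro.
  rewrite hgp !tval_psubst /= rmorphN1 mulN1r oppr_gt0 eq_le !leNgt.
  split; first by move=> [[/negP-> /negP->] ->].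
  by move=> /andP[/andP[/negP h1 /negP h2] h3].
have [gq rgq hgq] : exists2 g, rfree g & forall A si ro, holds A si ro g <->
    all (fun t => 0 < peval (map (tval A si ro) es) t) sq.
  elim: sq => [|t sq [gq rgq hgq]]; first by exists FTrue.
  exists (FAnd (FPos (psubst es t)) gq) => //= A si ro.
  by rewrite hgq tval_psubst; split=> /andP.
exists (FOr (FAnd gp gq) g); first by rewrite /= rgp rgq rg.
move=> A si ro; rewrite holds_or hg /= hgp hgq; split.
  by rewrite /clause_holds => -[[-> ->]|->] //; rewrite orbT.
by move=> /orP[/andP|]; [left|right].
Qed.

(** A root is not a term, so it is substituted atom by atom by means of [semialg_pos_at_kth_root].
    The third hypothesis says that the value of [u] does not depend on index variables below M; it
    prevents capture by the quantifiers of [f], which bind only such variables. *)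
Lemma subst_kth_root r k M u f : rfree f -> (fname f <= M)%N ->
  (forall A si si' ro, (forall c, (M <= c)%N -> si c = si' c) ->
    uval A si ro u = uval A si' ro u) ->
  exists2 g, rfree g & forall A si ro, holds A si ro g <->
    holds A si (upd ro r (kth_root (uval A si ro u) k)) f.
Proof.
move=> + + hu; elim: f => //= [t1 t2|t|f IH|f1 IH1 f2 IH2|c f IH].
- by exists (FLe t1 t2).
- move=> _ _.
  have [g rg hg] := semialg_form_ex (u ++ tcoefs r t)
    (semialg_pos_at_kth_root (size u) (size (tcoefs r t)) k).
  exists g => // A si ro; rewrite hg uval_coefs.
  suff [-> ->] : env_poly (size u) (size (tcoefs r t))
        (map (tval A si ro) (u ++ tcoefs r t)) = uval A si ro (tcoefs r t) /\
      env_poly 0 (size u) (map (tval A si ro) (u ++ tcoefs r t)) = uval A si ro u.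
    by [].
  split; apply/polyP => i; rewrite coef_poly coef_Poly map_cat nth_cat size_map.
    rewrite [(size u + i < _)%N]ltnNge leq_addr /= [(size u + i)%N]addnC addnK.
    by case: ltnP => // hi; rewrite nth_default ?size_map.
  by rewrite add0n; case: ltnP => // hi; rewrite nth_default ?size_map.
- by move=> rf fM; have [g rg hg] := IH rf fM; exists (FNot g) => //= A si ro; rewrite hg.
- move=> /andP[rf1 rf2]; rewrite geq_max => /andP[h1 h2].
  have [g1 rg1 hg1] := IH1 rf1 h1; have [g2 rg2 hg2] := IH2 rf2 h2.
  by exists (FAnd g1 g2) => /=; [rewrite rg1|move=> A si ro; rewrite hg1 hg2].
- move=> rf; rewrite geq_max => /andP[cM fM]; have [g rg hg] := IH rf fM.
  exists (FExI c g) => //= A si ro; split=> -[i ib hi]; exists i => //; move: hi.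
    rewrite hg (hu _ _ si) // => d Md; rewrite upd_neq //.
    by rewrite gtn_eqF // (leq_trans cM).
  rewrite hg (hu _ (upd si c i) si) // => d Md; rewrite upd_neq //.
  by rewrite gtn_eqF // (leq_trans cM).
Qed.

Lemma uval_candidates r M ts u A si si' ro : u \in candidates r M ts ->
  (forall c, (M <= c)%N -> si c = si' c) -> uval A si ro u = uval A si' ro u.
Proof.
move=> uc h.
have hl v : uval A si ro (map (trename (addn M)) v) =
    uval A si' ro (map (trename (addn M)) v).
  rewrite !uval_rename; congr (uval _ _ _ _); apply/funext => c /=.
  by rewrite h // leq_addr.
have hr v : uval A si ro (map (trename (addn (M + M))) v) =
    uval A si' ro (map (trename (addn (M + M))) v).
  rewrite !uval_rename; congr (uval _ _ _ _); apply/funext => c /=.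
  by rewrite h // -addnA leq_addr.
move: uc; rewrite inE !mem_cat => /orP[/eqP->|/orP[|/orP[|/orP[]]]].
- by rewrite !uval_cons.
- by move=> /mapP[v _ ->].
- by move=> /mapP[v _ ->]; rewrite !uval_shift hl.
- by move=> /mapP[v _ ->]; rewrite !uval_shift hl.
- by move=> /allpairsP[[v w] [_ _ ->]]; rewrite !uval_deriv !uval_mul hl hr.
Qed.

(** The coefficients were extracted with respect to r, so storing a root in r leaves them
    unchanged. *)
Lemma uval_candidates_upd r M ts u A si ro x : u \in candidates r M ts ->
  uval A si (upd ro r x) u = uval A si ro u.
Proof.
have hc si' t : uval A si' (upd ro r x) (tcoefs r t) = uval A si' ro (tcoefs r t).
  elim: t => [r'|a|c|t1 IH1 t2 IH2|t1 IH1 t2 IH2] //=.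
  - case: eqP => // /eqP hr; by rewrite !uval_cons /= upd_neq.
  - by rewrite !uval_add IH1 IH2.
  - by rewrite !uval_mul IH1 IH2.
rewrite inE !mem_cat => /orP[/eqP->|/orP[|/orP[|/orP[]]]].
- by rewrite !uval_cons.
- by move=> /mapP[_ /mapP[t _ ->] ->]; rewrite !uval_rename hc.
- by move=> /mapP[_ /mapP[t _ ->] ->]; rewrite !uval_shift !uval_rename hc.
- by move=> /mapP[_ /mapP[t _ ->] ->]; rewrite !uval_shift !uval_rename hc.
- move=> /allpairsP[[v w] [/= /mapP[t _ ->] /mapP[t' _ ->] ->]].
  by rewrite !uval_deriv !uval_mul !uval_rename !hc.
Qed.

(** The result is a disjunction over sample polynomials and root numbers, a list depending only on
    [f], with M + M quantified indices for the valuations in each disjunct; its size is therefore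
    independent of the structure. Any choice of indices yields some real number, so only the
    direction from right to left needs [sample_complete]. *)
Lemma elim_ex r f : rfree f -> exists2 g, rfree g &
  forall A si ro, (forall c, (si c < ibound A)%N) ->
    holds A si ro g <-> exists x, holds A si (upd ro r x) f.
Proof.
move=> rf; set M := fname f; set sm := samples r M (atoms f).
have G (d : seq rterm * nat) : d \in sm -> exists g, rfree g /\
    forall A si ro, holds A si ro g <->
      holds A si (upd ro r (kth_root (uval A si ro d.1) d.2)) f.
  case: d => u k /allpairsPdep[u' [k' [uc _ [-> _]]]].
  have [|g rg hg] := @subst_kth_root r k M u' f rf (leqnn _).
    by move=> A si si' ro; apply: uval_candidates uc.
  by exists g.
have [F hF] : exists F : seq rterm * nat -> form, forall d, d \in sm ->
    rfree (F d) /\ forall A si ro, holds A si ro (F d) <->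
      holds A si (upd ro r (kth_root (uval A si ro d.1) d.2)) f.
  have /choice[F hF] : forall d, exists g, d \in sm -> rfree g /\
      forall A si ro, holds A si ro g <->
        holds A si (upd ro r (kth_root (uval A si ro d.1) d.2)) f.
    move=> d; have [/G[g hg]|_] := boolP (d \in sm); first by exists g.
    by exists FTrue.
  by exists F.
exists (fors [seq fexs (iota M (M + M)) (F d) | d <- sm]).
  by apply: rfree_fors => d /hF[h _]; rewrite rfree_fexs.
move=> A si ro siA; rewrite (holds_fors _ _ _ (fun d => fexs _ (F d))).
split.
  move=> [d dsm /holds_fexs[si' [h1 h2 h3]]].
  have [_ /(_ A si' ro)[/(_ h3) h4 _]] := hF d dsm.
  exists (kth_root (uval A si' ro d.1) d.2).
  have ha : agree M si si'.
    by move=> c cM; rewrite h1 // mem_iota leqNgt cM.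
  by apply/(holds_agree A _ (leqnn M) ha).
move=> [x hx].
have [q [k [si' [h1 h2 h3 h4]]]] := sample_complete rf (leqnn _) siA hx.
exists (q, k) => //; apply/holds_fexs; exists si'; split=> //.
by have [_ ->] := hF _ h1.
Qed.

Lemma real_elimination f : exists2 g, rfree g &
  forall A si ro, (forall c, (si c < ibound A)%N) ->
    holds A si ro g <-> holds A si ro f.
Proof.
elim: f => [t1 t2|t|f [g rg hg]|f1 [g1 rg1 hg1] f2 [g2 rg2 hg2]|c f [g rg hg]|r f [g rg hg]].
- by exists (FLe t1 t2).
- by exists (FPos t).
- by exists (FNot g) => //= A si ro siA; rewrite hg.
- by exists (FAnd g1 g2) => /=; [rewrite rg1|move=> A si ro siA; rewrite hg1 ?hg2].
- exists (FExI c g) => //= A si ro siA; split=> -[i ib hi]; exists i => //; move: hi;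
    rewrite hg // => d; by rewrite /upd; case: eqP.
- have [g' rg' hg'] := elim_ex r rg; exists g' => //= A si ro siA.
  by rewrite hg' //; split=> -[x hx]; exists x; apply/(hg _ _ _ siA).
Qed.

End Logic.

(** * Running times *)

(** For z > 0 a power of z is below all higher powers, so that sums stay below a single monomial. *)
Definition polybounded (T : nat -> nat) : Prop :=
  exists a k : nat, forall z, (0 < z -> T z <= a * z ^ k)%N.

Lemma polybounded_le (T T' : nat -> nat) :
  (forall z, (0 < z -> T z <= T' z)%N) -> polybounded T' -> polybounded T.
Proof.
move=> h [a [k hT]]; exists a, k => z z0.
exact: leq_trans (h z z0) (hT z z0).
Qed.

Lemma polybounded_const c : polybounded (fun=> c).
Proof. by exists c, 0%N => z _; rewrite expn0 muln1. Qed.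

Lemma polybounded_id : polybounded id.
Proof. by exists 1%N, 1%N => z _; rewrite expn1 mul1n. Qed.

Lemma polybounded_add T T' : polybounded T -> polybounded T' ->
  polybounded (fun z => T z + T' z)%N.
Proof.
move=> [a [k h]] [a' [k' h']]; exists (a + a')%N, (k + k')%N => z z0.
rewrite mulnDl; apply: leq_add.
  apply: leq_trans (h z z0) _; rewrite leq_mul2l; apply/orP; right.
  by rewrite leq_pexp2l ?leq_addr.
apply: leq_trans (h' z z0) _; rewrite leq_mul2l; apply/orP; right.
by rewrite leq_pexp2l ?leq_addl.
Qed.

Lemma polybounded_mul T T' : polybounded T -> polybounded T' ->
  polybounded (fun z => T z * T' z)%N.
Proof.
move=> [a [k h]] [a' [k' h']]; exists (a * a')%N, (k + k')%N => z z0.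
by rewrite expnD mulnACA leq_mul ?h ?h'.
Qed.

#[global] Hint Resolve polybounded_const polybounded_id polybounded_add
  polybounded_mul : polyb.

Section Runs.
Context {R : realType}.
Implicit Types (s : state R) (c : cmd) (P Q : state R -> Prop).

(** Total correctness with a time bound. Execution is deterministic ([exec_det]), so the existence
    of such a run is a statement about the run. *)
Definition runs c s (T : nat) Q : Prop :=
  exists t s', [/\ exec c s t s', (t <= T)%N & Q s'].

Lemma runs_weaken c s T T' P Q : runs c s T P -> (T <= T')%N ->
  (forall s', P s' -> Q s') -> runs c s T' Q.
Proof.
by move=> [t [s' [e tT p]]] TT' PQ; exists t, s'; split; [|exact: leq_trans tT _|exact: PQ].
Qed.

Lemma runs_skip s Q : Q s -> runs Skip s 1 Q.
Proof. by move=> q; exists 1%N, s; split=> //; apply: ExecSkip. Qed.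

Lemma runs_nstore a e s Q : Q (nstore s (neval s a) (neval s e)) ->
  runs (NStore a e) s 1 Q.
Proof. by move=> q; do 2!eexists; split; [apply: ExecNStore| |exact: q]. Qed.

Lemma runs_rstore a e s Q : Q (rstore s (neval s a) (reval s e)) ->
  runs (RStore a e) s 1 Q.
Proof. by move=> q; do 2!eexists; split; [apply: ExecRStore| |exact: q]. Qed.

Lemma runs_seq c1 c2 s T1 T2 Q :
  runs c1 s T1 (fun s1 => runs c2 s1 T2 Q) -> runs (Seq c1 c2) s (T1 + T2) Q.
Proof.
move=> [t1 [s1 [e1 h1 [t2 [s2 [e2 h2 q]]]]]]; exists (t1 + t2)%N, s2.
by split=> //; [apply: ExecSeq e1 e2|apply: leq_add].
Qed.

Lemma runs_if b c1 c2 s T Q : runs (if beval s b then c1 else c2) s T Q ->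
  runs (If b c1 c2) s T.+1 Q.
Proof. by move=> [t [s' [e h q]]]; exists t.+1, s'; split=> //; apply: ExecIf. Qed.

(** The invariant is indexed by the number of completed rounds, and the test is known to succeed
    exactly n times; termination and time bound come together. *)
Lemma runs_while b c (I : nat -> state R -> Prop) n T Q s :
  (forall i s, (i < n)%N -> I i s -> beval s b /\ runs c s T (I i.+1)) ->
  (forall s, I n s -> ~~ beval s b /\ Q s) -> I 0%N s ->
  runs (While b c) s (n * T.+1).+1 Q.
Proof.
move=> step stop; suff h j i s' : (i + j)%N = n -> I i s' ->
    runs (While b c) s' (j * T.+1).+1 Q by apply: h; rewrite add0n.
elim: j i s' => [|j IH] i s'.
  rewrite addn0 => -> /stop[nb q]; exists 1%N, s'; split=> //.
  exact: ExecWhileFalse.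
move=> ijn hI; have ltin : (i < n)%N by lia.
have [hb [t1 [s1 [e1 h1 I1]]]] := step i s' ltin hI.
have [|t2 [s2 [e2 h2 q]]] := IH i.+1 s1 _ I1; first by lia.
exists (t1 + t2).+1, s2; split=> //; last by lia.
exact: ExecWhileTrue hb e1 e2.
Qed.

Lemma runs_mono c s T P Q :
  runs c s T P -> (forall s', P s' -> Q s') -> runs c s T Q.
Proof. by move=> h; apply: runs_weaken h (leqnn _). Qed.

Lemma runs_le c s T T' Q : runs c s T Q -> (T <= T')%N -> runs c s T' Q.
Proof. by move=> h hT; apply: runs_weaken h hT _. Qed.

(** The loop variable is index variable c of the memory layout. It is reset to 0 at the end, so that
    programs built from such loops leave the index variables at 0. *)
Definition For (c : nat) (bnd : nexpr) (body : cmd) : cmd :=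
  let v := NConst (4 * c + 1) in
  Seq (NStore v (NConst 0))
    (Seq (While (BNot (BNLe bnd (NLoad v)))
            (Seq body (NStore v (NAdd (NLoad v) (NConst 1)))))
       (NStore v (NConst 0))).

Lemma runs_for (c : nat) bnd body n (I : nat -> state R -> Prop) T Q s :
  I 0%N (nstore s (4 * c + 1) 0) ->
  (forall i s, (i < n)%N -> I i s -> [/\ neval s bnd = n, nmem s (4 * c + 1) = i
     & runs body s T (fun s' => nmem s' (4 * c + 1) = i /\
         I i.+1 (nstore s' (4 * c + 1) i.+1))]) ->
  (forall s, I n s -> [/\ neval s bnd = n, nmem s (4 * c + 1) = n
     & Q (nstore s (4 * c + 1) 0)]) ->
  runs (For c bnd body) s (n * (T + 2) + 3) Q.
Proof.
move=> I0 step stop.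
suff h : runs (For c bnd body) s (1 + ((n * (T + 1).+1).+1 + 1)) Q.
  by apply: runs_weaken h _ _ => //; rewrite -[(T + 1).+1]addn1 -addnA; lia.
apply/runs_seq/runs_nstore/runs_seq/(@runs_while _ _ I n) => //=.
- move=> i s1 ltin hI; have [e1 e2 h] := step i s1 ltin hI.
  rewrite /= e1 e2 -ltnNge; split=> //.
  apply/runs_seq/(runs_mono h) => s2 [e3 I2].
  by apply: runs_nstore; rewrite /= e3 (addn1 i).
- move=> s1 hI; have [e1 e2 h] := stop s1 hI.
  rewrite /= e1 e2 leqnn; split=> //.
  exact: runs_nstore.
Qed.

End Runs.

(** * Evaluation of formulas on the real RAM *)

Section Layout.
Context {R : realType}.
Variable S : nat.
Implicit Types (s : state R).

(* Integer cells: arrays at even addresses, variables at 4c + 1, temporaries at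
   4d + 3.  Real cells: scratch space below S, then arrays and variables
   alternate. *)
Definition nvar s (c : nat) : nat := nmem s (4 * c + 1).
Definition ntmp s (d : nat) : nat := nmem s (4 * d + 3).
Definition narr s (i : nat) : nat := nmem s (i + i).
Definition rvar s (r : nat) : R := rmem s (S + (r + r).+1).
Definition realarr s (i : nat) : R := rmem s (S + (i + i)).

(** The range of the index quantifiers is entry 1 of the integer array, that is, cell 2; it will be
    the number of edges. *)
Definition struct_of s : structure R :=
  Structure (narr s 1) (narr s) (realarr s).

Fixpoint compile_iterm (t : iterm) : nexpr :=
  match t with
  | IVar c => NLoad (NConst (4 * c + 1))
  | IConst n => NConst n
  | IAdd t1 t2 => NAdd (compile_iterm t1) (compile_iterm t2)
  | IArr t1 => NLoad (NAdd (compile_iterm t1) (compile_iterm t1))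
  end.

Lemma neval_iterm s t : neval s (compile_iterm t) = ival (struct_of s) (nvar s) t.
Proof. by elim: t => //= [t1 -> t2 ->|t1 ->]. Qed.

(** The literals of a program are natural numbers, so sign and denominator are supplied by a
    subtraction and a division. *)
Definition compile_rat (q : rat) : rexpr :=
  RDiv (match numq q with
        | Posz n => RConst n
        | Negz n => RSub (RConst 0) (RConst n.+1)
        end) (RConst `|denq q|).

Lemma reval_rat s q : reval s (compile_rat q) = ratr q.
Proof.
rewrite /compile_rat /ratr /=; congr (_ / _); last first.
  by rewrite -{2}(gez0_abs (ltW (denq_gt0 q))).
case: (numq q) => n //=.
by rewrite sub0r NegzE rmorphN.
Qed.

Fixpoint compile_rterm (t : rterm) : rexpr :=
  match t with
  | TVar r => RLoad (NConst (S + (r + r).+1))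
  | TArr a => let e := compile_iterm a in RLoad (NAdd (NConst S) (NAdd e e))
  | TConst q => compile_rat q
  | TAdd t1 t2 => RAdd (compile_rterm t1) (compile_rterm t2)
  | TMul t1 t2 => RMul (compile_rterm t1) (compile_rterm t2)
  end.

Lemma reval_rterm s t :
  reval s (compile_rterm t) = tval (struct_of s) (nvar s) (rvar s) t.
Proof.
elim: t => //= [a|q|t1 -> t2 ->|t1 -> t2 ->] //.
  by rewrite neval_iterm.
exact: reval_rat.
Qed.

Definition tmp (d : nat) : nexpr := NConst (4 * d + 3).

(* The truth value is left in temporary d; smaller temporaries and all
   variables are preserved. *)
Fixpoint compile (f : form) (d : nat) : cmd :=
  match f with
  | FLe t1 t2 => If (BNLe (compile_iterm t1) (compile_iterm t2))
      (NStore (tmp d) (NConst 1)) (NStore (tmp d) (NConst 0))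
  | FPos t => If (BRLe (compile_rterm t) (RConst 0))
      (NStore (tmp d) (NConst 0)) (NStore (tmp d) (NConst 1))
  | FNot f1 => Seq (compile f1 d)
      (NStore (tmp d) (NSub (NConst 1) (NLoad (tmp d))))
  | FAnd f1 f2 => Seq (compile f1 d) (Seq (compile f2 d.+1)
      (If (BNLe (NConst 1) (NLoad (tmp d.+1))) Skip
         (NStore (tmp d) (NConst 0))))
  | FExI c f1 => Seq (NStore (tmp d.+1) (NLoad (NConst (4 * c + 1))))
      (Seq (NStore (tmp d) (NConst 0))
      (Seq (For c (NLoad (NConst 2)) (Seq (compile f1 d.+2)
              (If (BNLe (NConst 1) (NLoad (tmp d.+2)))
                 (NStore (tmp d) (NConst 1)) Skip)))
      (NStore (NConst (4 * c + 1)) (NLoad (tmp d.+1)))))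
  | FExR _ _ => Skip
  end.

(** Residue 3 modulo 4 marks the temporaries, so only temporaries numbered d or more may differ. *)
Definition same_below (d : nat) s s' : Prop :=
  rmem s' = rmem s /\
  forall x, (x %% 4 != 3)%N || (x < 4 * d)%N -> nmem s' x = nmem s x.

Lemma same_below_trans d s1 s2 s3 :
  same_below d s1 s2 -> same_below d s2 s3 -> same_below d s1 s3.
Proof. by move=> [r1 n1] [r2 n2]; split=> [|x hx]; rewrite ?r2 ?n2 ?n1. Qed.

Lemma same_below_le d d' s s' : (d <= d')%N ->
  same_below d' s s' -> same_below d s s'.
Proof.
move=> dd' [r1 n1]; split=> // x hx; apply: n1.
by case/orP: hx => [->//|hx]; apply/orP; right; lia.
Qed.

Lemma nstore_nstore s a v w : nstore (nstore s a v) a w = nstore s a w.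
Proof.
by rewrite /nstore /=; congr State; apply/funext => x /=; case: eqP.
Qed.

Lemma same_below_tmp d d' s v : (d <= d')%N ->
  same_below d s (nstore s (4 * d' + 3) v).
Proof. by move=> dd'; split=> //= x hx; rewrite ifF //; lia. Qed.

Lemma same_below_struct d s s' : same_below d s s' ->
  [/\ struct_of s' = struct_of s, nvar s' = nvar s & rvar s' = rvar s].
Proof.
move=> [rE nE].
have hn : narr s' = narr s by apply/funext => i; apply: nE; lia.
split; last by rewrite /rvar rE.
  by rewrite /struct_of /realarr rE hn.
by apply/funext => c; apply: nE; lia.
Qed.

Definition holds_at s f : Prop := holds (struct_of s) (nvar s) (rvar s) f.

(** An index quantifier becomes a loop of at most z rounds. The nesting depth is that of [f], so the
    time is a polynomial in z whose degree and coefficients depend on [f] alone. *)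
Lemma runs_compile f d : rfree f -> exists2 T, polybounded T &
  forall z s, (0 < z)%N -> (narr s 1 <= z)%N ->
    runs (compile f d) s (T z) (fun s' => same_below d s s' /\
      ntmp s' d = `[< holds_at s f >]).
Proof.
elim: f d => [t1 t2|t|f IH|f1 IH1 f2 IH2|c f IH|//] d /=.
- move=> _; exists (fun=> 2%N) => [|z s z0 _]; first exact: polybounded_const.
  apply: runs_if => /=; rewrite !neval_iterm; case: ifP => h.
    apply: runs_nstore; split; first exact: same_below_tmp.
    by rewrite /ntmp /= eqxx /holds_at /= h asboolT.
  apply: runs_nstore; split; first exact: same_below_tmp.
  by rewrite /ntmp /= eqxx /holds_at /= h asboolF.
- move=> _; exists (fun=> 2%N) => [|z s z0 _]; first exact: polybounded_const.
  apply: runs_if => /=; rewrite reval_rterm leNgt; case: ifP => h.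
    apply: runs_nstore; split; first exact: same_below_tmp.
    by rewrite /ntmp /= eqxx /holds_at /= asboolF //; apply/negP.
  apply: runs_nstore; split; first exact: same_below_tmp.
  by rewrite /ntmp /= eqxx /holds_at /= asboolT //; move/negbFE: h.
- move=> rf; have [T bT h] := IH d rf.
  exists (fun z => T z + 1)%N => [|z s z0 hz]; first by eauto with polyb.
  apply/runs_seq/(runs_mono (h z s z0 hz)) => s1 [e1 t1].
  apply: runs_nstore; split.
    by apply: same_below_trans e1 _; apply: same_below_tmp.
  rewrite /ntmp /= eqxx -[nmem _ _]/(ntmp s1 d) t1 /holds_at /= asbool_neg.
  by case: asbool.
- move=> /andP[rf1 rf2].
  have [T1 b1 h1] := IH1 d rf1; have [T2 b2 h2] := IH2 d.+1 rf2.
  exists (fun z => T1 z + (T2 z + 2))%N => [|z s z0 hz]; first by eauto with polyb.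
  apply/runs_seq/(runs_mono (h1 z s z0 hz)) => s1 [e1 t1].
  have [E1 E2 E3] := same_below_struct e1.
  have hz1 : (narr s1 1 <= z)%N by rewrite -[narr s1 1]/(ibound (struct_of s1)) E1.
  apply/runs_seq/(runs_mono (h2 z s1 z0 hz1)) => s2 [e2 t2].
  have t12 : ntmp s2 d = ntmp s1 d by case: e2 => _; apply; lia.
  have e12 := same_below_trans e1 (same_below_le (leqnSn d) e2).
  apply: runs_if => /=; rewrite -[nmem _ _]/(ntmp s2 d.+1) t2.
  have hE : holds_at s1 f2 = holds_at s f2 by rewrite /holds_at E1 E2 E3.
  rewrite hE /holds_at /= asbool_and -/(holds_at s f1) -/(holds_at s f2).
  case: (asbool (holds_at s f2)).
    by rewrite andbT; apply: runs_skip; rewrite t12.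
  apply: runs_nstore; rewrite andbF; split.
    by apply: same_below_trans e12 _; apply: same_below_tmp.
  by rewrite /ntmp /= eqxx.
- move=> rf; have [T bT h] := IH d.+2 rf.
  exists (fun z => 1 + (1 + ((z * ((T z + 2) + 2) + 3) + 1)))%N => [|z s z0 hz].
    by eauto 10 with polyb.
  apply/runs_seq/runs_nstore/runs_seq/runs_nstore/runs_seq => /=.
  set s0 := nstore _ _ _.
  pose A := struct_of s; pose si := nvar s; pose ro := rvar s.
  (* Writing the saved value back to variable c would undo everything except temporaries. Temporary
     d.+1 keeps that value, and temporary d the disjunction over the indices already tried. *)
  pose I i s' := [/\ same_below d s (nstore s' (4 * c + 1) (si c)),
    nvar s' c = i, ntmp s' d.+1 = si c
    & ntmp s' d = `[< exists2 j, (j < i)%N & holds A (upd si c j) ro f >]].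
  have Ist i s' : I i s' ->
     [/\ struct_of s' = A, nvar s' = upd si c i & rvar s' = ro].
    move=> [/same_below_struct[E1 E2 E3] e2 _ _]; split.
    - rewrite /A -E1 /struct_of.
      have -> : narr (nstore s' (4 * c + 1) (si c)) = narr s'.
        by apply/funext => j; rewrite /narr /= ifF //; lia.
      by [].
    - apply/funext => j; rewrite /upd; case: eqP => [->//|/eqP jc].
      move/(congr1 (fun g => g j)): E2; rewrite /nvar /= ifF; first by [].
      by apply/negbTE; move: jc; rewrite !addn1 eqSS eqn_pmul2l.
    - by rewrite /ro -E3.
  have body i s' : (i < narr s 1)%N -> I i s' -> [/\ nmem s' 2 = narr s 1,
     nmem s' (4 * c + 1) = i & runs (Seq (compile f d.+2)
       (If (BNLe (NConst 1) (NLoad (tmp d.+2))) (NStore (tmp d) (NConst 1)) Skip))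
       s' (T z + 2) (fun s'' => nmem s'' (4 * c + 1) = i /\
         I i.+1 (nstore s'' (4 * c + 1) i.+1))].
    move=> ilt hI; have [E1 E2 E3] := Ist i s' hI.
    have [g1 g2 g3 g4] := hI.
    have ZE : narr s' 1 = narr s 1 by rewrite -[narr s' 1]/(ibound (struct_of s')) E1.
    split=> //.
    have hz' : (narr s' 1 <= z)%N by rewrite ZE.
    apply/runs_seq/(runs_mono (h z s' z0 hz')) => s2 [e2 t2].
    have key : (0 < ntmp s2 d.+2)%N = `[< holds A (upd si c i) ro f >].
      by rewrite t2 /holds_at E1 E2 E3; case: asbool.
    have e2v w : same_below d (nstore s' (4 * c + 1) w) (nstore s2 (4 * c + 1) w).
      have [r1 n1] := same_below_le (leqW (leqnSn d)) e2.
      by split=> //= x hx; case: eqP => // _; apply: n1.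
    have e2c : nmem s2 (4 * c + 1) = i.
      by case: e2 => _ ->; [exact: g2|lia].
    have t2' : ntmp s2 d.+1 = si c.
      by rewrite /ntmp; case: e2 => _ ->; [exact: g3|lia].
    have t2'' : ntmp s2 d = ntmp s' d by case: e2 => _; apply; lia.
    have exS : `[< exists2 j, (j < i.+1)%N & holds A (upd si c j) ro f >] =
        `[< exists2 j, (j < i)%N & holds A (upd si c j) ro f >] ||
        `[< holds A (upd si c i) ro f >].
      apply/asboolP/orP => [[j]|].
        rewrite ltnS leq_eqVlt => /orP[/eqP-> hj|ji hj]; first by right; apply/asboolP.
        by left; apply/asboolP; exists j.
      by move=> [/asboolP[j ji hj]|/asboolP hi]; [exists j => //; apply: leqW|exists i].
    apply: runs_if => /=; rewrite -[nmem s2 _]/(ntmp s2 d.+2) key //.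
    case: ifP => hf.
      apply: runs_nstore => /=; split; first by rewrite ifF //; lia.
      split.
      - rewrite nstore_nstore; apply: same_below_trans g1 _.
        apply: same_below_trans (e2v _) _.
        by split=> //= x hx; case: eqP => // _; rewrite ifF //; lia.
      - by rewrite /nvar /= eqxx.
      - by rewrite /ntmp /= ifF ?ifF //; lia.
      - by rewrite /ntmp /= ifF ?eqxx ?exS ?hf ?orbT //; lia.
    apply: runs_skip; split=> //; split.
    - rewrite nstore_nstore; apply: same_below_trans g1 _.
      exact: e2v.
    - by rewrite /nvar /= eqxx.
    - by rewrite /ntmp /= ifF //; lia.
    - rewrite /ntmp /= ifF; last by lia.
      by rewrite exS hf orbF -g4 -t2''.
  apply: (runs_le (T := narr s 1 * (T z + 2 + 2) + 3)%N).
    apply: (runs_for (I := I)) => //.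
      split.
      - rewrite nstore_nstore; split=> //= x hx; case: eqP => [->//|_].
        by rewrite !ifF //; lia.
      - by rewrite /nvar /= eqxx.
      - rewrite /ntmp /= ifF; last by lia.
        by rewrite ifF ?eqxx //; lia.
      - rewrite /ntmp /= ifF ?eqxx; last by lia.
        by rewrite asboolF // => -[].
    move=> s' hI; have [E1 _ _] := Ist _ s' hI.
    have [g1 g2 g3 g4] := hI.
    have ZE : narr s' 1 = narr s 1 by rewrite -[narr s' 1]/(ibound (struct_of s')) E1.
    split=> //; apply: runs_nstore.
    have -> : neval (nstore s' (4 * c + 1) 0) (NLoad (tmp d.+1)) = si c.
      by rewrite /= ifF //; lia.
    rewrite nstore_nstore; split=> //.
    by rewrite /ntmp /= ifF; [exact: g4|lia].
  by rewrite leq_add2r leq_mul2r hz orbT.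
Qed.
End Layout.

(** * Search for a witness *)

Section Search.
Context {R : realType}.
Variable S : nat.
Implicit Types (s : state R).

Local Notation struct_of := (struct_of S).
Local Notation rvar := (rvar S).

(** A 0 is appended because [RRoot] with formal degree [size u] reads one coefficient more than [u]
    has. *)
Fixpoint store_coefs (j : nat) (u : seq rterm) : cmd :=
  if u is t :: u' then
    Seq (RStore (NConst j) (compile_rterm S t)) (store_coefs j.+1 u')
  else RStore (NConst j) (RConst 0).

Lemma same_real_above s s' : nmem s' = nmem s ->
  (forall x, (S <= x)%N -> rmem s' x = rmem s x) ->
  [/\ struct_of s' = struct_of s, nvar s' = nvar s & rvar s' = rvar s].
Proof.
move=> nE rE; rewrite /nvar nE; split=> //.
  rewrite /struct_of /narr nE; congr Structure.
  by apply/funext => i; apply: rE; rewrite leq_addr.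
by apply/funext => i; apply: rE; rewrite leq_addr.
Qed.

Lemma runs_store_coefs j u s : (j + size u < S)%N ->
  runs (store_coefs j u) s (size u).+1 (fun s' => [/\ nmem s' = nmem s,
    forall x, (S <= x)%N || (x < j)%N -> rmem s' x = rmem s x
    & forall i, (i <= size u)%N -> rmem s' (j + i) =
        (map (tval (struct_of s) (nvar s) (rvar s)) u)`_i]).
Proof.
elim: u j s => [|t u IH] j s /=.
  rewrite addn0 => jS; apply: runs_rstore; split=> //= [x hx|i].
    by rewrite ifF //; lia.
  by rewrite leqn0 => /eqP->; rewrite addn0 eqxx.
move=> jS; rewrite -[(size u).+2]add1n; apply/runs_seq/runs_rstore.
rewrite reval_rterm /=; set v := tval _ _ _ t; set s1 := rstore s j v.
have jS' : (j.+1 + size u < S)%N by rewrite addSnnS.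
have [E1 E2 E3] : [/\ struct_of s1 = struct_of s, nvar s1 = nvar s & rvar s1 = rvar s].
  by apply: same_real_above => //= x hx; rewrite ifF //; lia.
apply: runs_mono (IH j.+1 s1 jS') _ => s' [nE rE cE]; split=> // [x hx|[|i]].
- by rewrite rE /=; [rewrite ifF //; lia|lia].
- by move=> _; rewrite addn0 rE /= ?eqxx // ltnSn orbT.
- by rewrite ltnS => hi; rewrite -addSnnS cE //= E1 E2 E3.
Qed.

Definition attempt (r : nat) (f : form) (d : seq rterm * nat) : cmd :=
  Seq (store_coefs 0 d.1)
    (Seq (RStore (NConst (S + (r + r).+1)) (RRoot (size d.1) d.2 (NConst 0)))
    (Seq (compile S f 1)
    (If (BNLe (NConst 1) (NLoad (tmp 1))) (NStore (tmp 0) (NConst 1)) Skip))).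

Fixpoint nest (cs : seq nat) (body : cmd) : cmd :=
  if cs is c :: cs' then For c (NLoad (NConst 2)) (nest cs' body) else body.

(** Temporary 0 is the success flag. Once it is set, all later attempts are skipped, so variable r
    keeps the root that was found. *)
Definition find (r : nat) (f : form) : cmd :=
  let M := fname f in
  Seq (NStore (tmp 0) (NConst 0))
    (foldr (fun d p =>
        Seq (nest (iota M (M + M))
               (If (BNLe (NLoad (tmp 0)) (NConst 0)) (attempt r f d) Skip)) p)
       Skip (samples r M (atoms f))).

(** * Correctness and running time of the search *)

Section Correctness.
Variables (r : nat) (f : form).
Hypothesis rf : rfree f.
Implicit Types (A : structure R) (ro : nat -> R).

(** Variable r is exempt, since attempts overwrite it. *)
Definition located A ro (si : nat -> nat) s : Prop :=
  [/\ struct_of s = A, nvar s = si & forall j, j != r -> rvar s j = ro j].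

Definition found A s : Prop :=
  ntmp s 0 = 1%N /\ holds A (fun=> 0%N) (rvar s) f.

(** The invariant of the search; X records which attempts have failed so far. *)
Definition found_or A (X : Prop) s : Prop := found A s \/ ntmp s 0 = 0%N /\ X.

Lemma located_nstore A ro si s c v : located A ro si s ->
  located A ro (upd si c v) (nstore s (4 * c + 1) v).
Proof.
move=> [h1 h2 h3]; split=> //.
  rewrite -h1 /struct_of; congr Structure; last apply/funext => i.
    by rewrite /narr /= ifF //; lia.
  by rewrite /narr /= ifF //; lia.
rewrite -h2; apply/funext => j; rewrite /nvar /upd /=.
by rewrite eqn_add2r eqn_mul2l.
Qed.

Lemma found_or_nstore A X s c v : found_or A X s ->
  found_or A X (nstore s (4 * c + 1) v).
Proof.
have e : ntmp (nstore s (4 * c + 1) v) 0 = ntmp s 0.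
  by rewrite /ntmp /= ifF //; lia.
by rewrite /found_or /found e.
Qed.

Definition candidate_root A ro d si : R := kth_root (uval A si ro d.1) d.2.

Lemma runs_attempt d : d \in samples r (fname f) (atoms f) -> (size d.1 < S)%N ->
  exists2 T, polybounded T & forall A ro z s si X, (0 < z)%N -> (ibound A <= z)%N ->
    located A ro si s -> agree (fname f) si (fun=> 0%N) -> found_or A X s ->
    runs (If (BNLe (NLoad (tmp 0)) (NConst 0)) (attempt r f d) Skip) s (T z)
      (fun s' => located A ro si s' /\
         found_or A (X /\ ~ holds A si (upd ro r (candidate_root A ro d si)) f) s').
Proof.
move=> ds dS; have [T bT hT] := @runs_compile R S f 1 rf.
exists (fun z => ((size d.1).+1 + (1 + (T z + 2))) + 1)%N.
  by eauto 10 with polyb.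
move=> A ro z s si X z0 Az lo ag fo; rewrite addn1; apply: runs_if => /=.
rewrite -[nmem s _]/(ntmp s 0) leqn0; case: eqP => [t0|t0]; last first.
  case: fo => [fs|[]//]; apply: (runs_le (T := 1%N)) => //.
  by apply: runs_skip; split=> //; left.
have {}fo : X by case: fo => [[]|[]] //; rewrite t0.
have [l1 l2 l3] := lo.
have dS0 : (0 + size d.1 < S)%N by [].
apply/runs_seq/(runs_mono (runs_store_coefs s dS0)) => s1 [n1 r1 c1].
have [E1 E2 E3] : [/\ struct_of s1 = A, nvar s1 = si & rvar s1 = rvar s].
  have [|-> -> ->] := same_real_above n1; first by move=> x hx; rewrite r1 ?hx.
  by split.
apply/runs_seq/runs_rstore => /=.
set v := kth_root _ _.
have uE : v = candidate_root A ro d si.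
  rewrite /v /candidate_root; congr kth_root; apply/polyP => i.
  rewrite coef_poly coef_Poly ltnS.
  have uin : d.1 \in candidates r (fname f) (atoms f).
    by case: d ds {dS dS0 c1 v} => u k /allpairsPdep[u' [k' [uc _ [-> _]]]].
  (* Variable r may still contain the root of an earlier attempt, but the coefficients do not depend
     on it. *)
  have eu : uval A si (rvar s) d.1 = uval A si ro d.1.
    rewrite -(uval_candidates_upd A si (rvar s) (ro r) uin).
    congr (uval _ _ _ _); apply/funext => j; rewrite /upd.
    by case: eqP => [->//|/eqP /l3].
  move/(congr1 (fun p : {poly R} => p`_i)): eu; rewrite /uval !coef_Poly => <-.
  case: leqP => hi; last by rewrite nth_default // size_map ltnW.
  by rewrite add0n -[in LHS](add0n i) c1 // l1 l2.
set s2 := rstore _ _ _.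
have [F1 F2] : struct_of s2 = A /\ nvar s2 = si.
  rewrite -E1 -E2; split=> //; rewrite /struct_of; congr Structure.
  by apply/funext => i; rewrite /realarr /= ifF //; lia.
have F3 : rvar s2 = upd ro r v.
  apply/funext => j; rewrite /rvar /upd /= eqn_add2l eqSS !addnn -!muln2 eqn_mul2r /=.
  case: eqP => // /eqP jr; rewrite muln2 -addnn.
  by move/(congr1 (fun g => g j)): E3; rewrite /rvar => ->; apply: l3.
have h2 : (narr s2 1 <= z)%N by rewrite -[narr s2 1]/(ibound (struct_of s2)) F1.
apply/runs_seq/(runs_mono (hT z s2 z0 h2)) => s3 [e3 t3].
have [G1 G2 G3] := same_below_struct S e3.
have t30 : ntmp s3 0 = 0%N.
  by rewrite /ntmp; case: e3 => _ ->; [rewrite /= n1|].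
have lo3 : located A ro si s3.
  split; rewrite ?G1 ?G2 ?G3 //; rewrite F3 => j jr.
  by rewrite upd_neq.
apply: runs_if => /=; rewrite -[nmem s3 _]/(ntmp s3 1) t3 /holds_at F1 F2 F3 uE.
case: asboolP => hf /=; last first.
  by apply: runs_skip; split=> //; right.
apply: runs_nstore; split.
  case: lo3 => m1 m2 m3; split=> //.
    rewrite -m1 /struct_of; congr Structure.
    by apply/funext => i; rewrite /narr /= ifF //; lia.
  by rewrite -m2; apply/funext => j; rewrite /nvar /= ifF //; lia.
left; split; first by [].
rewrite -[rvar _]/(rvar s3) G3 F3 uE.
(* The indices of the sample are not among the names of [f], so [f] also holds with all indices
   0. *)
by apply/(holds_agree A _ (leqnn _) ag).
Qed.

(** Each loop finds its variable at 0 and leaves it at 0, so the failures at all valuations of [cs]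
    can be collected one variable at a time. *)
Lemma runs_nest cs body (Bad : structure R -> (nat -> R) -> (nat -> nat) -> Prop) T : polybounded T ->
  uniq cs -> {in cs, forall c, fname f <= c}%N ->
  (forall A ro z s si X, (0 < z)%N -> (ibound A <= z)%N ->
    located A ro si s -> agree (fname f) si (fun=> 0%N) -> found_or A X s ->
    runs body s (T z) (fun s' => located A ro si s' /\ found_or A (X /\ Bad A ro si) s')) ->
  exists2 T', polybounded T' & forall A ro z s si X, (0 < z)%N -> (ibound A <= z)%N ->
    located A ro si s -> agree (fname f) si (fun=> 0%N) ->
    {in cs, forall c, si c = 0%N} -> found_or A X s ->
    runs (nest cs body) s (T' z) (fun s' => located A ro si s' /\
      found_or A (X /\ forall si', (forall c, c \notin cs -> si' c = si c) ->
        {in cs, forall c, si' c < ibound A}%N -> Bad A ro si') s').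
Proof.
move=> bT + + hbody; elim: cs => [|c cs IH] /=.
  move=> _ _; exists T => // A ro z s si X z0 Az lo ag _ fo.
  apply: runs_mono (hbody A ro z s si X z0 Az lo ag fo) _ => s' [lo' fo'].
  split=> //; case: fo' => [|[t0 [x b]]]; [by left|right].
  split=> //; split=> // si' h _; suff -> : si' = si by [].
  by apply/funext => d; apply: h.
move=> /andP[ncs ucs] hM.
have [|T' bT' h] := IH ucs; first by move=> d dcs; apply: hM; rewrite inE dcs orbT.
exists (fun z => z * (T' z + 2) + 3)%N; first by eauto 10 with polyb.
move=> A ro z s si X z0 Az lo ag si0 fo.
apply: (runs_le (T := (ibound A * (T' z + 2) + 3)%N)); last first.
  by rewrite leq_add2r leq_mul2r Az orbT.
pose I i s' := located A ro (upd si c i) s' /\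
  found_or A (X /\ forall si', (forall d, d \notin c :: cs -> si' d = si d) ->
        {in cs, forall d, si' d < ibound A}%N -> (si' c < i)%N -> Bad A ro si') s'.
have bE si' s' : located A ro si' s' -> nmem s' 2 = ibound A.
  by move=> [<-].
have vE i s' : located A ro (upd si c i) s' -> nmem s' (4 * c + 1) = i.
  by move=> [_ e _]; move/(congr1 (fun g => g c)): e; rewrite upd_eq.
apply: (runs_for (I := I)).
- split; first exact: located_nstore.
  apply: found_or_nstore; case: fo => [fs|[t0 x]]; [by left|right].
  by split=> //; split.
- move=> i s' iA [lo' fo']; split; [exact: bE lo'|exact: vE lo'|].
  have ag' : agree (fname f) (upd si c i) (fun=> 0%N).
    move=> d hd; rewrite upd_neq ?ag // ltn_eqF //.
    by apply: leq_trans hd _; apply: hM; rewrite mem_head.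
  have si0' : {in cs, forall d, upd si c i d = 0%N}.
    move=> d dcs; rewrite upd_neq; first by apply: si0; rewrite inE dcs orbT.
    by apply: contraNneq ncs => <-.
  apply: runs_mono (h A ro z s' _ _ z0 Az lo' ag' si0' fo') _ => s'' [lo'' fo''].
  split; first exact: vE lo''.
  split; first by rewrite -(upd_upd si c i); apply: located_nstore.
  apply: found_or_nstore; case: fo'' => [fs|[t0 [[x b] b']]]; [by left|right].
  split=> //; split=> // si' h1 h2; rewrite ltnS leq_eqVlt => /orP[/eqP si'c|].
    apply: b' => // d dcs; rewrite /upd; case: eqP => [->//|/eqP dc].
    by apply: h1; rewrite inE negb_or dc.
  exact: b.
- move=> s' [lo' fo']; split; [exact: bE lo'|exact: vE lo'|].
  split.
    have -> : si = upd (upd si c (ibound A)) c 0%N.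
      by rewrite upd_upd -(si0 c) ?mem_head ?upd_id.
    exact: located_nstore.
  apply: found_or_nstore; case: fo' => [fs|[t0 [x b]]]; [by left|right].
  split=> //; split=> // si' h1 h2; apply: b => // [d dcs|].
    by apply: h2; rewrite inE dcs orbT.
  by apply: h2; rewrite mem_head.
Qed.

(** If the flag is still 0, every sample has failed at every valuation, and [sample_complete] then
    excludes any solution. *)
Lemma runs_find :
  {in samples r (fname f) (atoms f), forall d, size d.1 < S}%N ->
  exists2 T, polybounded T & forall A ro z s, (0 < ibound A)%N -> (0 < z)%N -> (ibound A <= z)%N ->
    located A ro (fun=> 0%N) s ->
    runs (find r f) s (T z) (fun s' => located A ro (fun=> 0%N) s' /\
      (found A s' \/ ntmp s' 0 = 0%N /\
         ~ exists x, holds A (fun=> 0%N) (upd ro r x) f)).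
Proof.
rewrite /find; set M := fname f => hS.
pose Bad d A ro si := ~ holds A si (upd ro r (candidate_root A ro d si)) f.
suff [T bT hT] : exists2 T, polybounded T & forall A ro z s X, (0 < z)%N ->
    (ibound A <= z)%N -> located A ro (fun=> 0%N) s -> found_or A X s ->
    runs (foldr (fun d p => Seq (nest (iota M (M + M))
               (If (BNLe (NLoad (tmp 0)) (NConst 0)) (attempt r f d) Skip)) p)
       Skip (samples r M (atoms f))) s (T z) (fun s' => located A ro (fun=> 0%N) s' /\
      found_or A (X /\ {in samples r M (atoms f), forall d si',
        (forall c, c \notin iota M (M + M) -> si' c = 0%N) ->
        {in iota M (M + M), forall c, si' c < ibound A}%N -> Bad d A ro si'}) s').
  exists (fun z => 1 + T z)%N; first by eauto with polyb.
  move=> A ro z s A0 z0 Az lo; apply/runs_seq/runs_nstore => /=.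
  have [l1 l2 l3] := lo.
  apply: runs_mono (hT A ro z _ True z0 Az _ _) _.
  - split=> //.
      rewrite -l1 /struct_of; congr Structure.
      by apply/funext => i; rewrite /narr /= ifF //; lia.
    by rewrite -l2; apply/funext => j; rewrite /nvar /= ifF //; lia.
  - by right; split=> //; rewrite /ntmp /=.
  - move=> s' [lo' fo']; split=> //; case: fo' => [|[t0 [_ b]]]; [by left|right].
    split=> // -[x hx].
    have [|q [k [si' [h1 h2 h3 h4]]]] := sample_complete rf (leqnn M) _ hx.
      by [].
    apply: (b (q, k) h1 si' h2) => //.
move: hS (fun d (h : d \in samples r M (atoms f)) => h).
elim: {1 2 4 5}(samples r M (atoms f)) => [|d ds IH] /= hS sub.
  exists (fun=> 1%N) => [|A ro z s X z0 Az lo fo]; first exact: polybounded_const.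
  apply: runs_skip; split=> //.
  by case: fo => [|[t0 x]]; [left|right].
have hS' : {in ds, forall d, size d.1 < S}%N.
  by move=> e he; apply: hS; rewrite inE he orbT.
have [|T bT hT] := IH hS'; first by move=> e he; apply: sub; rewrite inE he orbT.
have [T1 bT1 hT1] := runs_attempt (sub d (mem_head _ _)) (hS d (mem_head _ _)).
have hM : {in iota M (M + M), forall c, M <= c}%N.
  by move=> c; rewrite mem_iota => /andP[].
have [T2 bT2 hT2] := runs_nest bT1 (iota_uniq M (M + M)) hM hT1.
exists (fun z => T2 z + T z)%N; first by eauto with polyb.
move=> A ro z s X z0 Az lo fo; apply: runs_seq.
apply: runs_mono (hT2 A ro z s _ X z0 Az lo _ _ fo) _ => // s1 [lo1 fo1].
apply: runs_mono (hT A ro z s1 _ z0 Az lo1 fo1) _ => s2 [lo2 fo2]; split=> //.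
case: fo2 => [|[t0 [[x b] b']]]; [by left|right].
split=> //; split=> // e; rewrite inE => /orP[/eqP->|]; last exact: b'.
exact: b.
Qed.

End Correctness.
End Search.

(** * Rearrangement of the input *)

Section Relocation.
Context {R : realType}.
Variable S : nat.
Implicit Types (s : state R).

(* A counter cell beyond the input; cell 1 contains the number of edges. *)
Definition counter : nexpr :=
  let m := NLoad (NConst 1) in
  NAdd (NAdd (NAdd m m) (NAdd m m)) (NConst 5).

(** The input is contiguous, whereas arrays live in even cells. Cell i moves to cell 2 i in
    decreasing order of i, so that no unread cell is overwritten; cell 1 is moved last because the
    address of the counter is computed from it. *)
Definition relocate_nat : cmd :=
  let m := NLoad (NConst 1) in
  Seq (NStore counter (NAdd (NAdd m m) (NConst 1)))
  (Seq (While (BNLe (NConst 2) (NLoad counter))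
    (Seq (NStore (NAdd (NLoad counter) (NLoad counter)) (NLoad (NLoad counter)))
    (Seq (NStore (NLoad counter) (NConst 0))
      (NStore counter (NSub (NLoad counter) (NConst 1))))))
  (Seq (NStore counter (NConst 0))
  (Seq (NStore (NConst 2) (NLoad (NConst 1)))
       (NStore (NConst 1) (NConst 0))))).

Lemma runs_relocate_nat (g : nat -> nat) s : nmem s = g ->
  (forall x, (2 * g 1 + 2 <= x)%N -> g x = 0%N) ->
  runs relocate_nat s (2 * g 1 * 4 + 5) (fun s' => rmem s' = rmem s /\
    forall x, nmem s' x = if odd x then 0%N else g x./2).
Proof.
move=> sg g0; set m := g 1%N in g0 *.
(* Cells up to i are untouched, even cells above twice i hold the moved entries, and the rest is
   cleared. The counter 4 m + 5 lies beyond the last target 2 (2 m + 1). *)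
pose layout (i x : nat) := if x == (4 * m + 5)%N then i else if (x <= i)%N then g x
  else if ~~ odd x && (i < x./2)%N then g x./2 else 0%N.
pose I k s' := rmem s' = rmem s /\ forall x, nmem s' x = layout (2 * m + 1 - k)%N x.
have ca s' : nmem s' 1 = m -> neval s' counter = (4 * m + 5)%N.
  by move=> h; rewrite /= h; lia.
have step k s' : (k < 2 * m)%N -> I k s' ->
    beval s' (BNLe (NConst 2) (NLoad counter)) /\
    runs (Seq (NStore (NAdd (NLoad counter) (NLoad counter)) (NLoad (NLoad counter)))
      (Seq (NStore (NLoad counter) (NConst 0))
      (NStore counter (NSub (NLoad counter) (NConst 1))))) s' 3 (I k.+1).
  move=> km [rE nE]; set i := (2 * m + 1 - k)%N.
  have i2 : (2 <= i <= 2 * m + 1)%N by rewrite /i; lia.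
  have h1 : nmem s' 1 = m.
    by rewrite nE -/i /layout ifF; [rewrite ifT //; lia|lia].
  have hc : nmem s' (4 * m + 5) = i by rewrite nE /layout eqxx.
  have ci : neval s' (NLoad counter) = i.
    by rewrite [neval _ _]/= -[(_ + _ + 5)%N]/(neval s' counter) ca.
  split; first by rewrite -[beval _ _]/(2 <= neval s' (NLoad counter))%N ci; lia.
  apply: (runs_seq (T1 := 1) (T2 := 2)); apply: runs_nstore.
  have -> : neval s' (NAdd (NLoad counter) (NLoad counter)) = (i + i)%N.
    by rewrite -[LHS]/(neval s' (NLoad counter) + neval s' (NLoad counter))%N ci.
  have -> : neval s' (NLoad (NLoad counter)) = g i.
    rewrite -[LHS]/(nmem s' (neval s' (NLoad counter))) ci nE -/i /layout ifF; last by lia.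
    by rewrite leqnn.
  set s1 := nstore _ _ _.
  have c1 : neval s1 (NLoad counter) = i.
    rewrite -[LHS]/(nmem s1 (neval s1 counter)) ca; last first.
      by rewrite /s1 /= ifF //; lia.
    by rewrite /s1 /= ifF ?hc //; lia.
  apply: (runs_seq (T1 := 1) (T2 := 1)); apply: runs_nstore; rewrite c1.
  set s2 := nstore _ _ _.
  have n21 : nmem s2 1 = m by rewrite /s2 /= !ifF //; lia.
  apply: runs_nstore; rewrite ca //.
  have -> : neval s2 (NSub (NLoad counter) (NConst 1)) = (2 * m + 1 - k.+1)%N.
    rewrite -[LHS]/(nmem s2 (neval s2 counter) - 1)%N ca //.
    by rewrite /s2 /s1 /= !ifF ?hc /i //; lia.
  split=> // x; rewrite /s2 /s1 /=; case: eqP => [->|/eqP xc].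
    by rewrite /layout eqxx.
  have i'E : (2 * m + 1 - k.+1)%N = (i - 1)%N by rewrite /i; lia.
  rewrite i'E /layout (negbTE xc); case: eqP => [->|/eqP xi].
    rewrite ifF; last by lia.
    by rewrite ifF //; lia.
  case: eqP => [->|/eqP xii].
    rewrite ifF; last by lia.
    rewrite ifT; first by congr g; lia.
    by rewrite addnn odd_double /= -addnn; lia.
  rewrite nE -/i /layout (negbTE xc).
  have -> : (x <= i - 1)%N = (x <= i)%N by lia.
  case: (leqP x i) => // ix; case ox: (odd x) => //=.
  have -> : (i - 1 < x./2)%N = (i < x./2)%N by lia.
  by [].
have -> : (2 * m * 4 + 5 = 1 + ((2 * m * 4).+1 + (1 + (1 + 1))))%N by lia.
have s1 : nmem s 1 = m by rewrite sg.
apply/runs_seq/runs_nstore/runs_seq; rewrite ca //.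
apply: (@runs_while _ _ _ I (2 * m)) => //.
  move=> s' [rE nE].
  have h1 : nmem s' 1 = m.
    by rewrite nE /layout ifF; [rewrite ifT //; lia|lia].
  have hc : nmem s' (4 * m + 5) = 1%N by rewrite nE /layout eqxx; lia.
  have ci : neval s' (NLoad counter) = 1%N.
    by rewrite -[LHS]/(nmem s' (neval s' counter)) ca.
  split; first by rewrite -[beval _ _]/(2 <= neval s' (NLoad counter))%N ci.
  apply/runs_seq/runs_nstore/runs_seq/runs_nstore/runs_nstore; rewrite ca //=.
  split=> // x; rewrite [in if 1 == _ then _ else _]ifF; last by lia.
  rewrite h1; case: eqP => [->//|/eqP x1]; case: eqP => [->//|/eqP x2].
  case: eqP => [->|/eqP xc]; first by rewrite ifT //; lia.
  rewrite nE /layout (negbTE xc) addnC addnK.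
  case ox: (odd x) => /=; first by rewrite ifF //; lia.
  case: x x1 x2 xc ox => [|x] x1 x2 xc ox //=.
  rewrite ifF; last by lia.
  by rewrite ifT //; move: ox => /=; lia.
split=> //= x; rewrite s1 sg.
have -> : (m + m + 1 = 2 * m + 1)%N by lia.
rewrite subn0 /layout; case: eqP => // /eqP xc.
case: (leqP x (2 * m + 1)) => // hx.
case: ifP => [/andP[_ h]|_]; last by rewrite g0 //; lia.
by rewrite !g0 //; lia.
Qed.

(** Decreasing order again protects the unread cells, as S + 2 j is at least j. The counter is
    integer cell 1, which is empty by now and ends at 0. The original real cells are not erased, so
    real variables start with arbitrary values. *)
Definition relocate_real : cmd :=
  let v := NConst 1 in
  Seq (NStore v (NAdd (NLoad (NConst 0)) (NLoad (NConst 0))))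
  (While (BNLe (NConst 1) (NLoad v))
    (Seq (NStore v (NSub (NLoad v) (NConst 1)))
         (RStore (NAdd (NConst S) (NAdd (NLoad v) (NLoad v))) (RLoad (NLoad v))))).

Lemma runs_relocate_real (g : nat -> R) s : rmem s = g -> nmem s 1 = 0%N ->
  let n := nmem s 0 in
  runs relocate_real s (2 * n * 3 + 2) (fun s' => nmem s' = nmem s /\
    forall j, (j < 2 * n)%N -> rmem s' (S + (j + j)) = g j).
Proof.
move=> sg s1 n.
pose I k s' := [/\ (forall x, nmem s' x = if x == 1%N then (2 * n - k)%N else nmem s x),
  forall x, (x < 2 * n - k)%N -> rmem s' x = g x
  & forall j, (2 * n - k <= j < 2 * n)%N -> rmem s' (S + (j + j)) = g j].
have -> : (2 * n * 3 + 2 = 1 + (2 * n * 3).+1)%N by lia.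
apply/runs_seq/runs_nstore/(@runs_while _ _ _ I (2 * n)).
- move=> k s' kn [nE lo hi]; split; first by rewrite /= nE /=; lia.
  apply: (runs_seq (T1 := 1) (T2 := 1)); apply/runs_nstore/runs_rstore => /=.
  rewrite nE /=; set i := (2 * n - k - 1)%N.
  have iE : (2 * n - k.+1)%N = i by rewrite /i; lia.
  split=> /=.
  + by move=> x; rewrite iE; case: eqP => // ne; rewrite nE; case: eqP.
  + move=> x; rewrite iE => xi; rewrite ifF; last by lia.
    by apply: lo; rewrite /i in xi *; lia.
  + move=> j; rewrite iE => /andP[ij jn].
    case: eqP => [e|ne].
      have -> : j = i by lia.
      by apply: lo; rewrite /i; lia.
    by apply: hi; rewrite /i in ij ne *; lia.
- move=> s' [nE lo hi]; split; first by rewrite /= nE /= subnn.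
  split; last by move=> j jn; apply: hi; rewrite subnn.
  by apply/funext => x; rewrite nE subnn; case: eqP => // ->.
- split=> /=.
  + by move=> x; case: eqP => // _; rewrite subn0; lia.
  + by move=> x _; rewrite sg.
  + by move=> j; lia.
Qed.

End Relocation.

(** * Paths in finite unions of segments *)

(** For the induction of [refine_segment] on the number of cut points inside an interval. *)
Lemma count_ltn (T : eqType) (P Q : pred T) (s : seq T) e :
  e \in s -> ~~ P e -> (forall x, P x -> Q x) -> Q e -> (count P s < count Q s)%N.
Proof.
move=> es nP PQ Qe; elim: s es => // a s IH; rewrite inE /= => /orP[/eqP<-|es].
  by rewrite (negbTE nP) Qe add0n add1n ltnS; apply: sub_count.
have := IH es; case Pa: (P a); first by rewrite (PQ _ Pa) ltn_add2l.
by move=> h; rewrite add0n; apply: leq_trans h (leq_addl _ _).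
Qed.

Section Paths.
Context {R : realType}.
Implicit Types (p q u v x y : R * R) (X : set (R * R)) (w : seq (R * R)).

(** Minkowski from Cauchy-Schwarz, which is Lagrange's identity with remainder (ad - bc)^2. *)
Lemma sqrt_addr_le (a b c d : R) :
  Num.sqrt ((a + c) ^+ 2 + (b + d) ^+ 2) <=
  Num.sqrt (a ^+ 2 + b ^+ 2) + Num.sqrt (c ^+ 2 + d ^+ 2).
Proof.
set A := a ^+ 2 + b ^+ 2; set C := c ^+ 2 + d ^+ 2.
have A0 : 0 <= A by rewrite addr_ge0 ?sqr_ge0.
have C0 : 0 <= C by rewrite addr_ge0 ?sqr_ge0.
have CS : a * c + b * d <= Num.sqrt A * Num.sqrt C.
  rewrite -sqrtrM // (le_trans (ler_norm _)) // -sqrtr_sqr ler_sqrt ?mulr_ge0 //.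
  rewrite /A /C -subr_ge0.
  have -> : (a ^+ 2 + b ^+ 2) * (c ^+ 2 + d ^+ 2) - (a * c + b * d) ^+ 2 =
    (a * d - b * c) ^+ 2 by ring.
  exact: sqr_ge0.
have S0 : 0 <= Num.sqrt A + Num.sqrt C by rewrite addr_ge0 ?sqrtr_ge0.
rewrite -[leRHS]ger0_norm // -sqrtr_sqr ler_sqrt ?sqr_ge0 //.
rewrite [leRHS]sqrrD !sqr_sqrtr //.
have -> : (a + c) ^+ 2 + (b + d) ^+ 2 = A + C + (a * c + b * d) *+ 2.
  by rewrite /A /C; ring.
by rewrite addrAC lerD2r; rewrite lerD2l lerMn2r CS orbT.
Qed.

Lemma edist_ge0 p q : 0 <= edist p q.
Proof. exact: sqrtr_ge0. Qed.

Lemma edistxx p : edist p p = 0.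
Proof. by rewrite /edist !subrr expr0n /= addr0 sqrtr0. Qed.

Lemma edistC p q : edist p q = edist q p.
Proof. by rewrite /edist -(sqrrN (p.1 - q.1)) -(sqrrN (p.2 - q.2)) !opprB. Qed.

Lemma edist_triangle x p q : edist p q <= edist p x + edist x q.
Proof.
rewrite /edist.
have -> : p.1 - q.1 = (p.1 - x.1) + (x.1 - q.1) by ring.
have -> : p.2 - q.2 = (p.2 - x.2) + (x.2 - q.2) by ring.
exact: sqrt_addr_le.
Qed.

Definition seg_point p q (t : R) : R * R :=
  ((1 - t) * p.1 + t * q.1, (1 - t) * p.2 + t * q.2).

Lemma seg_point0 p q : seg_point p q 0 = p.
Proof. by rewrite /seg_point; case: p => a b /=; congr pair; ring. Qed.

Lemma seg_point1 p q : seg_point p q 1 = q.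
Proof. by rewrite /seg_point; case: q => a b /=; congr pair; ring. Qed.

Lemma seg_pointC p q t : seg_point p q t = seg_point q p (1 - t).
Proof. by rewrite /seg_point; congr pair; ring. Qed.

Lemma segmentC p q : segment p q = segment q p.
Proof.
suff h u v x : segment u v x -> segment v u x by apply/seteqP; split=> x; apply: h.
move=> [t /andP[t0 t1] ->]; exists (1 - t); last exact: seg_pointC.
by apply/andP; split; lra.
Qed.

Lemma segment_left p q : segment p q p.
Proof. by exists 0; rewrite ?lexx ?ler01 //; apply/esym/seg_point0. Qed.

Lemma segment_right p q : segment p q q.
Proof. by rewrite segmentC; apply: segment_left. Qed.

Lemma edist_seg_point p q s t :
  edist (seg_point p q s) (seg_point p q t) = `|s - t| * edist p q.
Proof.
rewrite /edist /= -sqrtr_sqr -sqrtrM ?sqr_ge0 //; congr Num.sqrt; ring.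
Qed.

Lemma seg_point_inj p q s t : p <> q -> seg_point p q s = seg_point p q t -> s = t.
Proof.
move=> pq [h1 h2]; have [e|/eqP ne] := eqVneq p.1 q.1; last first.
  apply/eqP; rewrite -subr_eq0; have : (s - t) * (q.1 - p.1) == 0 by apply/eqP; lra.
  by rewrite mulf_eq0 => /orP[//|/eqP e0]; case: ne; lra.
have [e'|/eqP ne] := eqVneq p.2 q.2.
  by case: pq; case: p q e e' {h1 h2} => a b [c d] /= -> ->.
apply/eqP; rewrite -subr_eq0; have : (s - t) * (q.2 - p.2) == 0 by apply/eqP; lra.
by rewrite mulf_eq0 => /orP[//|/eqP e0]; case: ne; lra.
Qed.

Lemma seg_point_comp p q s t r :
  seg_point (seg_point p q s) (seg_point p q t) r =
  seg_point p q ((1 - r) * s + r * t).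
Proof. by rewrite /seg_point /=; congr pair; ring. Qed.

Lemma segment_sub p q x y : segment p q x -> segment p q y ->
  segment x y `<=` segment p q.
Proof.
move=> [s /andP[s0 s1] ->] [t /andP[t0 t1] ->] _ [r /andP[r0 r1] ->].
exists ((1 - r) * s + r * t); last exact: seg_point_comp.
by apply/andP; split; nra.
Qed.

(** If two parameters are hit, [segment p q] lies on the line and the parameter is affine in the
    position on it, with slope k; the sign of k decides which end is c. Otherwise at most one
    parameter is hit, and c = 1, d = 0 encodes the empty set. *)
Lemma segment_line_interval u v p q : u <> v ->
  exists c d, forall t, segment p q (seg_point u v t) <-> c <= t <= d.
Proof.
move=> uv.
have [[t1 [t2 [t12 [s1 _ e1] [s2 _ e2]]]]|none] := pselect (exists t1 t2,
    [/\ t1 <> t2, segment p q (seg_point u v t1) & segment p q (seg_point u v t2)]).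
  have s12 : s2 - s1 != 0.
    apply/eqP => s0; apply: t12; apply: (seg_point_inj uv); rewrite e1 e2.
    by have -> : s1 = s2 by lra.
  pose k := (t2 - t1) / (s2 - s1).
  have k0 : k != 0.
    by rewrite mulf_neq0 ?invr_eq0 // subr_eq0; apply/eqP => /esym.
  move: e1 e2 => -[e11 e12] [e21 e22].
  have kE : k * (s2 - s1) = t2 - t1 by rewrite mulfVK.
  have h1 : q.1 - p.1 = k * (v.1 - u.1).
    apply: (mulIf s12); rewrite mulrAC kE; lra.
  have h2 : q.2 - p.2 = k * (v.2 - u.2).
    apply: (mulIf s12); rewrite mulrAC kE; lra.
  have pE s : seg_point p q s = seg_point u v ((t1 - s1 * k) + s * k).
    have p1 : p.1 = u.1 + t1 * (v.1 - u.1) - s1 * (k * (v.1 - u.1)).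
      by rewrite -h1; lra.
    have p2 : p.2 = u.2 + t1 * (v.2 - u.2) - s1 * (k * (v.2 - u.2)).
      by rewrite -h2; lra.
    rewrite /seg_point; congr pair.
      have -> : (1 - s) * p.1 + s * q.1 = p.1 + s * (q.1 - p.1) by ring.
      by rewrite h1 p1; ring.
    have -> : (1 - s) * p.2 + s * q.2 = p.2 + s * (q.2 - p.2) by ring.
    by rewrite h2 p2; ring.
  set a := t1 - s1 * k in pE.
  have segE t : segment p q (seg_point u v t) <-> exists2 s, 0 <= s <= 1 & t = a + s * k.
    split=> -[s hs e]; exists s => //.
      by apply: (seg_point_inj uv); rewrite e -pE.
    by rewrite e -/(seg_point p q s) pE.
  have [kp|kn] := ltP 0 k.
    exists a, (a + k) => t; rewrite segE; split.
      by move=> [s /andP[s0 s1'] ->]; apply/andP; split; nra.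
    move=> /andP[h h']; exists ((t - a) / k); last by rewrite mulfVK // addrC subrK.
    by rewrite divr_ge0 ?ler_pdivrMr ?mul1r ?(ltW kp) //=; lra.
  have {}kn : k < 0 by rewrite lt_neqAle k0.
  exists (a + k), a => t; rewrite segE; split.
    by move=> [s /andP[s0 s1'] ->]; apply/andP; split; nra.
  move=> /andP[h h']; exists ((t - a) / k); last by rewrite mulfVK // addrC subrK.
  rewrite -mulrNN -invrN divr_ge0 ?ler_pdivrMr ?mul1r ?oppr_gt0 //=; lra.
have [[t0 ht0]|nex] := pselect (exists t, segment p q (seg_point u v t)).
  exists t0, t0 => t; split=> [ht|].
    suff -> : t = t0 by rewrite lexx.
    by apply: contrapT => tt0; apply: none; exists t, t0.
  by rewrite -eq_le => /eqP <-.
exists 1, 0 => t; split=> [ht|]; last by lra.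
by case: nex; exists t.
Qed.

(** Paths each of whose steps stays inside a single segment of the list, so that one can argue edge
    by edge. *)
Fixpoint steps (Ss : seq ((R * R) * (R * R))) u w : Prop :=
  if w is x :: w' then
    (exists2 S, S \in Ss & segment S.1 S.2 u /\ segment S.1 S.2 x)
    /\ steps Ss x w'
  else True.

Lemma steps_cat Ss u w w' :
  steps Ss u w -> steps Ss (last u w) w' -> steps Ss u (w ++ w').
Proof. by elim: w u => //= x w IH u [h1 h2] h3; split=> //; apply: IH. Qed.

Lemma path_length_cat u w w' :
  path_length u (w ++ w') = path_length u w + path_length (last u w) w'.
Proof. by elim: w u => [|x w IH] u /=; rewrite ?add0r // IH addrA. Qed.

Lemma path_within_cat X u w w' :
  path_within X u w -> path_within X (last u w) w' -> path_within X u (w ++ w').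
Proof. by elim: w u => //= x w IH u [h1 h2] h3; split=> //; apply: IH. Qed.

Lemma path_within_sub X Y u w : X `<=` Y -> path_within X u w -> path_within Y u w.
Proof.
move=> XY; elim: w u => //= x w IH u [h1 h2]; split; last exact: IH.
exact: subset_trans h1 XY.
Qed.

Lemma path_length_ge0 u w : 0 <= path_length u w.
Proof. by elim: w u => //= x w IH u; rewrite addr_ge0 ?edist_ge0. Qed.

Lemma edist_path_length u w : edist u (last u w) <= path_length u w.
Proof.
elim: w u => [|x w IH] u /=; first by rewrite edistxx.
by apply: le_trans (edist_triangle x _ _) _; rewrite lerD2l.
Qed.

Lemma path_reverse X u w : path_within X u w ->
  exists w', [/\ path_within X (last u w) w', last (last u w) w' = u
    & path_length (last u w) w' = path_length u w].
Proof.
elim: w u => [|x w IH] u /=; first by exists [::].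
move=> [h1 /IH[w' [h2 h3 h4]]]; exists (w' ++ [:: u]).
rewrite path_length_cat last_cat h4 h3 /= addr0 addrC (edistC x); split=> //.
by apply: path_within_cat => //=; rewrite h3 segmentC.
Qed.

(** Each segment of the list meets the line in an interval of parameters. Cut at the ends of these
    intervals: a piece with no such end inside is covered entirely by the segment that covers its
    midpoint. The induction is on the number of ends strictly inside. *)
Lemma refine_segment Ss u v : u <> v ->
  (forall t, 0 <= t <= 1 -> exists2 S, S \in Ss & segment S.1 S.2 (seg_point u v t)) ->
  exists w, [/\ steps Ss u w, last u w = v & path_length u w = edist u v].
Proof.
move=> uv cov.
have /choice[cd cdP] : forall S : (R * R) * (R * R), exists cd : R * R, forall t,
    segment S.1 S.2 (seg_point u v t) <-> cd.1 <= t <= cd.2.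
  by move=> S; have [c [d h]] := segment_line_interval S.1 S.2 uv; exists (c, d).
pose L := [seq (cd sg).1 | sg <- Ss] ++ [seq (cd sg).2 | sg <- Ss].
suff h n a b : 0 <= a -> a <= b -> b <= 1 ->
    (count (fun e => a < e < b)%R L <= n)%N ->
    exists w, [/\ steps Ss (seg_point u v a) w, last (seg_point u v a) w = seg_point u v b
      & path_length (seg_point u v a) w = (b - a) * edist u v].
  have [//||||w] := h (size L) 0 1; rewrite ?count_size //.
  by rewrite seg_point0 seg_point1 subr0 mul1r; exists w.
elim: n a b => [|n IH] a b a0 ab b1 hc.
  move: hc; rewrite leqn0 => /eqP hc.
  have nL e : e \in L -> ~~ (a < e < b).
    move=> eL; apply/negP => h; move: hc; apply/eqP; rewrite -lt0n -has_count.
    by apply/hasP; exists e.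
  have [S SS hm] := cov ((a + b) / 2) ltac:(apply/andP; split; lra).
  exists [:: seg_point u v b] => /=; rewrite addr0 edist_seg_point distrC ger0_norm ?subr_ge0 //.
  split=> //; split=> //; exists S => //.
  move: hm; rewrite !cdP => /andP[hm1 hm2].
  have L1 : (cd S).1 \in L by rewrite mem_cat; apply/orP; left; apply/mapP; exists S.
  have L2 : (cd S).2 \in L by rewrite mem_cat; apply/orP; right; apply/mapP; exists S.
  have := nL _ L1; have := nL _ L2; rewrite !negb_and -!leNgt.
  by move=> /orP[] g1 /orP[] g2; split; apply/andP; split; lra.
have [/hasP[e eL /andP[ae eb]]|] := boolP (has (fun e => a < e < b)%R L); last first.
  by rewrite has_count -leqNgt leqn0 => /eqP hc0; apply: IH; rewrite ?hc0.
have lt1 : (count (fun e' => a < e' < e)%R L < count (fun e' => a < e' < b)%R L)%N.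
  apply: (count_ltn eL); rewrite ?ltxx ?andbF ?ae ?eb // => e' /andP[->] /=.
  by move=> h; apply: lt_trans h eb.
have lt2 : (count (fun e' => e < e' < b)%R L < count (fun e' => a < e' < b)%R L)%N.
  apply: (count_ltn eL); rewrite ?ltxx ?ae ?eb // => e' /andP[h ->] /=.
  by rewrite (lt_trans ae h).
have [w1 [p1 p2 p3]] := IH a e a0 (ltW ae) (le_trans (ltW eb) b1) (leq_trans lt1 hc).
have [w2 [q1 q2 q3]] := IH e b (le_trans a0 (ltW ae)) (ltW eb) b1 (leq_trans lt2 hc).
exists (w1 ++ w2); rewrite last_cat p2 path_length_cat p2 p3 q3; split=> //.
  by apply: steps_cat; rewrite ?p2.
by rewrite -mulrDl; congr (_ * _); ring.
Qed.

Lemma refine_path Ss X u w :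
  (forall x, X x -> exists2 S, S \in Ss & segment S.1 S.2 x) ->
  path_within X u w -> exists w', [/\ steps Ss u w', last u w' = last u w
    & path_length u w' = path_length u w].
Proof.
move=> cov; elim: w u => [|x w IH] u /=; first by exists [::].
move=> [h1 /IH[w2 [q1 q2 q3]]].
have [ux|ux] := pselect (u = x).
  by exists w2; rewrite ux edistxx add0r.
have [|w1 [p1 p2 p3]] := @refine_segment Ss u x ux.
  by move=> t ht; apply: cov; apply: h1; exists t.
exists (w1 ++ w2); rewrite last_cat path_length_cat p2 p3 q3; split=> //.
by apply: steps_cat; rewrite ?p2.
Qed.

Implicit Types l : R.

(** Upper bounds on path lengths take the place of distances: no infimum needs to be attained, and
    the resulting conditions can be written in first-order form. *)
Definition joined X u v (l : R) : Prop :=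
  exists w, [/\ path_within X u w, last u w = v & path_length u w <= l].

Lemma joined_refl X u l : 0 <= l -> joined X u u l.
Proof. by move=> l0; exists [::]; split. Qed.

Lemma joined_le X u v l l' : l <= l' -> joined X u v l -> joined X u v l'.
Proof. by move=> ll' [w [h1 h2 h3]]; exists w; split=> //; apply: le_trans ll'. Qed.

Lemma joined_trans X x u v l l' : joined X u x l -> joined X x v l' -> joined X u v (l + l').
Proof.
move=> [w [h1 h2 h3]] [w' [h1' h2' h3']]; exists (w ++ w').
rewrite last_cat path_length_cat h2; split=> //; last exact: lerD.
by apply: path_within_cat; rewrite ?h2.
Qed.

Lemma joined_sym X u v l : joined X u v l -> joined X v u l.
Proof.
move=> [w [h1 h2 h3]]; have [w' [q1 q2 q3]] := path_reverse h1.
by exists w'; rewrite -h2; split=> //; rewrite q3.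
Qed.

Lemma edist_joined X u v l : joined X u v l -> edist u v <= l.
Proof.
by move=> [w [_ <- h]]; apply: le_trans (edist_path_length _ _) h.
Qed.

Lemma joined_sub X Y u v l : X `<=` Y -> joined X u v l -> joined Y u v l.
Proof.
by move=> XY [w [h1 h2 h3]]; exists w; split=> //; apply: path_within_sub h1.
Qed.

Lemma joined_segment X u v : segment u v `<=` X -> joined X u v (edist u v).
Proof. by move=> h; exists [:: v]; rewrite /= addr0; split. Qed.

Lemma dist_within_joined X u v l : joined X u v l -> (dist_within X u v <= l%:E)%E.
Proof.
move=> [w [h1 h2 h3]]; apply: le_trans (_ : ((path_length u w)%:E <= _)%E).
  by apply: ereal_inf_lbound; exists w.
by rewrite lee_fin.
Qed.

Lemma dist_within_lt X u v (r : R) : (dist_within X u v < r%:E)%E <->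
  exists2 l, l < r & joined X u v l.
Proof.
split=> [/ereal_inf_lt[_ [w [h1 h2] <-]]|[l lr /dist_within_joined h]].
  by rewrite lte_fin => h; exists (path_length u w) => //; exists w; split.
by apply: le_lt_trans h _; rewrite lte_fin.
Qed.

Lemma dist_within_ge0 X u v : (0 <= dist_within X u v)%E.
Proof.
by apply: le_ereal_inf_tmp => _ [w _ <-]; rewrite lee_fin path_length_ge0.
Qed.

End Paths.

(** * Distances in a network *)

Section NetworkDistance.
Context {R : realType}.
Variable N : network R.
Implicit Types (e f : 'I_(nvert N) * 'I_(nvert N)) (b : bool) (t l : R)
  (u v x : R * R) (i j : 'I_(nvert N)).

Definition edge_end e b : 'I_(nvert N) := if b then e.2 else e.1.
Definition edge_point e t : R * R := seg_point (pos e.1) (pos e.2) t.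
Definition edge_length e : R := edist (pos e.1) (pos e.2).
(* the fraction of the edge between the point of parameter t and an end *)
Definition end_offset t b : R := if b then 1 - t else t.

Local Notation joined := (joined (locus N)).

(** These conditions determine the vertex distances without mentioning a minimum: the first three
    bound D by the length of any walk along edges, and the last supplies a path for each entry. *)
Definition distance_table (D : 'I_(nvert N) -> 'I_(nvert N) -> R) : Prop :=
  [/\ forall i, D i i = 0, forall i k j, D i j <= D i k + D k j,
    forall e, e \in edges N -> D e.1 e.2 = edge_length e /\ D e.2 e.1 = edge_length e
    & forall i j, joined (pos i) (pos j) (D i j)].

(** Either the path stays inside the edge, or it leaves e at its end b and enters f at its end
    b'. *)
Definition reach (D : 'I_(nvert N) -> 'I_(nvert N) -> R) e t f t' l : Prop :=
  e = f /\ `|t - t'| * edge_length e <= l \/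
  exists b b', end_offset t b * edge_length e + D (edge_end e b) (edge_end f b')
    + end_offset t' b' * edge_length f <= l.

Lemma edge_exists : edges N != [::] -> exists e, e \in edges N.
Proof. by case: (edges N) => // e es _; exists e; rewrite mem_head. Qed.

Hypotheses (plane : plane_network N) (conn : connected_network N)
  (has_edge : edges N != [::]).

Lemma pos_inj : injective (@pos R N).
Proof. by case: plane. Qed.

Lemma edge_neq e : e \in edges N -> pos e.1 <> pos e.2.
Proof.
by case: plane => _ _ h _ /h/eqP ne /pos_inj.
Qed.

Lemma edge_point_inj e t t' : e \in edges N ->
  edge_point e t = edge_point e t' -> t = t'.
Proof. by move=> /edge_neq; apply: seg_point_inj. Qed.

Lemma edge_sub_locus e : e \in edges N -> edge_segment e `<=` locus N.
Proof. by move=> ein x hx; right; exists e. Qed.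

Lemma locus_edges x : locus N x -> exists2 e, e \in edges N & edge_segment e x.
Proof.
case=> [[i _ <-]|[e ein hx]]; last by exists e.
have [e0 e0in] := edge_exists has_edge.
have [->|ie] := eqVneq i e0.1.
  by exists e0 => //; apply: segment_left.
have [_ /(_ i e0.1)/connectP[[|j p] /=]] := conn.
  by move=> _ e0i; rewrite e0i eqxx in ie.
move=> /andP[/orP[] ij _ _]; eexists; try exact: ij.
  exact: segment_left.
exact: segment_right.
Qed.

Lemma locus_edge_point x : locus N x <->
  exists e t, [/\ e \in edges N, 0 <= t <= 1 & x = edge_point e t].
Proof.
split=> [/locus_edges[e ein [t ht ->]]|[e [t [ein ht ->]]]]; first by exists e, t.
by apply: (edge_sub_locus ein); exists t.
Qed.

Lemma edge_point_end e b : edge_point e b%:R = pos (edge_end e b).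
Proof. by case: b; rewrite /edge_point ?seg_point0 ?seg_point1. Qed.

Lemma end_offset_end b : end_offset b%:R b = 0.
Proof. by case: b; rewrite /= ?subrr. Qed.

Lemma edge_ends_end e x : edge_ends e x -> exists b, x = pos (edge_end e b).
Proof. by case=> ->; [exists false|exists true]. Qed.

Lemma common_point e f t t' : e \in edges N -> f \in edges N -> e != f ->
  0 <= t <= 1 -> 0 <= t' <= 1 -> edge_point e t = edge_point f t' ->
  exists b b', [/\ edge_end e b = edge_end f b', t = b%:R & t' = b'%:R].
Proof.
move=> ein fin ef ht ht' E.
have [_ _ _ /(_ e f ein fin ef (edge_point e t))] := plane.
case=> [|/edge_ends_end[b hb] /edge_ends_end[b' hb']].
  by split; [exists t|rewrite E; exists t'].
exists b, b'; split; first by apply: pos_inj; rewrite -hb -hb'.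
  by apply: (edge_point_inj ein); rewrite hb edge_point_end.
by apply: (edge_point_inj fin); rewrite -E hb' edge_point_end.
Qed.

Section Reach.
Variable D : 'I_(nvert N) -> 'I_(nvert N) -> R.
Hypothesis table : distance_table D.

Lemma edge_length_ge0 e : 0 <= edge_length e.
Proof. exact: edist_ge0. Qed.

Lemma end_offset_le t t' b : end_offset t b <= `|t - t'| + end_offset t' b.
Proof.
have h1 := ler_norm (t - t'); have h2 := ler_norm (t' - t).
by rewrite distrC in h2; rewrite /end_offset; case: b; lra.
Qed.

Lemma reach_le e t f t' l l' : l <= l' -> reach D e t f t' l -> reach D e t f t' l'.
Proof.
move=> ll' [[-> h]|[b [b' h]]]; [left; split=> //|right; exists b, b'];
  exact: le_trans ll'.
Qed.

Lemma reach_same_edge e s t f t' l : reach D e t f t' l ->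
  reach D e s f t' (`|s - t| * edge_length e + l).
Proof.
move=> [[-> h]|[b [b' h]]]; [left; split=> //|right; exists b, b'].
  apply: le_trans (_ : (`|s - t| + `|t - t'|) * edge_length f <= _).
    by rewrite ler_wpM2r ?edge_length_ge0 // ler_distD.
  by rewrite mulrDl lerD2l.
apply: le_trans (_ : `|s - t| * edge_length e + (end_offset t b * edge_length e
   + D (edge_end e b) (edge_end f b') + end_offset t' b' * edge_length f) <= _).
  rewrite !addrA -mulrDl !lerD2r ler_wpM2r ?edge_length_ge0 //.
  exact: end_offset_le.
by rewrite lerD2l.
Qed.

Lemma table_edge e b b' : e \in edges N ->
  D (edge_end e b) (edge_end e b') <= end_offset b%:R b' * edge_length e.
Proof.
have [D0 _ De _] := table => ein; have [d1 d2] := De e ein.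
by case: b; case: b'; rewrite /= ?subrr ?subr0 ?D0 ?d1 ?d2 ?mul0r ?mul1r.
Qed.

(** By planarity a point on two different edges is an end of both. A route that first runs along f
    to an end then becomes a route between vertices, by the triangle inequality for D. *)
Lemma reach_switch e s f t g t' l : e \in edges N -> f \in edges N ->
  g \in edges N -> 0 <= s <= 1 -> 0 <= t <= 1 -> 0 <= t' <= 1 ->
  edge_point e s = edge_point f t -> reach D f t g t' l -> reach D e s g t' l.
Proof.
move=> ein fin gin hs ht ht' E; have [ef|ef] := eqVneq e f.
  by move: E; rewrite ef => /(edge_point_inj fin) ->.
have [b [b' [bE -> ->]]] := common_point ein fin ef hs ht E.
have [D0 Dt De _] := table.
case=> [[<- h]|[c [c' h]]]; right.
  exists b, b'; rewrite end_offset_end mul0r add0r bE D0 add0r.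
  apply: le_trans h; rewrite ler_wpM2r ?edge_length_ge0 //.
  have := end_offset_le t' b'%:R b'; by rewrite end_offset_end addr0 distrC.
exists b, c'; rewrite end_offset_end mul0r add0r bE.
apply: le_trans h; rewrite lerD2r; apply: le_trans (Dt _ (edge_end f c) _) _.
by rewrite lerD2r; apply: table_edge.
Qed.

Lemma reach_refl e s f t : e \in edges N -> f \in edges N ->
  0 <= s <= 1 -> 0 <= t <= 1 -> edge_point e s = edge_point f t ->
  reach D e s f t 0.
Proof.
move=> ein fin hs ht E; apply: reach_switch E _ => //.
by left; rewrite subrr normr0 mul0r.
Qed.

(** After refinement each step runs inside one edge g. Working backwards from the end of the path, a
    step is absorbed by moving along g and then switching from g to the edge on which the point was
    given. *)
Lemma joined_reach e t f t' l : e \in edges N -> f \in edges N ->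
  0 <= t <= 1 -> 0 <= t' <= 1 ->
  joined (edge_point e t) (edge_point f t') l -> reach D e t f t' l.
Proof.
move=> ein fin ht ht' [w [h1 h2 h3]]; apply: reach_le h3 _.
have [|w' [p1 p2 p3]] := @refine_path _ [seq (pos g.1, pos g.2) | g <- edges N] _ _ _ _ h1.
  move=> x /locus_edges[g gin hg]; exists (pos g.1, pos g.2) => //.
  by apply/mapP; exists g.
rewrite -p3; move: p2; rewrite h2; move: p1 {p3 h1 h2 l w}.
elim: w' e t ein ht => [|x w IH] e t ein ht /=.
  by move=> _; apply: reach_refl.
move=> [[_ /mapP[g gin ->]] /= [[s hs E] [s' hs' xE]] st] hl.
have r1 := IH g s' gin hs'; rewrite -/(edge_point g s') in r1.
move: st hl; rewrite {1}xE -/(edge_point g s') => st; rewrite xE => hl.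
apply: (@reach_switch _ _ g s) => //.
have -> : edist (edge_point e t) (seg_point (pos g.1) (pos g.2) s') =
    `|s - s'| * edge_length g by rewrite E edist_seg_point.
exact/reach_same_edge/r1.
Qed.

Lemma joined_edge e s t : e \in edges N -> 0 <= s <= 1 -> 0 <= t <= 1 ->
  joined (edge_point e s) (edge_point e t) (`|s - t| * edge_length e).
Proof.
move=> ein hs ht; exists [:: edge_point e t]; split=> //=.
  split=> //; apply: subset_trans (edge_sub_locus ein).
  by apply: segment_sub; [exists s|exists t].
by rewrite addr0 edist_seg_point.
Qed.

Lemma joined_end e t b : e \in edges N -> 0 <= t <= 1 ->
  joined (edge_point e t) (pos (edge_end e b)) (end_offset t b * edge_length e).
Proof.
move=> ein ht; rewrite -edge_point_end.
have hb : 0 <= (b%:R : R) <= 1 by case: b; rewrite /= ?lexx ?ler01.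
apply: joined_le (joined_edge ein ht hb); rewrite ler_wpM2r ?edge_length_ge0 //.
by case/andP: ht => t0 t1; case: b {hb} => /=; rewrite ?subr0 ler_norml; lra.
Qed.

Lemma reach_joined e t f t' l : e \in edges N -> f \in edges N ->
  0 <= t <= 1 -> 0 <= t' <= 1 -> reach D e t f t' l ->
  joined (edge_point e t) (edge_point f t') l.
Proof.
move=> ein fin ht ht' [[-> h]|[b [b' h]]].
  by apply: joined_le h _; apply: joined_edge.
apply: joined_le h _; have [_ _ _ Dj] := table.
apply: (joined_trans (x := pos (edge_end f b'))); last exact/joined_sym/joined_end.
apply: (joined_trans (x := pos (edge_end e b))) (Dj _ _).
exact: joined_end.
Qed.

Lemma reachP e t f t' l : e \in edges N -> f \in edges N ->
  0 <= t <= 1 -> 0 <= t' <= 1 ->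
  joined (edge_point e t) (edge_point f t') l <-> reach D e t f t' l.
Proof. by move=> *; split; [apply: joined_reach|apply: reach_joined]. Qed.

End Reach.
End NetworkDistance.

(** * Distances in a network with a shortcut *)

Section Shortcuts.
Context {R : realType}.
Variable N : network R.
Implicit Types (u v a b : R * R) (l : R).
Hypotheses (conn : connected_network N) (has_edge : edges N != [::]).

Local Notation njoined := (joined (locus N)).

Section Segment.
Variables p q : R * R.

Definition augmented : set (R * R) := locus N `|` segment p q.
Definition crossing : set (R * R) := locus N `&` segment p q.

(* A shortest path uses the segment from its first to its last point on it. *)
Lemma joined_augmented u v l : locus N v -> joined augmented u v l ->
  (locus N u -> njoined u v l \/ exists a b l1 l2, [/\ crossing a, crossing b,
     njoined u a l1, njoined b v l2 & l1 + edist a b + l2 <= l]) /\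
  (segment p q u -> exists b l2, [/\ crossing b, njoined b v l2 & edist u b + l2 <= l]).
Proof.
move=> lv [w [h1 h2 h3]].
pose Ss := (p, q) :: [seq (pos g.1, pos g.2) | g <- edges N].
have [|w' [p1 p2 p3]] := @refine_path _ Ss _ _ _ _ h1.
  move=> x [/(locus_edges conn has_edge)[g gin hg]|hx]; last first.
    by exists (p, q); rewrite ?mem_head.
  by exists (pos g.1, pos g.2) => //; rewrite inE; apply/orP; right; apply/mapP; exists g.
move: h3; rewrite -p3; move: p2; rewrite h2; move: p1 {p3 h1 h2 w}.
elim: w' u l => [|x w IH] u l /=.
  move=> _ uv l0; rewrite uv; split=> [_|suv]; first by left; apply: joined_refl.
  by exists v, 0; rewrite edistxx addr0; split=> //; apply: joined_refl.
move=> [[S SS [Su Sx]] st] hl hlen.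
have [|IHA IHB] := IH x (l - edist u x) st hl; first by rewrite lerBrDl.
move: SS; rewrite inE => /orP[/eqP SE|/mapP[g gin SE]]; rewrite SE /= in Su Sx.
  have [b [l2 [cb jb hb]]] := IHB Sx.
  have hub : edist u b + l2 <= l.
    have := edist_triangle x u b; lra.
  split=> [lu|_]; last by exists b, l2.
  (* The step runs along pq, so u itself is the first crossing. *)
  right; exists u, b, 0, l2; rewrite add0r; split=> //; first exact: joined_refl.
have lu : locus N u by apply: edge_sub_locus gin _ Su.
have lx : locus N x by apply: edge_sub_locus gin _ Sx.
have jux : njoined u x (edist u x).
  apply: joined_segment; apply: subset_trans (edge_sub_locus gin).
  exact: segment_sub Su Sx.
have A : njoined u v l \/ exists a b l1 l2, [/\ crossing a, crossing b,
     njoined u a l1, njoined b v l2 & l1 + edist a b + l2 <= l].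
  have [j|[a [b [l1 [l2 [ca cb ja jb hab]]]]]] := IHA lx.
    by left; have := joined_trans jux j; rewrite addrC subrK.
  right; exists a, b, (edist u x + l1), l2; split=> //; last by lra.
  exact: joined_trans jux ja.
split=> // su; case: A => [j|[a [b [l1 [l2 [ca cb ja jb hab]]]]]].
  by exists u, l; rewrite edistxx add0r.
(* Here u is on pq, and the straight piece from u to b is no longer than the route through a. *)
exists b, l2; split=> //; have := edist_joined ja; have := edist_triangle a u b.
lra.
Qed.

(** Suprema and infima are replaced by a number r: after insertion every pair is joined by a path
    shorter than r, while before it some pair has distance at least r' > r. Pairs with both points
    on pq are covered by the pair p, q. *)
Definition shortcut_condition : Prop :=
  [/\ locus N p, locus N q
    & exists r, [/\ exists u0 v0 r', [/\ locus N u0, locus N v0, r < r'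
           & forall l, njoined u0 v0 l -> r' <= l],
        forall u v, locus N u -> locus N v -> (exists2 l, l < r & njoined u v l) \/
          exists a b l1 l2, [/\ crossing a, crossing b, njoined u a l1,
             njoined b v l2 & l1 + edist a b + l2 < r]
        & forall u v, segment p q u -> locus N v ->
          exists b l2, [/\ crossing b, njoined b v l2 & edist u b + l2 < r]]].

Lemma joined_in_augmented u v l : njoined u v l -> joined augmented u v l.
Proof. by apply: joined_sub; apply: subsetUl. Qed.

Lemma joined_in_segment u v : segment p q u -> segment p q v ->
  joined augmented u v (edist u v).
Proof.
move=> su sv; apply: joined_segment; apply: subset_trans (segment_sub su sv) _.
exact: subsetUr.
Qed.

Lemma shortcutP : is_shortcut N p q <-> shortcut_condition.
Proof.
split=> [[lp lq hd]|[lp lq [r [[u0 [v0 [r' [lu0 lv0 rr' hr']]]] hA hB]]]]; split=> //.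
  have [_ [u0 [v0 [lu0 lv0 ->]]] hlt] := ereal_sup_gt hd.
  have d0 : (0 <= diam augmented)%E.
    apply: le_ereal_sup_tmp; exists (dist_within augmented p p).
      by exists p, p; split=> //; left.
    exact: dist_within_ge0.
  have hle u v : augmented u -> augmented v ->
      (dist_within augmented u v <= diam augmented)%E.
    by move=> hu hv; apply: ereal_sup_ubound; exists u, v.
  (* Both numbers are chosen between the augmented diameter and the distance of u0 and v0, which at
     this point may still be infinite. *)
  have [r [r' [hr rr' hr']]] : exists r r' : R, [/\ (diam augmented < r%:E)%E, r < r'
      & (r'%:E <= dist_within (locus N) u0 v0)%E].
    rewrite -/augmented in hlt.
    case: (diam augmented) d0 hlt => [d| |] //=; last by move=> _; rewrite ltNge leey.
    move=> d0; case: (dist_within _ u0 v0) => [d'| |] //=.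
      rewrite lte_fin => dd'; exists ((d + d') / 2), d'.
      by rewrite lte_fin lexx; split=> //; lra.
    move=> _; exists (d + 1), (d + 2); rewrite lte_fin leey.
    by split=> //; lra.
  have hj u v : augmented u -> augmented v ->
      exists2 l, l < r & joined augmented u v l.
    by move=> hu hv; apply/dist_within_lt/(le_lt_trans (hle u v hu hv)).
  exists r; split.
  - exists u0, v0, r'; split=> // l /dist_within_joined jl.
    by rewrite -lee_fin; apply: le_trans hr' jl.
  - move=> u v lu lv; have [l lr jl] := hj u v (or_introl lu) (or_introl lv).
    have [+ _] := joined_augmented lv jl.
    move=> /(_ lu)[j|[a [b [l1 [l2 [ca cb ja jb hab]]]]]]; first by left; exists l.
    by right; exists a, b, l1, l2; split=> //; apply: le_lt_trans lr.
  - move=> u v su lv; have [l lr jl] := hj u v (or_intror su) (or_introl lv).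
    have [_ /(_ su)[b [l2 [cb jb hb]]]] := joined_augmented lv jl.
    by exists b, l2; split=> //; apply: le_lt_trans lr.
have jB u v : segment p q u -> locus N v ->
    exists2 l, l < r & joined augmented u v l.
  move=> su lv; have [b [l2 [[lb sb] jb hb]]] := hB u v su lv.
  exists (edist u b + l2) => //.
  exact: joined_trans (joined_in_segment su sb) (joined_in_augmented jb).
have jA u v : locus N u -> locus N v ->
    exists2 l, l < r & joined augmented u v l.
  move=> lu lv; have [[l lr j]|] := hA u v lu lv.
    by exists l => //; apply: joined_in_augmented.
  move=> [a [b [l1 [l2 [[la sa] [lb sb] ja jb hab]]]]].
  exists (l1 + edist a b + l2) => //; apply: joined_trans (joined_in_augmented jb).
  exact: joined_trans (joined_in_augmented ja) (joined_in_segment sa sb).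
have hj u v : augmented u -> augmented v ->
    exists2 l, l < r & joined augmented u v l.
  move=> [lu|su] [lv|sv]; [exact: jA|..|].
  - by have [l lr j] := jB v u sv lu; exists l => //; apply: joined_sym.
  - exact: jB.
  (* Both points are on pq, so their distance is at most that of p and q, hence at most the length
     of a path joining p and q, and one of these is shorter than r. *)
  - exists (edist u v); last exact: joined_in_segment.
    have [l lr j] := jA p q lp lq; apply: le_lt_trans lr.
    apply: le_trans (edist_joined j).
    case: su sv => [s /andP[s0 s1] ->] [t /andP[t0 t1] ->].
    rewrite -!/(seg_point p q _) edist_seg_point.
    by rewrite ler_piMl ?edist_ge0 // ler_norml; lra.
apply: (@le_lt_trans _ _ r%:E).
  apply: ge_ereal_sup => _ [u [v [hu hv ->]]].
  have [l lr /dist_within_joined j] := hj u v hu hv.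
  by apply: le_trans j _; rewrite lee_fin ltW.
apply: (@lt_le_trans _ _ r'%:E); first by rewrite lte_fin.
apply: (@le_trans _ _ (dist_within (locus N) u0 v0)).
  apply: le_ereal_inf_tmp => _ [w [h1 h2] <-]; rewrite lee_fin.
  by apply: hr'; exists w.
by apply: ereal_sup_ubound; exists u0, v0.
Qed.

End Segment.
End Shortcuts.

(** * Shortcuts as a first-order formula *)

Definition TOpp t := TMul (TConst (-1)) t.
Definition TSub t u := TAdd t (TOpp u).
Definition TOne := TConst 1.
Definition TZero := TConst 0.

Definition FAllR r f := FNot (FExR r (FNot f)).
Definition FLtR t u := FPos (TSub u t).
Definition FLeR t u := FNot (FLtR u t).
Definition FEqR t u := FAnd (FLeR t u) (FLeR u t).
Definition FEqI a b := FAnd (FLe a b) (FLe b a).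
Definition FUnit t := FAnd (FLeR TZero t) (FLeR t TOne).
Definition FImp f g := FNot (FAnd f (FNot g)).

Definition i_nvert := IArr (IConst 0).
Definition i_nedge := IArr (IConst 1).
Definition i_end c (b : bool) := IArr (IAdd (IConst (2 + b)) (IAdd (IVar c) (IVar c))).
Definition t_pos (b : bool) v := TArr (IAdd (IConst b) (IAdd v v)).
(** Row-major access to the distance table needs multiples of the number of vertices, and index
    terms have no product; these multiples are stored in the integer array after the two counts and
    the ends of the edges. *)
Definition i_row v := IAdd (IAdd i_nedge i_nedge) (IAdd (IConst 2) v).
Definition i_dist v w := IAdd (IAdd i_nvert i_nvert) (IAdd (IArr (i_row v)) w).
Definition t_dist v w := TArr (i_dist v w).
Definition t_length c := t_dist (i_end c false) (i_end c true).
Definition t_offset t (b : bool) := if b then TSub TOne t else t.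
Definition t_mix t u v := TAdd (TMul (TSub TOne t) u) (TMul t v).
Definition t_point c t (b : bool) :=
  t_mix t (t_pos b (i_end c false)) (t_pos b (i_end c true)).

Definition FReachVia c t c' t' l (b b' : bool) :=
  FLeR (TAdd (TAdd (TMul (t_offset t b) (t_length c))
                   (t_dist (i_end c b) (i_end c' b')))
             (TMul (t_offset t' b') (t_length c'))) l.

(** The two inequalities of the first case bound the absolute value in [reach]; the four remaining
    cases are the choices of ends. *)
Definition FReach c t c' t' l :=
  FOr (FAnd (FEqI (IVar c) (IVar c'))
        (FAnd (FLeR (TMul (TSub t t') (t_length c)) l)
              (FLeR (TMul (TSub t' t) (t_length c)) l)))
  (FOr (FOr (FReachVia c t c' t' l false false) (FReachVia c t c' t' l false true))
       (FOr (FReachVia c t c' t' l true false) (FReachVia c t c' t' l true true))).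

(* Points of the network: variable c is the index of an edge, variable r the
   position on that edge. *)
Definition FExP c r f := FExI c (FExR r (FAnd (FUnit (TVar r)) f)).
Definition FAllP c r f := FNot (FExP c r (FNot f)).

(* Real variables 0, ..., 3 are the coordinates of the ends p, q of the segment. *)
Definition t_seg t (b : bool) := t_mix t (TVar b) (TVar (2 + b)).
Definition FIsP c t (b1 b2 : rterm) :=
  FAnd (FEqR b1 (t_point c t false)) (FEqR b2 (t_point c t true)).
Definition FCross c t s :=
  FAnd (FUnit s) (FIsP c t (t_seg s false) (t_seg s true)).
(** An upper bound on a distance, polynomial after squaring since z is nonnegative. This is enough
    because z is quantified existentially and occurs only in an upper bound. *)
Definition FDist (x1 x2 y1 y2 z : rterm) :=
  FAnd (FLeR TZero z)
    (FLeR (TAdd (TMul (TSub x1 y1) (TSub x1 y1)) (TMul (TSub x2 y2) (TSub x2 y2)))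
          (TMul z z)).

Definition FShorter c t c' t' (r l : nat) :=
  FExR l (FAnd (FLtR (TVar l) (TVar r)) (FReach c t c' t' (TVar l))).

(** Index variables 0, 1 are the edges of u, v; real variables 5, 6 are the positions on them and 4
    is r. The crossings a, b have edges 2, 3, positions 7, 9 on these edges and 8, 10 on pq.
    Variables 11, 12 bound the two paths in the network, 13 the piece of pq. *)
Definition FDetour :=
  FExP 2 7 (FExR 8 (FExP 3 9 (FExR 10 (FExR 11 (FExR 12 (FExR 13
    (FAnd (FCross 2 (TVar 7) (TVar 8)) (FAnd (FCross 3 (TVar 9) (TVar 10))
    (FAnd (FReach 0 (TVar 5) 2 (TVar 7) (TVar 11))
    (FAnd (FReach 3 (TVar 9) 1 (TVar 6) (TVar 12))
    (FAnd (FDist (t_point 2 (TVar 7) false) (t_point 2 (TVar 7) true)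
       (t_point 3 (TVar 9) false) (t_point 3 (TVar 9) true) (TVar 13))
    (FLtR (TAdd (TAdd (TVar 11) (TVar 13)) (TVar 12)) (TVar 4))))))))))))).

(** Here real variable 5 is the position of u on pq; the other registers are as in [FDetour]. *)
Definition FExit :=
  FExP 3 9 (FExR 10 (FExR 12 (FExR 13
    (FAnd (FCross 3 (TVar 9) (TVar 10))
    (FAnd (FReach 3 (TVar 9) 1 (TVar 6) (TVar 12))
    (FAnd (FDist (t_seg (TVar 5) false) (t_seg (TVar 5) true)
       (t_point 3 (TVar 9) false) (t_point 3 (TVar 9) true) (TVar 13))
    (FLtR (TAdd (TVar 13) (TVar 12)) (TVar 4)))))))).

Definition FShortcut :=
  FAnd (FExP 0 4 (FIsP 0 (TVar 4) (TVar 0) (TVar 1)))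
  (FAnd (FExP 0 4 (FIsP 0 (TVar 4) (TVar 2) (TVar 3)))
  (FExR 4
    (FAnd (FExP 0 5 (FExP 1 6 (FExR 7 (FAnd (FLtR (TVar 4) (TVar 7))
             (FNot (FShorter 0 (TVar 5) 1 (TVar 6) 7 8))))))
    (FAnd (FAllP 0 5 (FAllP 1 6
             (FOr (FShorter 0 (TVar 5) 1 (TVar 6) 4 7) FDetour)))
    (FAllR 5 (FImp (FUnit (TVar 5)) (FAllP 1 6 FExit))))))).

(** * Meaning of the formula in the structure of a network *)

Section Correctness.
Context {R : realType}.
Variables (N : network R) (D : 'I_(nvert N) -> 'I_(nvert N) -> R)
  (A : structure R).
Hypotheses (plane : plane_network N) (conn : connected_network N)
  (has_edge : edges N != [::]) (table : distance_table D).

Definition network_structure : Prop :=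
  [/\ [/\ ibound A = size (edges N), iarr A 0 = nvert N & iarr A 1 = size (edges N)],
   forall e, e \in edges N -> forall b : bool,
      iarr A (2 + b + (index e (edges N) + index e (edges N))) = edge_end e b,
   forall i : 'I_(nvert N),
      iarr A (size (edges N) + size (edges N) + (2 + i)) = (i * nvert N)%N,
   forall (i : 'I_(nvert N)) (b : bool),
      rarr A (b + (i + i)) = (if b then (pos i).2 else (pos i).1)
  & forall i j : 'I_(nvert N), rarr A (nvert N + nvert N + (i * nvert N + j)) = D i j].

Hypothesis struct : network_structure.

Implicit Types (si : nat -> nat) (ro : nat -> R) (e : 'I_(nvert N) * 'I_(nvert N)) (f g : form) (b : bool).

Lemma holds_exR si ro r f :
  holds A si ro (FExR r f) <-> exists x, holds A si (upd ro r x) f.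
Proof. by []. Qed.

Lemma holds_and si ro f g :
  holds A si ro (FAnd f g) <-> holds A si ro f /\ holds A si ro g.
Proof. by []. Qed.

Lemma tval_sub si ro t u :
  tval A si ro (TSub t u) = tval A si ro t - tval A si ro u.
Proof. by rewrite /= rmorphN1 mulN1r. Qed.

Lemma tval_one si ro : tval A si ro TOne = 1.
Proof. exact: rmorph1. Qed.

Lemma tval_zero si ro : tval A si ro TZero = 0.
Proof. exact: rmorph0. Qed.

Lemma holds_lt si ro t u :
  holds A si ro (FLtR t u) <-> tval A si ro t < tval A si ro u.
Proof. by rewrite -[holds _ _ _ _]/(is_true (0 < tval A si ro (TSub u t))) tval_sub subr_gt0. Qed.

Lemma holds_le si ro t u :
  holds A si ro (FLeR t u) <-> tval A si ro t <= tval A si ro u.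
Proof.
rewrite -[holds A si ro (FLeR t u)]/(~ holds A si ro (FLtR u t)) holds_lt leNgt.
by split=> /negP.
Qed.

Lemma holds_eq si ro t u :
  holds A si ro (FEqR t u) <-> tval A si ro t = tval A si ro u.
Proof.
rewrite holds_and !holds_le; split=> [[h1 h2]|->] //.
by apply/eqP; rewrite eq_le h1 h2.
Qed.

Lemma holds_unit si ro t : holds A si ro (FUnit t) <-> 0 <= tval A si ro t <= 1.
Proof.
by rewrite holds_and !holds_le tval_zero tval_one; split=> /andP.
Qed.

Lemma holds_exP si ro c r f : holds A si ro (FExP c r f) <->
  exists e t, [/\ e \in edges N, 0 <= t <= 1
    & holds A (upd si c (index e (edges N))) (upd ro r t) f].
Proof.
have [[bE _ _] _ _ _ _] := struct; split.
  move=> [i ib [t [/holds_unit ht hf]]]; rewrite bE in ib.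
  case E: (edges N) (has_edge) ib => [//|e0 es] _; rewrite -E => ib.
  exists (nth e0 (edges N) i), t; rewrite mem_nth // index_uniq //; last by case: plane.
  by split=> //; move: ht; rewrite /= upd_eq.
move=> [e [t [ein ht hf]]]; exists (index e (edges N)); first by rewrite bE index_mem.
by exists t; split=> //; apply/holds_unit; rewrite /= upd_eq.
Qed.

Lemma holds_allP si ro c r f : holds A si ro (FAllP c r f) <->
  forall e t, e \in edges N -> 0 <= t <= 1 ->
    holds A (upd si c (index e (edges N))) (upd ro r t) f.
Proof.
rewrite -[holds _ _ _ _]/(~ holds A si ro (FExP c r (FNot f))) holds_exP; split.
  move=> h e t ein ht; apply: contrapT => nf; apply: h; exists e, t.
  by split.
by move=> h [e [t [ein ht /= nf]]]; apply/nf/h.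
Qed.

Lemma holds_allR si ro r f : holds A si ro (FAllR r f) <->
  forall t, holds A si (upd ro r t) f.
Proof.
split=> [h t|h [t nf]]; last exact/nf/h.
by apply: contrapT => nf; apply: h; exists t.
Qed.

Lemma holds_imp si ro f g : holds A si ro (FImp f g) <->
  (holds A si ro f -> holds A si ro g).
Proof.
split=> [h hf|h [hf ng]]; last exact/ng/h.
by apply: contrapT => ng; apply: h; split.
Qed.

Definition at_edge si c e : Prop := e \in edges N /\ si c = index e (edges N).

Lemma ival_end si c e b : at_edge si c e -> ival A si (i_end c b) = edge_end e b.
Proof. by move=> [ein /= ->]; have [_ h _ _ _] := struct; rewrite h. Qed.

Lemma tval_pos si ro b v (i : 'I_(nvert N)) : ival A si v = i ->
  tval A si ro (t_pos b v) = if b then (pos i).2 else (pos i).1.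
Proof. by move=> /= ->; have [_ _ _ h _] := struct; rewrite h. Qed.

Lemma tval_dist si ro v w (i j : 'I_(nvert N)) : ival A si v = i ->
  ival A si w = j -> tval A si ro (t_dist v w) = D i j.
Proof.
move=> /= -> ->; have [[_ nE mE] _ rE _ DE] := struct.
by rewrite nE mE rE DE.
Qed.

Lemma tval_length si ro c e : at_edge si c e ->
  tval A si ro (t_length c) = edge_length e.
Proof.
move=> h; rewrite (tval_dist ro (ival_end false h) (ival_end true h)).
by have [_ _ De _] := table; have [-> _] := De e h.1.
Qed.

Lemma tval_offset si ro t b :
  tval A si ro (t_offset t b) = end_offset (tval A si ro t) b.
Proof. by case: b => //; rewrite tval_sub tval_one. Qed.

Lemma tval_mix si ro t u v : tval A si ro (t_mix t u v) =
  (1 - tval A si ro t) * tval A si ro u + tval A si ro t * tval A si ro v.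
Proof. by rewrite /= rmorphN1 rmorph1 mulN1r. Qed.

Lemma tval_point si ro c e t b : at_edge si c e ->
  tval A si ro (t_point c t b) =
  if b then (edge_point e (tval A si ro t)).2 else (edge_point e (tval A si ro t)).1.
Proof.
move=> h; rewrite tval_mix (tval_pos ro b (ival_end false h)).
by rewrite (tval_pos ro b (ival_end true h)); case: b.
Qed.

Lemma holds_reach si ro c e t c' e' t' l : at_edge si c e -> at_edge si c' e' ->
  holds A si ro (FReach c t c' t' l) <->
  reach D e (tval A si ro t) e' (tval A si ro t') (tval A si ro l).
Proof.
move=> h h'.
have via b b' : holds A si ro (FReachVia c t c' t' l b b') <->
    end_offset (tval A si ro t) b * edge_length e + D (edge_end e b) (edge_end e' b')
    + end_offset (tval A si ro t') b' * edge_length e' <= tval A si ro l.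
  rewrite holds_le -[tval A si ro (TAdd _ _)]/(
    tval A si ro (t_offset t b) * tval A si ro (t_length c) +
    tval A si ro (t_dist (i_end c b) (i_end c' b')) +
    tval A si ro (t_offset t' b') * tval A si ro (t_length c')).
  rewrite !tval_offset (tval_length ro h) (tval_length ro h').
  by rewrite (tval_dist ro (ival_end b h) (ival_end b' h')).
have same : holds A si ro (FAnd (FEqI (IVar c) (IVar c'))
        (FAnd (FLeR (TMul (TSub t t') (t_length c)) l)
              (FLeR (TMul (TSub t' t) (t_length c)) l))) <->
    e = e' /\ `|tval A si ro t - tval A si ro t'| * edge_length e <= tval A si ro l.
  have le1 u u' : holds A si ro (FLeR (TMul (TSub u u') (t_length c)) l) <->
      (tval A si ro u - tval A si ro u') * edge_length e <= tval A si ro l.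
    by rewrite holds_le -[tval A si ro (TMul _ _)]/(tval A si ro (TSub u u') *
      tval A si ro (t_length c)) tval_sub (tval_length ro h).
  have eqI : holds A si ro (FEqI (IVar c) (IVar c')) <-> e = e'.
    rewrite /= h.2 h'.2; split=> [[h1 h2]|->//].
    have : index e (edges N) = index e' (edges N) by apply/eqP; rewrite eqn_leq h1 h2.
    by move/(congr1 (nth e (edges N))); rewrite !nth_index ?h.1 ?h'.1.
  rewrite holds_and eqI holds_and !le1.
  set a := tval _ _ _ t; set a' := tval _ _ _ t'.
  split=> [[-> [h1 h2]]|[-> hn]]; split=> //.
    by case: (lerP a' a).
  by split; apply: le_trans hn; (apply: ler_wpM2r; first exact: edge_length_ge0);
    [exact: ler_norm|rewrite distrC; exact: ler_norm].
rewrite /FReach !holds_or same !via /reach; split.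
  move=> [g|[[g|g]|[g|g]]]; first by left.
  - by right; exists false, false.
  - by right; exists false, true.
  - by right; exists true, false.
  - by right; exists true, true.
by move=> [g|[[] [[] g]]]; tauto.
Qed.

Lemma holds_isP si ro c e t t1 t2 : at_edge si c e ->
  holds A si ro (FIsP c t t1 t2) <->
  (tval A si ro t1, tval A si ro t2) = edge_point e (tval A si ro t).
Proof.
move=> h; rewrite holds_and !holds_eq !(tval_point _ _ _ h) /=.
by split=> [[-> ->]|[-> ->]].
Qed.

Lemma holds_dist si ro x1 x2 y1 y2 z : holds A si ro (FDist x1 x2 y1 y2 z) <->
  edist (tval A si ro x1, tval A si ro x2) (tval A si ro y1, tval A si ro y2)
    <= tval A si ro z.
Proof.
rewrite holds_and !holds_le tval_zero.
rewrite -[tval A si ro (TAdd _ _)]/(tval A si ro (TSub x1 y1) * tval A si ro (TSub x1 y1) +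
  tval A si ro (TSub x2 y2) * tval A si ro (TSub x2 y2)) !tval_sub.
rewrite -[tval A si ro (TMul z z)]/(tval A si ro z * tval A si ro z) /edist -!expr2.
rewrite [(_, _).1]/= [(_, _).2]/= .
set S := _ + _; have S0 : 0 <= S by rewrite addr_ge0 ?sqr_ge0.
split=> [[z0 h]|h].
  by rewrite -[leRHS]ger0_norm // -sqrtr_sqr ler_sqrt ?sqr_ge0.
have z0 := le_trans (sqrtr_ge0 _) h; split=> //.
by rewrite -(sqr_sqrtr S0) ler_sqr ?nnegrE ?sqrtr_ge0.
Qed.

(** The last two hypotheses express that the bound variable l does not occur in the terms t and
    t'. *)
Lemma holds_shorter si ro c e t c' e' t' r l : at_edge si c e -> at_edge si c' e' ->
  0 <= tval A si ro t <= 1 -> 0 <= tval A si ro t' <= 1 -> r != l ->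
  (forall x, tval A si (upd ro l x) t = tval A si ro t) ->
  (forall x, tval A si (upd ro l x) t' = tval A si ro t') ->
  holds A si ro (FShorter c t c' t' r l) <->
  exists2 x, x < ro r & joined (locus N) (edge_point e (tval A si ro t))
    (edge_point e' (tval A si ro t')) x.
Proof.
move=> h h' ht ht' rl tE tE'.
have ein := h.1; have ein' := h'.1.
split=> [/holds_exR[x /holds_and[/holds_lt lx /(holds_reach _ _ _ _ h h')]]|[x lx j]].
  rewrite tE tE' => hr; exists x; first by move: lx; rewrite /= upd_eq upd_neq.
  by apply/(reachP plane conn has_edge table) => //; move: hr; rewrite /= upd_eq.
exists x; split; first by apply/holds_lt; rewrite /= upd_eq upd_neq.
apply/(holds_reach _ _ _ _ h h'); rewrite tE tE' /= upd_eq.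
by apply/(reachP plane conn has_edge table).
Qed.

Definition seg_start ro : R * R := (ro 0%N, ro 1%N).
Definition seg_stop ro : R * R := (ro 2%N, ro 3%N).

Lemma tval_seg si ro t b : tval A si ro (t_seg t b) =
  if b then (seg_point (seg_start ro) (seg_stop ro) (tval A si ro t)).2
  else (seg_point (seg_start ro) (seg_stop ro) (tval A si ro t)).1.
Proof. by rewrite tval_mix; case: b. Qed.

Lemma holds_cross si ro c e t s : at_edge si c e ->
  holds A si ro (FCross c t s) <-> 0 <= tval A si ro s <= 1 /\
  seg_point (seg_start ro) (seg_stop ro) (tval A si ro s) =
    edge_point e (tval A si ro t).
Proof.
by move=> h; rewrite holds_and holds_unit (holds_isP _ _ _ _ h) !tval_seg.
Qed.

Lemma crossing_edge_point p q x : crossing N p q x ->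
  exists e t s, [/\ e \in edges N, 0 <= t <= 1, 0 <= s <= 1, x = edge_point e t
    & seg_point p q s = edge_point e t].
Proof.
move=> [/(locus_edge_point conn has_edge)[e [t [ein ht ->]]] [s hs E]].
by exists e, t, s.
Qed.

Lemma edge_point_crossing p q e t s : e \in edges N -> 0 <= t <= 1 ->
  0 <= s <= 1 -> seg_point p q s = edge_point e t -> crossing N p q (edge_point e t).
Proof.
move=> ein ht hs E; split; last by exists s.
by apply/(locus_edge_point conn has_edge); exists e, t.
Qed.

Lemma holds_detour si ro e e' : at_edge si 0 e -> at_edge si 1 e' ->
  0 <= ro 5%N <= 1 -> 0 <= ro 6%N <= 1 ->
  holds A si ro FDetour <->
  exists (a b : R * R) l1 l2, [/\ crossing N (seg_start ro) (seg_stop ro) a,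
    crossing N (seg_start ro) (seg_stop ro) b,
    joined (locus N) (edge_point e (ro 5%N)) a l1,
    joined (locus N) b (edge_point e' (ro 6%N)) l2 & l1 + edist a b + l2 < ro 4%N].
Proof.
move=> h h' ht ht'; have ein := h.1; have ein' := h'.1.
have hP := reachP plane conn has_edge table.
split.
  move=> /holds_exP[f [t [fin htf /holds_exR[s /holds_exP[g [u [gin hu]]]]]]].
  move=> /holds_exR[v /holds_exR[l1 /holds_exR[l2 /holds_exR[z]]]].
  set si' := upd _ 3%N _; set ro' := upd _ 13%N _.
  (* All names are numerals, so looking up a variable in the updated valuation is a computation. *)
  have h0 : at_edge si' 0 e by [].
  have h1 : at_edge si' 1 e' by [].
  have h2 : at_edge si' 2 f by [].
  have h3 : at_edge si' 3 g by [].
  move=> /holds_and[/(holds_cross _ _ _ h2)[hs E2]].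
  move=> /holds_and[/(holds_cross _ _ _ h3)[hv E3]].
  move=> /holds_and[/(holds_reach _ _ _ _ h0 h2) r1].
  move=> /holds_and[/(holds_reach _ _ _ _ h3 h1) r2].
  move=> /holds_and[/holds_dist hz /holds_lt hl].
  exists (edge_point f t), (edge_point g u), l1, l2; split.
  - exact: edge_point_crossing E2.
  - exact: edge_point_crossing E3.
  - exact/hP.
  - exact/hP.
  - apply: le_lt_trans hl; rewrite /= lerD2r lerD2l.
    by move: hz; rewrite !(tval_point _ _ _ h2) !(tval_point _ _ _ h3).
move=> [a [b [l1 [l2 [ca cb ja jb hl]]]]].
have [f [t [s [fin htf hs aE E2]]]] := crossing_edge_point ca.
have [g [u [v [gin hu hv bE E3]]]] := crossing_edge_point cb.
apply/holds_exP; exists f, t; split=> //; apply/holds_exR; exists s.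
apply/holds_exP; exists g, u; split=> //.
apply/holds_exR; exists v; apply/holds_exR; exists l1; apply/holds_exR; exists l2.
apply/holds_exR; exists (edist a b).
set si' := upd _ 3%N _; set ro' := upd _ 13%N _.
have h0 : at_edge si' 0 e by [].
have h1 : at_edge si' 1 e' by [].
have h2 : at_edge si' 2 f by [].
have h3 : at_edge si' 3 g by [].
split; first by apply/(holds_cross _ _ _ h2).
split; first by apply/(holds_cross _ _ _ h3).
split; first by apply/(holds_reach _ _ _ _ h0 h2)/hP => //; rewrite -aE.
split; first by apply/(holds_reach _ _ _ _ h3 h1)/hP => //; rewrite -bE.
split; last exact/holds_lt.
apply/holds_dist; have -> : tval A si' ro' (TVar 13) = edist a b by [].
by rewrite !(tval_point _ _ _ h2) !(tval_point _ _ _ h3) aE bE.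
Qed.

Lemma holds_exit si ro e' : at_edge si 1 e' -> 0 <= ro 6%N <= 1 ->
  holds A si ro FExit <->
  exists (b : R * R) l2, [/\ crossing N (seg_start ro) (seg_stop ro) b,
    joined (locus N) b (edge_point e' (ro 6%N)) l2
    & edist (seg_point (seg_start ro) (seg_stop ro) (ro 5%N)) b + l2 < ro 4%N].
Proof.
move=> h' ht'; have ein' := h'.1.
have hP := reachP plane conn has_edge table.
split.
  move=> /holds_exP[g [u [gin hu /holds_exR[v /holds_exR[l2 /holds_exR[z]]]]]].
  set si' := upd _ 3%N _; set ro' := upd _ 13%N _.
  have h1 : at_edge si' 1 e' by [].
  have h3 : at_edge si' 3 g by [].
  move=> /holds_and[/(holds_cross _ _ _ h3)[hv E3]].
  move=> /holds_and[/(holds_reach _ _ _ _ h3 h1) r2].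
  move=> /holds_and[/holds_dist hz /holds_lt hl].
  exists (edge_point g u), l2; split.
  - exact: edge_point_crossing E3.
  - exact/hP.
  - apply: le_lt_trans hl; rewrite /= lerD2r.
    by move: hz; rewrite !tval_seg !(tval_point _ _ _ h3).
move=> [b [l2 [cb jb hl]]].
have [g [u [v [gin hu hv bE E3]]]] := crossing_edge_point cb.
apply/holds_exP; exists g, u; split=> //.
apply/holds_exR; exists v; apply/holds_exR; exists l2; apply/holds_exR.
exists (edist (seg_point (seg_start ro) (seg_stop ro) (ro 5%N)) b).
set si' := upd _ 3%N _; set ro' := upd _ 13%N _.
have h1 : at_edge si' 1 e' by [].
have h3 : at_edge si' 3 g by [].
split; first by apply/(holds_cross _ _ _ h3).
split; first by apply/(holds_reach _ _ _ _ h3 h1)/hP => //; rewrite -bE.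
split; last exact/holds_lt.
apply/holds_dist.
have -> : tval A si' ro' (TVar 13) =
  edist (seg_point (seg_start ro) (seg_stop ro) (ro 5%N)) b by [].
by rewrite !tval_seg !(tval_point _ _ _ h3) bE.
Qed.

Lemma holds_shortcut si ro : holds A si ro FShortcut <->
  shortcut_condition N (seg_start ro) (seg_stop ro).
Proof.
have lP := locus_edge_point conn has_edge.
have onP k x y : holds A si ro (FExP 0 4 (FIsP 0 (TVar 4) (TVar x) (TVar y))) ->
   x != 4%N -> y != 4%N -> k = (ro x, ro y) -> locus N k.
  move=> /holds_exP[e [t [ein ht]]].
  set si' := upd _ _ _ => hf x4 y4 ->; have h : at_edge si' 0 e by [].
  move: hf => /(holds_isP _ _ _ _ h) /=; rewrite upd_eq !upd_neq // => ->.
  by apply/lP; exists e, t.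
have onP' x y : locus N (ro x, ro y) -> x != 4%N -> y != 4%N ->
    holds A si ro (FExP 0 4 (FIsP 0 (TVar 4) (TVar x) (TVar y))).
  move=> /lP[e [t [ein ht E]]] x4 y4; apply/holds_exP; exists e, t; split=> //.
  set si' := upd _ _ _; have h : at_edge si' 0 e by [].
  by apply/(holds_isP _ _ _ _ h) => /=; rewrite upd_eq !upd_neq.
split.
  move=> /holds_and[/onP hp /holds_and[/onP hq /holds_exR[r]]].
  move=> /holds_and[h1 /holds_and[h2 h3]]; split.
  - exact: hp.
  - exact: hq.
  exists r; split.
  - move: h1 => /holds_exP[e [t [ein ht /holds_exP[e' [t' [ein' ht' /holds_exR[r']]]]]]].
    set si' := upd _ 1%N _; set ro' := upd _ 7%N _ => /holds_and[/holds_lt rr' hn].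
    have g0 : at_edge si' 0 e by [].
    have g1 : at_edge si' 1 e' by [].
    exists (edge_point e t), (edge_point e' t'), r'; split=> //.
    + by apply/lP; exists e, t.
    + by apply/lP; exists e', t'.
    + move=> l jl; rewrite leNgt; apply/negP => lr'; apply: hn.
      apply/(holds_shorter g0 g1) => //; by exists l.
  - move=> _ _ /lP[e [t [ein ht ->]]] /lP[e' [t' [ein' ht' ->]]].
    move: h2 => /holds_allP /(_ e t ein ht) /holds_allP /(_ e' t' ein' ht').
    set si' := upd _ 1%N _; set ro' := upd _ 6%N _ => /holds_or.
    have g0 : at_edge si' 0 e by [].
    have g1 : at_edge si' 1 e' by [].
    move=> [/(holds_shorter g0 g1)[]//x lx jx|/(holds_detour g0 g1)]; last first.
      by move=> /(_ ht ht'); right.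
    by left; exists x.
  - move=> _ _ [s hs ->] /lP[e' [t' [ein' ht' ->]]].
    move: h3 => /holds_allR /(_ s) /holds_imp h3.
    have /holds_allP /(_ e' t' ein' ht') : holds A si (upd (upd ro 4%N r) 5%N s) (FAllP 1 6 FExit).
      by apply: h3; apply/holds_unit.
    set si' := upd _ 1%N _; set ro' := upd _ 6%N _.
    have g1 : at_edge si' 1 e' by [].
    by move=> /(holds_exit (ro := ro') g1 ht').
move=> [lp lq [r [[u0 [v0 [r' [lu0 lv0 rr' hr']]]] hA hB]]].
split; first exact: onP'.
split; first exact: onP'.
exists r; split.
  move: lu0 lv0 hr' => /lP[e [t [ein ht ->]]] /lP[e' [t' [ein' ht' ->]]] hr'.
  apply/holds_exP; exists e, t; split=> //.
  apply/holds_exP; exists e', t'; split=> //; exists r'.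
  set si' := upd _ 1%N _; set ro' := upd _ 7%N _.
  have g0 : at_edge si' 0 e by [].
  have g1 : at_edge si' 1 e' by [].
  split; first exact/holds_lt.
  move=> /(holds_shorter g0 g1)[]//x lx /hr'; rewrite leNgt.
  by move=> /negP; apply.
split.
  apply/holds_allP => e t ein ht; apply/holds_allP => e' t' ein' ht'.
  set si' := upd _ 1%N _; set ro' := upd _ 6%N _; apply/holds_or.
  have g0 : at_edge si' 0 e by [].
  have g1 : at_edge si' 1 e' by [].
  have [||[x xr jx]|] := hA (edge_point e t) (edge_point e' t').
  - by apply/lP; exists e, t.
  - by apply/lP; exists e', t'.
  - by left; apply/(holds_shorter g0 g1) => //; exists x.
  - by right; apply/(holds_detour g0 g1).
apply/holds_allR => s; apply/holds_imp => /holds_unit hs.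
apply/holds_allP => e' t' ein' ht'.
set si' := upd _ 1%N _; set ro' := upd _ 6%N _.
have g1 : at_edge si' 1 e' by [].
apply/(holds_exit g1) => //; apply: hB; first by exists s.
by apply/lP; exists e', t'.
Qed.

End Correctness.

(** * Table of distances *)

Section ForTable.
Context {R : realType}.
Implicit Types (s : state R) (an si : nat -> nat).

(** For loops that fill real tables: arrays of integers and the other index variables are preserved,
    so the invariant P concerns the real memory only. *)
Lemma runs_for_table an si (c : nat) bnd body b z T
    (P : nat -> (nat -> R) -> Prop) s :
  (b <= z)%N -> (forall s', narr s' = an -> neval s' bnd = b) -> si c = 0%N ->
  (forall i s', (i < b)%N -> narr s' = an -> nvar s' = upd si c i ->
     P i (rmem s') -> runs body s' T (fun s'' =>
       [/\ narr s'' = an, nvar s'' = upd si c i & P i.+1 (rmem s'')])) ->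
  narr s = an -> nvar s = si -> P 0%N (rmem s) ->
  runs (For c bnd body) s (z * (T + 2) + 3) (fun s' =>
    [/\ narr s' = an, nvar s' = si & P b (rmem s')]).
Proof.
move=> bz hb si0 step sa sv p0.
apply: (runs_le (T := (b * (T + 2) + 3)%N)); last first.
  by rewrite leq_add2r leq_mul2r bz orbT.
have na s' v : narr (nstore s' (4 * c + 1) v) = narr s'.
  by apply/funext => i; rewrite /narr /= ifF //; lia.
have nv s' v : nvar (nstore s' (4 * c + 1) v) = upd (nvar s') c v.
  by apply/funext => i; rewrite /nvar /upd /= eqn_add2r eqn_mul2l.
have vc s' i : nvar s' = upd si c i -> nmem s' (4 * c + 1) = i.
  by move=> e; move/(congr1 (fun g => g c)): e; rewrite upd_eq.
apply: (runs_for (I := fun i s' => [/\ narr s' = an, nvar s' = upd si c i & P i (rmem s')])).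
- by split; rewrite ?na ?nv ?sv.
- move=> i s' ib [e1 e2 e3]; split; [exact: hb|exact: vc|].
  apply: runs_mono (step i s' ib e1 e2 e3) _ => s'' [f1 f2 f3].
  by split; [exact: vc|split; rewrite ?na ?nv ?f2 ?upd_upd].
- move=> s' [e1 e2 e3]; split; [exact: hb|exact: vc|].
  by split; rewrite ?na ?nv ?e2 ?upd_upd // -si0 upd_id.
Qed.

End ForTable.

Section Tables.
Context {R : realType}.
Variables (S : nat) (N : network R).
Hypotheses (plane : plane_network N) (conn : connected_network N)
  (has_edge : edges N != [::]).
Implicit Types (s : state R) (an si : nat -> nat) (rm : nat -> R).

Local Notation n := (nvert N).
Local Notation m := (size (edges N)).

Definition n_bound : nexpr := NLoad (NConst 0).
Definition m_bound : nexpr := NLoad (NConst 2).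

Definition cell (v : iterm) : nexpr := NAdd (compile_iterm v) (compile_iterm v).

(** Multiples are obtained by repeated addition, since the machine has no integer product. *)
Definition row_program : cmd :=
  Seq (NStore (cell (i_row (IConst 0))) (NConst 0))
    (For 0 n_bound
      (NStore (cell (i_row (IAdd (IVar 0) (IConst 1))))
        (NAdd (NLoad (cell (i_row (IVar 0)))) n_bound))).

Definition nat_table an : Prop :=
  [/\ an 0%N = n, an 1%N = m
   & forall e, e \in edges N -> forall b : bool,
      an (2 + b + (index e (edges N) + index e (edges N)))%N = edge_end e b].

Definition row_table an : Prop :=
  forall i : 'I_n, an (m + m + (2 + i))%N = (i * n)%N.

Lemma runs_rows z s : (n <= z)%N -> nat_table (narr s) -> nvar s = (fun=> 0%N) ->
  runs row_program s (z * 3 + 4) (fun s' =>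
    [/\ nat_table (narr s'), row_table (narr s'), nvar s' = (fun=> 0%N)
      & rmem s' = rmem s]).
Proof.
move=> nz [a0 a1 ae] sv.
have n0 : (0 < n)%N by case: conn.
pose an i x := if (m + m + 2 <= x <= m + m + 2 + i)%N
  then ((x - (m + m + 2)) * n)%N else narr s x.
have an0 i : an i 0%N = n by rewrite /an ifF ?a0 //; lia.
have an1 i : an i 1%N = m by rewrite /an ifF ?a1 //; lia.
have st s' x v i : narr s' = an i -> (x = m + m + 2 + i.+1)%N -> v = (i.+1 * n)%N ->
    narr (nstore s' (x + x) v) = an i.+1.
  move=> e -> ->; apply/funext => y; rewrite /narr /= /an.
  have -> : (y + y == m + m + 2 + i.+1 + (m + m + 2 + i.+1))%N = (y == m + m + 2 + i.+1)%N by lia.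
  case: eqP => [->|/eqP ne]; first by rewrite ifT ?addKn //; lia.
  move/(congr1 (fun g => g y)): e; rewrite /narr /an => ->.
  by have -> : (m + m + 2 <= y <= m + m + 2 + i)%N =
    (m + m + 2 <= y <= m + m + 2 + i.+1)%N by lia.
have stv s' x v : nvar (nstore s' (x + x) v) = nvar s'.
  by apply/funext => y; rewrite /nvar /= ifF //; lia.
apply: (runs_le (T := (1 + (n * (1 + 2) + 3))%N)); last by lia.
apply/runs_seq/runs_nstore.
have -> : neval s (cell (i_row (IConst 0))) = (m + m + 2 + (m + m + 2))%N.
  rewrite -[LHS]/(neval s (compile_iterm (i_row (IConst 0))) + neval s (compile_iterm (i_row (IConst 0))))%N.
  by rewrite (neval_iterm 0) /= a1; lia.
set s1 := nstore _ _ _.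
have e1 : narr s1 = an 0%N.
  apply/funext => y; rewrite /s1 /narr /= /an.
  have -> : (y + y == m + m + 2 + (m + m + 2))%N = (m + m + 2 <= y <= m + m + 2 + 0)%N by lia.
  by case: ifP => // hy; have -> : (y - (m + m + 2) = 0)%N by lia.
have e2 : nvar s1 = fun=> 0%N by rewrite stv.
have na s' v : narr (nstore s' (4 * 0 + 1) v) = narr s'.
  by apply/funext => i; rewrite /narr /= ifF //; lia.
have nv s' v : nvar (nstore s' (4 * 0 + 1) v) = upd (nvar s') 0 v.
  by apply/funext => i; rewrite /nvar /upd /= eqn_add2r eqn_mul2l.
apply: (runs_for (I := fun i s' => [/\ narr s' = an i,
  nvar s' = upd (fun=> 0%N) 0 i & rmem s' = rmem s])).
- by split; rewrite ?na ?nv ?e1 ?e2.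
- move=> i s' ilt [f1 f2 f3]; split.
  + by rewrite -[LHS]/(narr s' 0%N) f1 an0.
  + by rewrite -[LHS]/(nvar s' 0%N) f2.
  apply: runs_nstore.
  have rowE v : neval s' (cell (i_row v)) =
     ((m + m + 2 + ival (struct_of 0 s') (nvar s') v) + (m + m + 2 + ival (struct_of 0 s') (nvar s') v))%N.
    rewrite -[LHS]/(neval s' (compile_iterm (i_row v)) + neval s' (compile_iterm (i_row v)))%N.
    by rewrite (neval_iterm 0) /= f1 an1 !addnA.
  have vE : neval s' (NAdd (NLoad (cell (i_row (IVar 0)))) n_bound) = (i.+1 * n)%N.
    rewrite -[LHS]/(nmem s' (neval s' (cell (i_row (IVar 0)))) + narr s' 0%N)%N rowE /= f2 /=.
    rewrite -[nmem s' _]/(narr s' (m + m + 2 + i)%N) f1 an0 /an ifT; last by lia.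
    by rewrite addKn mulSn addnC.
  have aE : neval s' (cell (i_row (IAdd (IVar 0) (IConst 1)))) =
      (m + m + 2 + i.+1 + (m + m + 2 + i.+1))%N.
    by rewrite rowE /= f2 /= upd_eq addn1.
  rewrite vE aE; split; first by rewrite -[LHS]/(nvar _ 0%N) stv f2.
  split.
  + by rewrite na; apply: st.
  + by rewrite nv stv f2 upd_upd.
  + exact: f3.
- move=> s' [f1 f2 f3]; split.
  + by rewrite -[LHS]/(narr s' 0%N) f1 an0.
  + by rewrite -[LHS]/(nvar s' 0%N) f2.
  rewrite na f1; split=> //.
  + split=> // e ein b; rewrite /an ifF ?ae //.
    by have := ein; rewrite -index_mem; case: b => /=; lia.
  + move=> i; rewrite /an ifT; last by have := ltn_ord i; lia.
    by have -> : (m + m + (2 + i) - (m + m + 2) = i)%N by lia.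
  + by rewrite nv f2 upd_upd; apply/funext => x; rewrite /upd; case: eqP.
Qed.

End Tables.

(** * Floyd-Warshall on the machine *)

Section DistanceTable.
Context {R : realType}.
Variables (S : nat) (N : network R).
Hypotheses (plane : plane_network N) (conn : connected_network N)
  (has_edge : edges N != [::]).
Implicit Types (s : state R) (an si : nat -> nat) (rm : nat -> R)
  (i j k a b : 'I_(nvert N)) (e : 'I_(nvert N) * 'I_(nvert N)).

Local Notation n := (nvert N).
Local Notation m := (size (edges N)).

Definition dist_cell i j : nat :=
  (S + ((n + n + (i * n + j)) + (n + n + (i * n + j))))%N.

Definition dist_of rm i j : R := rm (dist_cell i j).

Definition pos_table rm : Prop := forall i (c : bool),
  rm (S + ((c + (i + i)) + (c + (i + i))))%N = if c then (pos i).2 else (pos i).1.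

Definition tables an rm : Prop :=
  [/\ nat_table N an, row_table N an & pos_table rm].

Lemma tables_structure s : tables (narr s) (rmem s) ->
  network_structure (dist_of (rmem s)) (struct_of S s).
Proof. by move=> [[h0 h1 h2] h3 h4]. Qed.

Lemma dist_cell_inj i j a b : (dist_cell i j == dist_cell a b) = (i == a) && (j == b).
Proof.
apply/eqP/andP => [|[/eqP-> /eqP->]//]; rewrite /dist_cell => h.
have {}h : (i * n + j = a * n + b)%N by lia.
have n0 : (0 < n)%N by case: conn.
have ia : i = a :> nat.
  have := congr1 (divn^~ n) h.
  by rewrite !divnMDl // !divn_small ?addn0.
by split; apply/eqP/val_inj => //=; move: h; rewrite ia => /addnI.
Qed.

Lemma dist_of_upd rm i j v a b :
  dist_of (upd rm (dist_cell i j) v) a b =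
  if (a == i) && (b == j) then v else dist_of rm a b.
Proof. by rewrite /dist_of /upd dist_cell_inj. Qed.

Lemma pos_table_upd rm i j v : pos_table rm -> pos_table (upd rm (dist_cell i j) v).
Proof.
move=> h a c; rewrite /upd ifF ?h //; apply/negbTE; rewrite /dist_cell.
by have := ltn_ord a; case: c => /= ?; apply/eqP; lia.
Qed.

Definition store_dist (v w : iterm) (e : rexpr) : cmd :=
  RStore (NAdd (NConst S) (cell (i_dist v w))) e.

Lemma runs_store_dist s v w ex i j (Q : state R -> Prop) : tables (narr s) (rmem s) ->
  ival (struct_of S s) (nvar s) v = i -> ival (struct_of S s) (nvar s) w = j ->
  Q (State (nmem s) (upd (rmem s) (dist_cell i j) (reval s ex))) ->
  runs (store_dist v w ex) s 1 Q.
Proof.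
move=> [[h0 h1 _] h3 _] vi wj q; apply: runs_rstore.
suff -> : neval s (NAdd (NConst S) (cell (i_dist v w))) = dist_cell i j by [].
rewrite -[LHS]/(S + (neval s (compile_iterm (i_dist v w)) +
  neval s (compile_iterm (i_dist v w))))%N (neval_iterm S).
rewrite -[ival _ _ _]/(narr s 0 + narr s 0 + (narr s (narr s 1 + narr s 1 +
  (2 + ival (struct_of S s) (nvar s) v)) + ival (struct_of S s) (nvar s) w))%N.
by rewrite vi wj h0 h1 h3.
Qed.

Definition r_diff (c : bool) : rexpr :=
  compile_rterm S (TSub (t_pos c (i_end 1 false)) (t_pos c (i_end 1 true))).

Definition r_length : rexpr :=
  RSqrt (RAdd (RMul (r_diff false) (r_diff false)) (RMul (r_diff true) (r_diff true))).

Lemma reval_length s e : tables (narr s) (rmem s) -> at_edge (nvar s) 1 e ->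
  reval s r_length = edge_length e.
Proof.
move=> /tables_structure st h.
have dE c : reval s (r_diff c) = (if c then (pos e.1).2 else (pos e.1).1) -
    (if c then (pos e.2).2 else (pos e.2).1).
  rewrite reval_rterm tval_sub.
  by rewrite (tval_pos st _ c (ival_end st false h)) (tval_pos st _ c (ival_end st true h)).
rewrite -[LHS]/(Num.sqrt (reval s (r_diff false) * reval s (r_diff false) +
  reval s (r_diff true) * reval s (r_diff true))).
by rewrite !dE -!expr2.
Qed.

(** An invariant of all updates from the initial table on: no entry is ever too small, because an
    actual path realises it. *)
Definition sound rm : Prop :=
  forall i j, joined (locus N) (pos i) (pos j) (dist_of rm i j).

Lemma sound_upd rm i j v : sound rm -> joined (locus N) (pos i) (pos j) v ->
  sound (upd rm (dist_cell i j) v).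
Proof. by move=> h hv a b; rewrite dist_of_upd; case: andP => // -[/eqP-> /eqP->]. Qed.

Definition total_length : R := \sum_(e <- edges N) edge_length e.

(** A simple path has at most n edges, each no longer than the total. This finite number replaces
    infinity in the initial table, which is therefore sound. *)
Lemma joined_total i j : joined (locus N) (pos i) (pos j) (n%:R * total_length).
Proof.
have L0 : 0 <= total_length by apply: sumr_ge0 => e _; apply: edge_length_ge0.
have le1 e : e \in edges N -> edge_length e <= total_length.
  move=> ein; rewrite /total_length (big_rem e) //= lerDl.
  by apply: sumr_ge0 => f _; apply: edge_length_ge0.
have [_ /(_ i j)/connectP[p0 + ->]] := conn.
move=> /shortenP[p hp up _].
have hsz : (size p <= n)%N.
  by have := card_uniqP up; rewrite -[X in (_ <= X)%N]card_ord => /= h; rewrite ltnW // -h max_card.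
apply: (joined_le (l := (size p)%:R * total_length)).
  by rewrite ler_wpM2r // ler_nat.
elim: p i hp {up hsz} => [|k p IH] i /=; first by move=> _; rewrite mul0r; apply: joined_refl.
move=> /andP[ik hp]; rewrite -addn1 natrD addrC mulrDl mul1r.
apply: joined_trans (IH k hp); apply: (joined_le (l := edist (pos i) (pos k))).
  case/orP: ik => h; first exact: le1 h.
  by rewrite edistC; apply: le1 h.
apply: joined_segment; case/orP: ik => h; first exact: (edge_sub_locus h).
by rewrite segmentC; apply: (edge_sub_locus h).
Qed.

(** The cell of real variable 0, outside the tables and free until the search begins. *)
Definition big_cell : nexpr := NConst (S + 1).

(** An integer in memory cannot be converted to a real, so the factor n comes from n rounds of
    summation. *)
Definition total_program : cmd :=
  Seq (RStore big_cell (RConst 0))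
    (For 0 n_bound (For 1 m_bound
       (RStore big_cell (RAdd (RLoad big_cell) r_length)))).

Lemma pos_table_big rm v : pos_table rm -> pos_table (upd rm (S + 1) v).
Proof.
by move=> h a c; rewrite /upd ifF ?h //; apply/negbTE/eqP; lia.
Qed.

Lemma bound_n an s : nat_table N an -> narr s = an -> neval s n_bound = n.
Proof. by move=> [h0 _ _] e; rewrite -[LHS]/(narr s 0%N) e. Qed.

Lemma bound_m an s : nat_table N an -> narr s = an -> neval s m_bound = m.
Proof. by move=> [_ h1 _] e; rewrite -[LHS]/(narr s 1%N) e. Qed.

Definition ready an s : Prop :=
  [/\ tables an (rmem s), narr s = an & nvar s = fun=> 0%N].

Lemma at_edge_nth si c x0 l : (l < m)%N -> si c = l -> at_edge si c (nth x0 (edges N) l).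
Proof.
move=> lm e; split; first exact: mem_nth.
by rewrite e index_uniq //; case: plane.
Qed.

Lemma runs_total an s z : (n <= z)%N -> (m <= z)%N -> ready an s ->
  runs total_program s (1 + (z * ((z * (1 + 2) + 3) + 2) + 3)) (fun s' =>
    ready an s' /\ rmem s' (S + 1)%N = n%:R * total_length).
Proof.
move=> nz mz [[t1 t2 t3] sa sv]; apply/runs_seq/runs_rstore.
set s1 := rstore _ _ _.
have [x0 x0in] := edge_exists has_edge.
pose part l := \sum_(0 <= q < l) edge_length (nth x0 (edges N) q).
have partE : part m = total_length by rewrite /part /total_length (big_nth x0).
pose P (q : nat) rm := pos_table rm /\ rm (S + 1)%N = q%:R * total_length.
suff h : runs (For 0 n_bound (For 1 m_bound
      (RStore big_cell (RAdd (RLoad big_cell) r_length)))) s1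
    (z * ((z * (1 + 2) + 3) + 2) + 3) (fun s' =>
    [/\ narr s' = an, nvar s' = (fun=> 0%N) & P n (rmem s')]).
  by apply: runs_mono h _ => s' [e1 e2 [e3 e4]].
apply: runs_for_table => //.
- by move=> s'; apply: bound_n.
- move=> q s' qn f1 f2 [f3 f4].
  pose P' (l : nat) rm := pos_table rm /\ rm (S + 1)%N = q%:R * total_length + part l.
  suff h : runs (For 1 m_bound (RStore big_cell (RAdd (RLoad big_cell) r_length))) s'
      (z * (1 + 2) + 3) (fun s'' =>
      [/\ narr s'' = an, nvar s'' = upd (fun=> 0%N) 0 q & P' m (rmem s'')]).
    apply: runs_mono h _ => s'' [e1 e2 [e3 e4]]; split=> //; split=> //.
    by rewrite e4 partE -addn1 natrD mulrDl mul1r.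
  apply: runs_for_table => //.
  + by move=> s2; apply: bound_m.
  + move=> l s2 lm g1 g2 [g3 g4]; apply: runs_rstore.
    have ae : at_edge (nvar s2) 1 (nth x0 (edges N) l).
      by apply: at_edge_nth => //; rewrite g2 upd_eq.
    have lE : reval s2 r_length = edge_length (nth x0 (edges N) l).
      by apply: reval_length ae; rewrite g1.
    rewrite -[reval _ _]/(rmem s2 (S + 1)%N + reval s2 r_length) lE g4.
    rewrite -[neval _ _]/(S + 1)%N; split=> //; split; first exact: pos_table_big.
    by rewrite /= eqxx /part big_nat_recr //= addrA.
  + by split=> //; rewrite f4 /part big_geq // addr0.
- split; first exact: pos_table_big.
  by rewrite /= eqxx mul0r.
Qed.

Definition fill_program : cmd :=
  For 0 n_bound (For 1 n_bound (store_dist (IVar 0) (IVar 1) (RLoad big_cell))).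

Lemma runs_fill an s z B : (n <= z)%N -> ready an s -> rmem s (S + 1)%N = B ->
  runs fill_program s (z * ((z * (1 + 2) + 3) + 2) + 3) (fun s' =>
    ready an s' /\ forall i j, dist_of (rmem s') i j = B).
Proof.
move=> nz [[t1 t2 t3] sa sv] sB.
pose P (q : nat) rm := [/\ pos_table rm, rm (S + 1)%N = B
  & forall i j, (i < q)%N -> dist_of rm i j = B].
suff h : runs fill_program s (z * ((z * (1 + 2) + 3) + 2) + 3) (fun s' =>
    [/\ narr s' = an, nvar s' = (fun=> 0%N) & P n (rmem s')]).
  by apply: runs_mono h _ => s' [e1 e2 [e3 e4 e5]]; split=> // i j; apply: e5.
apply: runs_for_table => //; first by move=> s'; apply: bound_n.
move=> q s' qn f1 f2 [f3 f4 f5].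
pose P' (l : nat) rm := [/\ pos_table rm, rm (S + 1)%N = B
  & forall i j, (i < q)%N || (i == q :> nat) && (j < l)%N -> dist_of rm i j = B].
suff h : runs (For 1 n_bound (store_dist (IVar 0) (IVar 1) (RLoad big_cell))) s'
    (z * (1 + 2) + 3) (fun s'' =>
    [/\ narr s'' = an, nvar s'' = upd (fun=> 0%N) 0 q & P' n (rmem s'')]).
  apply: runs_mono h _ => s'' [e1 e2 [e3 e4 e5]]; split=> //; split=> // i j.
  by rewrite ltnS leq_eqVlt => iq; apply: e5; rewrite ltn_ord andbT orbC.
apply: runs_for_table => //.
- by move=> s2; apply: bound_n.
- move=> l s2 ln g1 g2 [g3 g4 g5].
  apply: (@runs_store_dist _ _ _ _ (Ordinal qn) (Ordinal ln)); rewrite ?g1 //=.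
  + by rewrite g2.
  + by rewrite g2.
  split=> //; split=> /=; first exact: pos_table_upd.
    by rewrite /upd ifF ?g4 //; apply/negbTE/eqP; rewrite /dist_cell; lia.
  move=> i j h; rewrite dist_of_upd; case: andP => // nij; apply: g5.
  move: h; rewrite ltnS (leq_eqVlt j) => /orP[->//|/andP[iq /orP[jl|->]]].
    by case: nij; split; apply/eqP; apply: val_inj => /=; apply/eqP.
  by rewrite iq orbT.
- by split=> // i j; rewrite andbF orbF; apply: f5.
Qed.

Definition diagonal_program : cmd :=
  For 0 n_bound (store_dist (IVar 0) (IVar 0) (RConst 0)).

Definition zero_diagonal rm := forall i, dist_of rm i i = 0.

Lemma runs_diagonal an s z : (n <= z)%N -> ready an s -> sound (rmem s) ->
  runs diagonal_program s (z * (1 + 2) + 3) (fun s' =>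
    [/\ ready an s', sound (rmem s') & zero_diagonal (rmem s')]).
Proof.
move=> nz [[t1 t2 t3] sa sv] so.
pose P (q : nat) rm := [/\ pos_table rm, sound rm
  & forall i, (i < q)%N -> dist_of rm i i = 0].
suff h : runs diagonal_program s (z * (1 + 2) + 3) (fun s' =>
    [/\ narr s' = an, nvar s' = (fun=> 0%N) & P n (rmem s')]).
  by apply: runs_mono h _ => s' [e1 e2 [e3 e4 e5]]; split=> // i; apply: e5.
apply: runs_for_table => //; first by move=> s'; apply: bound_n.
move=> q s2 qn g1 g2 [g3 g4 g5].
apply: (@runs_store_dist _ _ _ _ (Ordinal qn) (Ordinal qn)); rewrite ?g1 //=.
+ by rewrite g2.
+ by rewrite g2.
split=> //; split=> /=; first exact: pos_table_upd.
  by apply: sound_upd => //; apply: joined_refl.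
move=> i; rewrite dist_of_upd andbb; case: eqVneq => // ne.
rewrite ltnS leq_eqVlt => /orP[/eqP iq|]; last exact: g5.
by move: ne; rewrite -val_eqE /= iq eqxx.
Qed.

Definition edge_program : cmd :=
  For 1 m_bound
    (Seq (store_dist (i_end 1 false) (i_end 1 true) r_length)
         (store_dist (i_end 1 true) (i_end 1 false) r_length)).

(** Inequalities survive later updates; they become equalities at the end, because a sound entry is
    never below the straight distance. *)
Definition edge_bound rm e : Prop :=
  dist_of rm e.1 e.2 <= edge_length e /\ dist_of rm e.2 e.1 <= edge_length e.

Lemma runs_edges an s z : (m <= z)%N -> ready an s -> sound (rmem s) ->
  zero_diagonal (rmem s) ->
  runs edge_program s (z * ((1 + 1) + 2) + 3) (fun s' =>
    [/\ ready an s', sound (rmem s'), zero_diagonal (rmem s')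
      & forall e, e \in edges N -> edge_bound (rmem s') e]).
Proof.
move=> mz [[t1 t2 t3] sa sv] so zd.
have [x0 x0in] := edge_exists has_edge.
pose P (q : nat) rm := [/\ pos_table rm, sound rm, zero_diagonal rm
  & forall e, e \in edges N -> (index e (edges N) < q)%N -> edge_bound rm e].
suff h : runs edge_program s (z * ((1 + 1) + 2) + 3) (fun s' =>
    [/\ narr s' = an, nvar s' = (fun=> 0%N) & P m (rmem s')]).
  apply: runs_mono h _ => s' [e1 e2 [e3 e4 e5 e6]]; split=> // e ein.
  by apply: e6; rewrite ?index_mem.
apply: runs_for_table => //; first by move=> s'; apply: bound_m.
move=> q s1 qm g1 g2 [g3 g4 g5 g6].
set e0 := nth x0 (edges N) q.
have ae s' : nvar s' = nvar s1 -> at_edge (nvar s') 1 e0.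
  by move=> h; apply: at_edge_nth => //; rewrite h g2 upd_eq.
have e0in : e0 \in edges N by apply: mem_nth.
have tb : tables (narr s1) (rmem s1) by rewrite g1.
have neq : e0.1 != e0.2 by case: plane => _ _ h _; apply: h.
have upd_bound rm i j e : edge_bound rm e ->
    edge_bound (upd rm (dist_cell i j) (edist (pos i) (pos j))) e.
  move=> [b1 b2]; rewrite /edge_bound !dist_of_upd; split.
    by case: andP => // -[/eqP<- /eqP<-].
  by case: andP => // -[/eqP<- /eqP<-]; rewrite edistC.
have upd_diag rm i j v : i != j -> zero_diagonal rm ->
    zero_diagonal (upd rm (dist_cell i j) v).
  move=> ij h a; rewrite dist_of_upd; case: andP => // -[/eqP ai /eqP aj].
  by move: ij; rewrite -ai -aj eqxx.
have join12 : joined (locus N) (pos e0.1) (pos e0.2) (edge_length e0).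
  by apply: joined_segment; apply: (edge_sub_locus e0in).
apply: runs_seq.
apply: (@runs_store_dist _ _ _ _ e0.1 e0.2) => //.
- exact: (ival_end (tables_structure tb) false (ae s1 erefl)).
- exact: (ival_end (tables_structure tb) true (ae s1 erefl)).
rewrite (reval_length tb (ae s1 erefl)); set s2 := State _ _.
have tb2 : tables (narr s2) (rmem s2).
  by case: tb => ? ? ?; split=> //; apply: pos_table_upd.
apply: (@runs_store_dist _ _ _ _ e0.2 e0.1) => //.
- exact: (ival_end (tables_structure tb2) true (ae s2 erefl)).
- exact: (ival_end (tables_structure tb2) false (ae s2 erefl)).
rewrite (reval_length tb2 (ae s2 erefl)).
split=> //; split=> /=.
- by do 2!apply: pos_table_upd.
- apply: sound_upd; first exact: sound_upd.
  exact: joined_sym.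
- by apply/upd_diag; [rewrite eq_sym|apply/upd_diag].
move=> e ein; rewrite ltnS leq_eqVlt => /orP[/eqP iq|iq].
  have -> : e = e0 by rewrite /e0 -iq nth_index.
  by rewrite /edge_bound !dist_of_upd !eqxx (negbTE neq) /= lexx.
rewrite {2}/edge_length edistC; apply/upd_bound.
by apply/upd_bound; apply: g6.
Qed.

Definition relax_step : cmd :=
  let d v w := compile_rterm S (t_dist (IVar v) (IVar w)) in
  If (BRLe (d 0 1) (RAdd (d 0 2) (d 2 1))) Skip
    (store_dist (IVar 0) (IVar 1) (RAdd (d 0 2) (d 2 1))).

Definition relax_program : cmd :=
  For 2 n_bound (For 0 n_bound (For 1 n_bound relax_step)).

(** The invariant is the triangle inequality through every vertex x < q, rather than a statement
    about paths with restricted inner vertices. After n rounds it holds through all vertices, which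
    together with soundness and the edge bounds gives a distance table. *)
Lemma runs_relax an s z : (n <= z)%N -> ready an s -> sound (rmem s) ->
  zero_diagonal (rmem s) -> (forall e, e \in edges N -> edge_bound (rmem s) e) ->
  runs relax_program s (z * ((z * ((z * (2 + 2) + 3) + 2) + 3) + 2) + 3) (fun s' =>
    ready an s' /\ distance_table (dist_of (rmem s'))).
Proof.
move=> nz [[t1 t2 t3] sa sv] so zd eb.
pose P (q : nat) rm := [/\ pos_table rm, sound rm, zero_diagonal rm,
  forall e, e \in edges N -> edge_bound rm e
  & forall i (x : 'I_n) j, (x < q)%N -> dist_of rm i j <= dist_of rm i x + dist_of rm x j].
suff h : runs relax_program s (z * ((z * ((z * (2 + 2) + 3) + 2) + 3) + 2) + 3)
    (fun s' => [/\ narr s' = an, nvar s' = (fun=> 0%N) & P n (rmem s')]).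
  apply: runs_mono h _ => s' [e1 e2 [e3 e4 e5 e6 e7]]; split=> //; split=> //.
    by move=> i k j; apply: e7.
  move=> e ein; have [b1 b2] := e6 e ein.
  have c1 := edist_joined (e4 e.1 e.2); have c2 := edist_joined (e4 e.2 e.1).
  rewrite edistC in c2; by split; apply/eqP; rewrite eq_le ?b1 ?b2.
apply: runs_for_table => //; first by move=> s'; apply: bound_n.
move=> q s1 qn f1 f2 [f3 f4 f5 f6 f7].
pose k : 'I_n := Ordinal qn.
pose D0 := dist_of (rmem s1).
have D0pos i j : 0 <= D0 i j.
  by apply: le_trans (edist_ge0 _ _) (edist_joined (f4 i j)).
pose D1 i j := Order.min (D0 i j) (D0 i k + D0 k j).
pose partial (x y : nat) rm := [/\ pos_table rm, sound rm
  & forall i j, dist_of rm i j =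
      if (i < x)%N || (i == x :> nat) && (j < y)%N then D1 i j else D0 i j].
(* By the zero diagonal, row k and column k do not change in round k, so updating in place still
   reads the old entries. *)
have D1k i : D1 i k = D0 i k.
  by rewrite /D1 /D0 (f5 k) addr0 minxx.
have D1k' j : D1 k j = D0 k j.
  by rewrite /D1 /D0 (f5 k) add0r minxx.
pose si := upd (fun=> 0%N) 2 q.
suff h : runs (For 0 n_bound (For 1 n_bound relax_step)) s1
    (z * ((z * (2 + 2) + 3) + 2) + 3)
    (fun s' => [/\ narr s' = an, nvar s' = si & partial n 0%N (rmem s')]).
  apply: runs_mono h _ => s' [e1 e2 [e3 e4 e5]].
  have {}e5 i j : dist_of (rmem s') i j = D1 i j by rewrite e5 ltn_ord.
  split=> //; split=> //.
  - by move=> i; rewrite e5 /D1 /D0 f5; apply: min_l; rewrite addr_ge0 ?D0pos.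
  - move=> e ein; have [b1 b2] := f6 e ein.
    by split; rewrite e5 /D1 ge_min ?b1 ?b2.
  - move=> i x j; rewrite !e5 ltnS leq_eqVlt => /orP[/eqP xq|xq].
      have -> : x = k by apply: val_inj.
      by rewrite D1k D1k' /D1 ge_min lexx orbT.
    have t a b : D0 a b <= D0 a x + D0 x b by apply: f7.
    (* Four cases according to which term attains each minimum; if both routes pass through k, the
       round trip from k to x and back is dropped as nonnegative. *)
    have h1 := t i j; have h2 := t i k; have h3 := t k j; have h4 := D0pos k x.
    have h5 := D0pos x k.
    rewrite /D1 ge_min; apply/orP.
    case: (leP (D0 i x) (D0 i k + D0 k x)) => _; case: (leP (D0 x j) (D0 x k + D0 k j)) => _.
    + by left.
    + by right; lra.
    + by right; lra.
    + by right; lra.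
apply: (runs_for_table (b := n) (P := fun x => partial x 0%N)) => //.
- by move=> s'; apply: bound_n.
- move=> x s2 xn g1 g2 hp.
  suff h : runs (For 1 n_bound relax_step) s2
    (z * (2 + 2) + 3)
    (fun s' => [/\ narr s' = an, nvar s' = upd si 0 x & partial x n (rmem s')]).
    apply: runs_mono h _ => s' [e1 e2 [e3 e4 e5]]; split=> //; split=> // i j.
    by rewrite e5 ltn_ord andbT ltn0 andbF orbF ltnS (leq_eqVlt i) orbC.
  apply: runs_for_table => //.
  + by move=> s'; apply: bound_n.
  + move=> y s3 yn h1 h2 [h3 h4 h5].
    have tb : tables (narr s3) (rmem s3) by rewrite h1.
    have st := tables_structure tb.
    have v0 : ival (struct_of S s3) (nvar s3) (IVar 0) = Ordinal xn by rewrite /= h2.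
    have v1 : ival (struct_of S s3) (nvar s3) (IVar 1) = Ordinal yn by rewrite /= h2.
    have v2 : ival (struct_of S s3) (nvar s3) (IVar 2) = k by rewrite /= h2.
    pose d v w := reval s3 (compile_rterm S (t_dist (IVar v) (IVar w))).
    have d01 : d 0%N 1%N = D0 (Ordinal xn) (Ordinal yn).
      by rewrite /d reval_rterm (tval_dist st _ v0 v1) h5 /= !ltnn andbF.
    have d02 : d 0%N 2%N = D0 (Ordinal xn) k.
      by rewrite /d reval_rterm (tval_dist st _ v0 v2) h5 D1k; case: ifP.
    have d21 : d 2%N 1%N = D0 k (Ordinal yn).
      by rewrite /d reval_rterm (tval_dist st _ v2 v1) h5 D1k'; case: ifP.
    have cond i j : (i < x)%N || (i == x :> nat) && (j < y.+1)%N =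
        ((i < x)%N || (i == x :> nat) && (j < y)%N) || (i == Ordinal xn) && (j == Ordinal yn).
      by rewrite ltnS (leq_eqVlt j) -!val_eqE /= andb_orr orbA orbAC.
    apply: runs_if.
    rewrite -[beval _ _]/(d 0%N 1%N <= d 0%N 2%N + d 2%N 1%N) d01 d02 d21.
    case: ifP => hle.
      apply: runs_skip; split=> //; split=> // i j; rewrite h5 cond.
      case: ifP => //= _; case: andP => // -[/eqP-> /eqP->].
      by rewrite /D1; apply/esym/min_l.
    apply: (runs_store_dist tb v0 v1).
    rewrite -[reval _ _]/(d 0%N 2%N + d 2%N 1%N) d02 d21; split=> //; split=> /=.
    * exact: pos_table_upd.
    * apply: sound_upd => //.
      exact: joined_trans (f4 (Ordinal xn) k) (f4 k (Ordinal yn)).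
    * move=> i j; rewrite dist_of_upd h5 cond.
      case: andP => [[/eqP-> /eqP->]|]; last by rewrite orbF.
      rewrite orbT /D1; apply/esym/min_r/ltW.
      by rewrite ltNge hle.
- by split=> // i j; rewrite ltn0 andbF.
Qed.

End DistanceTable.

(** * The algorithm *)

Lemma size_flatten_pairs (T U : Type) (f g : T -> U) (s : seq T) :
  size (flatten [seq [:: f x; g x] | x <- s]) = (size s + size s)%N.
Proof. by elim: s => //= x s ->; rewrite addnS. Qed.

Lemma nth_flatten_pairs (T U : Type) (f g : T -> U) (s : seq T) x0 y0 k (c : bool) :
  (k < size s)%N ->
  nth y0 (flatten [seq [:: f x; g x] | x <- s]) (c + (k + k)) =
  if c then g (nth x0 s k) else f (nth x0 s k).
Proof.
elim: s k => //= x s IH [|k]; first by case: (c).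
rewrite ltnS => ks; rewrite -(IH k ks).
by have -> : (c + (k.+1 + k.+1) = (c + (k + k)).+2)%N by lia.
Qed.

Section NoEdges.
Context {R : realType}.

(** A connected network without edges is a single point, so the inserted segment is degenerate and
    changes nothing. *)
Lemma no_edge_no_shortcut (N : network R) p q : connected_network N ->
  edges N = [::] -> ~ is_shortcut N p q.
Proof.
move=> [_ conn] E [lp lq]; suff -> : locus N `|` segment p q = locus N.
  by rewrite ltxx.
have same (i j : 'I_(nvert N)) : i = j.
  have /connectP[[|k s] /=] := conn i j; first by move=> _ ->.
  by rewrite /adjacent E.
have eqpt x y : locus N x -> locus N y -> x = y.
  have pt z : locus N z -> range (@pos R N) z by case=> // -[e] /=; rewrite E.
  by move=> /pt[i _ <-] /pt[j _ <-]; rewrite (same i j).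
apply/setUidPl => x [t _ ->]; suff -> : ((1 - t) * p.1 + t * q.1, (1 - t) * p.2 + t * q.2) = p.
  exact: lp.
rewrite (eqpt q p lq lp); case: (p) => a b /=.
by congr pair; ring.
Qed.

End NoEdges.

Section Assembly.
Context {R : realType}.
Variable S : nat.
Implicit Types s : state R.

Definition table_program : cmd :=
  Seq relocate_nat (Seq (relocate_real S) (Seq row_program (Seq (total_program S)
  (Seq (fill_program S) (Seq (diagonal_program S) (Seq (edge_program S)
  (relax_program S))))))).

Definition table_time (z : nat) : nat :=
  (2 * z * 4 + 5 + (2 * z * 3 + 2 + (z * 3 + 4 +
  (1 + (z * ((z * (1 + 2) + 3) + 2) + 3) +
  (z * ((z * (1 + 2) + 3) + 2) + 3 + (z * (1 + 2) + 3 + (z * ((1 + 1) + 2) + 3 +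
  (z * ((z * ((z * (2 + 2) + 3) + 2) + 3) + 2) + 3))))))))%N.

Lemma polybounded_table_time : polybounded table_time.
Proof. by rewrite /table_time; do 40?[apply: polybounded_add | apply: polybounded_mul]; auto with polyb. Qed.

Lemma runs_tables (N : network R) z : plane_network N -> connected_network N ->
  edges N != [::] -> (nvert N <= z)%N -> (size (edges N) <= z)%N ->
  runs table_program (network_input N) (table_time z) (fun s =>
    [/\ nvar s = (fun=> 0%N), ibound (struct_of S s) = size (edges N)
      & exists2 D : 'I_(nvert N) -> 'I_(nvert N) -> R,
          distance_table D & network_structure D (struct_of S s)]).
Proof.
move=> plane conn has_edge nz mz.
have [x0 x0in] := edge_exists has_edge.
set s0 := network_input N; pose g := nmem s0; pose r := rmem s0.
have g0 : g 0%N = nvert N by [].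
have g1 : g 1%N = size (edges N) by [].
have ge e (c : bool) : e \in edges N ->
    g (2 + c + (index e (edges N) + index e (edges N)))%N = edge_end e c.
  move=> ein; set k := index e (edges N).
  have -> : (2 + c + (k + k) = (c + (k + k)).+2)%N by lia.
  rewrite -[LHS]/(nth 0%N (flatten [seq [:: val e.1; val e.2] | e <- edges N])
    (c + (k + k))).
  by rewrite (nth_flatten_pairs _ _ x0) ?index_mem // nth_index //; case: c.
have gbig x : (2 * g 1%N + 2 <= x)%N -> g x = 0%N.
  move=> hx; rewrite /g /s0 /= nth_default //= size_flatten_pairs.
  by move: hx; rewrite g1; lia.
have rP (i : 'I_(nvert N)) (c : bool) :
    r (c + (i + i))%N = if c then (pos i).2 else (pos i).1.
  rewrite -[LHS]/(nth 0 (flatten [seq [:: (pos i).1; (pos i).2] | i <- enum 'I_(nvert N)])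
    (c + (i + i))).
  by rewrite (nth_flatten_pairs _ _ i) ?nth_ord_enum // size_enum_ord.
rewrite /table_time; apply: runs_seq.
apply: (runs_weaken (runs_relocate_nat (s := s0) (g := g) erefl gbig)).
  by rewrite g1; lia.
move=> s1 [r1 n1].
have a1 i : narr s1 i = g i by rewrite /narr n1 addnn odd_double doubleK.
have v1 : nvar s1 = fun=> 0%N.
  by apply/funext => c; rewrite /nvar n1 ifT //; lia.
apply: runs_seq; apply: (runs_weaken (runs_relocate_real S (s := s1) (g := r) r1 _)).
- by rewrite n1.
- by rewrite n1 /= g0; lia.
move=> s2 [n2 r2].
have a2 : narr s2 = g by apply/funext => i; rewrite -a1 /narr n2.
have v2 : nvar s2 = fun=> 0%N by rewrite /nvar n2.
have nt2 : nat_table N (narr s2).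
  rewrite a2; split; [exact: g0|exact: g1|]. by move=> e ein c; apply: ge.
apply: runs_seq; apply: runs_mono (runs_rows conn has_edge nz nt2 v2) _ => s3 [nt3 rt3 v3 r3].
have rd3 : ready S N (narr s3) s3.
  split=> //; split=> // i c; rewrite r3 r2 ?n1 /= ?g0; first by rewrite rP.
  by have := ltn_ord i; case: c; lia.
apply: runs_seq; apply: runs_mono (runs_total plane has_edge nz mz rd3) _.
move=> s4 [rd4 b4]; apply: runs_seq.
apply: runs_mono (runs_fill conn has_edge nz rd4 b4) _ => s5 [rd5 d5].
have so5 : sound S N (rmem s5).
  by move=> i j; rewrite d5; apply: joined_total.
apply: runs_seq; apply: runs_mono (runs_diagonal conn has_edge nz rd5 so5) _.
move=> s6 [rd6 so6 zd6]; apply: runs_seq.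
apply: runs_mono (runs_edges plane conn has_edge mz rd6 so6 zd6) _.
move=> s7 [rd7 so7 zd7 eb7].
apply: runs_mono (runs_relax conn has_edge nz rd7 so7 zd7 eb7) _.
move=> s8 [[tb8 a8 v8] dt8].
have st8 : tables S N (narr s8) (rmem s8) by rewrite a8.
split=> //; first by have [[_ h _] _ _] := st8.
by exists (dist_of S (rmem s8)) => //; apply: tables_structure.
Qed.

(** Real variables 0 to 3 are at the offsets 1, 3, 5, 7 from S; their values are copied to the
    output cells, which lie in the scratch space. *)
Definition answer_program : cmd :=
  Seq (NStore (NConst 0) (NConst 1))
  (Seq (RStore (NConst 0) (RLoad (NConst (S + 1))))
  (Seq (RStore (NConst 1) (RLoad (NConst (S + 3))))
  (Seq (RStore (NConst 2) (RLoad (NConst (S + 5))))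
       (RStore (NConst 3) (RLoad (NConst (S + 7))))))).

(** Only the first search decides anything: the later ones succeed whenever it does, so their flags
    are not tested. *)
Definition search_program (f0 f1 f2 f3 : form) : cmd :=
  Seq (find S 0 f0)
  (If (BNLe (NConst 1) (NLoad (tmp 0)))
    (Seq (find S 1 f1) (Seq (find S 2 f2) (Seq (find S 3 f3) answer_program)))
    (NStore (NConst 0) (NConst 0))).

Lemma runs_answer s : (4 <= S)%N -> runs answer_program s 5 (fun s' =>
  [/\ nmem s' 0%N = 1%N, rmem s' 0%N = rvar S s 0, rmem s' 1%N = rvar S s 1,
     rmem s' 2%N = rvar S s 2 & rmem s' 3%N = rvar S s 3]).
Proof.
move=> S4; do 4![apply: (runs_seq (T1 := 1)); first [apply: runs_nstore|apply: runs_rstore]].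
apply: runs_rstore.
by split; rewrite //= ?ifF // /rvar; lia.
Qed.

Definition main_program (f0 f1 f2 f3 : form) : cmd :=
  If (BNLe (NConst 1) (NLoad (NConst 1)))
    (Seq table_program (search_program f0 f1 f2 f3))
    (NStore (NConst 0) (NConst 0)).

Lemma polybounded_search_time T0 T1 T2 T3 : polybounded T0 -> polybounded T1 ->
  polybounded T2 -> polybounded T3 ->
  polybounded (fun z => T0 z + (T1 z + (T2 z + (T3 z + 5))).+1)%N.
Proof.
move=> b0 b1 b2 b3.
apply: (@polybounded_le _ (fun z => T0 z + ((T1 z + (T2 z + (T3 z + 5))) + 1))%N).
  by move=> z _; rewrite addn1.
by eauto 10 with polyb.
Qed.

End Assembly.

Lemma samples_size_bound (l : seq (seq rterm * nat)) :
  exists B, {in l, forall d, size d.1 < B}%N.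
Proof.
elim: l => [|d l [B hB]]; first by exists 0%N.
exists (maxn (size d.1).+1 B) => e; rewrite inE => /orP[/eqP->|/hB h].
  by rewrite leq_max leqnn.
by rewrite leq_max h orbT.
Qed.

Section Search.
Context {R : realType}.

(* The first elimination makes [FShortcut] free of real quantifiers; the others
   ask whether the coordinates found so far extend to a solution. *)
Lemma shortcut_search : exists S f0 f1 f2 f3,
  exists2 T, polybounded T & forall A (s : state R) z, (0 < ibound A)%N -> (0 < z)%N ->
    (ibound A <= z)%N -> struct_of S s = A -> nvar s = (fun=> 0%N) ->
    runs (search_program S f0 f1 f2 f3) s (T z) (fun s' =>
      (nmem s' 0 = 1%N /\ exists ro, [/\ holds A (fun=> 0%N) ro FShortcut,
         rmem s' 0 = ro 0, rmem s' 1 = ro 1, rmem s' 2 = ro 2 & rmem s' 3 = ro 3]%N) \/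
      (nmem s' 0 = 0%N /\ ~ exists x0 x1 x2 x3, holds A (fun=> 0%N)
         (upd (upd (upd (upd (rvar S s) 0 x0) 1 x1) 2 x2) 3 x3) FShortcut)).
Proof.
have [f3 rf3 h3] := @real_elimination R FShortcut.
have [f2 rf2 h2] := @elim_ex R 3 f3 rf3.
have [f1 rf1 h1] := @elim_ex R 2 f2 rf2.
have [f0 rf0 h0] := @elim_ex R 1 f1 rf1.
have [B0 hB0] := samples_size_bound (samples 0 (fname f0) (atoms f0)).
have [B1 hB1] := samples_size_bound (samples 1 (fname f1) (atoms f1)).
have [B2 hB2] := samples_size_bound (samples 2 (fname f2) (atoms f2)).
have [B3 hB3] := samples_size_bound (samples 3 (fname f3) (atoms f3)).
(* Scratch space for the coefficients of every sample polynomial of the four searches, and for the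
   four output cells. *)
pose S := (4 + B0 + B1 + B2 + B3)%N.
have [|T0 bT0 F0] := @runs_find R S 0 f0 rf0; first by move=> d /hB0; rewrite /S; lia.
have [|T1 bT1 F1] := @runs_find R S 1 f1 rf1; first by move=> d /hB1; rewrite /S; lia.
have [|T2 bT2 F2] := @runs_find R S 2 f2 rf2; first by move=> d /hB2; rewrite /S; lia.
have [|T3 bT3 F3] := @runs_find R S 3 f3 rf3; first by move=> d /hB3; rewrite /S; lia.
exists S, f0, f1, f2, f3.
exists (fun z => T0 z + (T1 z + (T2 z + (T3 z + 5))).+1)%N.
  exact: polybounded_search_time.
move=> A s z A0 z0 Az sA sv.
have si0 : forall c : nat, ((fun=> 0) c < ibound A)%N by [].
have lo0 : located S 0 A (rvar S s) (fun=> 0%N) s by split.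
apply: runs_seq; apply: runs_mono (F0 A _ z s A0 z0 Az lo0) _.
move=> s1 [[e1 e2 _] fo1]; apply: runs_if.
have -> : beval s1 (BNLe (NConst 1) (NLoad (tmp 0))) = (0 < ntmp s1 0)%N by [].
case: fo1 => [[-> hf0]|[-> nex]]; rewrite ?ltnn ?ltn0Sn; last first.
  apply: (runs_le (T := 1)); last by lia.
  apply: runs_nstore; right; split=> //=.
  move=> [x0 [x1 [x2 [x3 hx]]]]; apply: nex; exists x0.
  apply/h0 => //; exists x1; apply/h1 => //; exists x2; apply/h2 => //; exists x3.
  exact/h3.
have lo1 : located S 1 A (rvar S s1) (fun=> 0%N) s1 by split.
apply: runs_seq; apply: runs_mono (F1 A _ z s1 A0 z0 Az lo1) _.
move=> s2 [[a1 a2 _] [[_ hf1]|[_ nex]]]; last by case: nex; apply/h0.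
have lo2 : located S 2 A (rvar S s2) (fun=> 0%N) s2 by split.
apply: runs_seq; apply: runs_mono (F2 A _ z s2 A0 z0 Az lo2) _.
move=> s3 [[b1 b2 _] [[_ hf2]|[_ nex]]]; last by case: nex; apply/h1.
have lo3 : located S 3 A (rvar S s3) (fun=> 0%N) s3 by split.
apply: runs_seq; apply: runs_mono (F3 A _ z s3 A0 z0 Az lo3) _.
move=> s4 [[c1 c2 _] [[_ hf3]|[_ nex]]]; last by case: nex; apply/h2.
have S4 : (4 <= S)%N by rewrite /S; lia.
apply: runs_mono (runs_answer s4 S4) _ => s5 [n5 r0 r1 r2 r3].
by left; split=> //; exists (rvar S s4); split=> //; apply/h3.
Qed.

End Search.

Theorem theorem7 (R : realType) :
  exists (prog : cmd) (a k : nat),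
    forall N : network R,
      plane_network N -> connected_network N ->
      exists (t : nat) (s : state R),
        [/\ exec prog (network_input N) t s,
            (t <= a * network_size N ^ k)%N,
            nmem s 0%N = 1%N <-> (exists p q : R * R, is_shortcut N p q)
          & (exists p q : R * R, is_shortcut N p q) ->
            is_shortcut N (rmem s 0%N, rmem s 1%N) (rmem s 2%N, rmem s 3%N)].
Proof.
have [S [f0 [f1 [f2 [f3 [T bT hsearch]]]]]] := @shortcut_search R.
exists (main_program S f0 f1 f2 f3).
have [a [k hak]] : polybounded (fun z => (table_time z + T z) + 1)%N.
  apply: polybounded_add; last exact: polybounded_const.
  by apply: polybounded_add => //; apply: polybounded_table_time.
exists a, k => N plane conn; set z := network_size N.
have z0 : (0 < z)%N by rewrite /z /network_size addn_gt0; case: conn => ->.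
suff [t [s [et ht [h1 h2]]]] : runs (main_program S f0 f1 f2 f3) (network_input N)
    ((table_time z + T z) + 1) (fun s =>
      (nmem s 0%N = 1%N <-> (exists p q : R * R, is_shortcut N p q)) /\
      ((exists p q : R * R, is_shortcut N p q) ->
        is_shortcut N (rmem s 0%N, rmem s 1%N) (rmem s 2%N, rmem s 3%N))).
  by exists t, s; split=> //; apply: leq_trans ht (hak z z0).
rewrite addn1; apply: runs_if.
have -> : beval (network_input N) (BNLe (NConst 1) (NLoad (NConst 1))) =
  (0 < size (edges N))%N by [].
(* Without edges the index quantifiers would range over the empty set, so the program answers this
   case directly. *)
case: ltnP => [m0|]; last first.
  rewrite leqn0 size_eq0 => /eqP E.
  have no : ~ exists p q : R * R, is_shortcut N p q.
    by move=> [p [q /(no_edge_no_shortcut conn E)]].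
  apply: (runs_le (T := 1)); last first.
    by rewrite /table_time -!addnA; lia.
  by apply: runs_nstore; split=> [|/no//]; split=> // /no.
have has_edge : edges N != [::] by rewrite -size_eq0 -lt0n.
have nz : (nvert N <= z)%N by apply: leq_addr.
have mz : (size (edges N) <= z)%N by apply: leq_addl.
apply: runs_seq; apply: runs_mono (runs_tables S plane conn has_edge nz mz) _.
move=> s1 [v1 b1 [D dt st]].
have A0 : (0 < ibound (struct_of S s1))%N by rewrite b1.
have Az : (ibound (struct_of S s1) <= z)%N by rewrite b1.
apply: runs_mono (hsearch _ s1 z A0 z0 Az erefl v1) _ => s2.
have hS ro : holds (struct_of S s1) (fun=> 0%N) ro FShortcut <->
    is_shortcut N (seg_start ro) (seg_stop ro).
  by rewrite (holds_shortcut plane conn has_edge dt st) (shortcutP conn has_edge).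
move=> [[-> [ro [/hS hro -> -> -> ->]]]|[-> nex]].
  by split=> //; split=> // _; exists (seg_start ro), (seg_stop ro).
have no : ~ exists p q : R * R, is_shortcut N p q.
  move=> [[x0 x1] [[x2 x3] h]]; apply: nex; exists x0, x1, x2, x3.
  exact/hS.
by split=> [|/no//]; split=> // /no.
Qed.
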